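(* For every $\varepsilon>0$ there is an algorithm which, given an instance $\mathcal{I}=(G_{\mathrm{conn}},G_{\mathrm{cov}},k,t)$ of Partial Connected Red-Blue Dominating Set in which the coverage graph $G_{\mathrm{cov}}$ is $K_{d,d}$-free (and $G_{\mathrm{conn}}$ is arbitrary), runs in time $2^{\mathcal{O}(kd(k^2+\log d))}\cdot|\mathcal{I}|^{\mathcal{O}(1/\varepsilon)}$ and either (i) outputs $S\subseteq R$ with $|S|\le(1+\varepsilon)k$, $G_{\mathrm{conn}}[S]$ connected and $|N_{G_{\mathrm{cov}}}(S)|\ge t$; or (ii) correctly reports that there is no $S\subseteq R$ with $|S|\le k$, $G_{\mathrm{conn}}[S]$ connected and $|N_{G_{\mathrm{cov}}}(S)|\ge t$.
   Context: An instance of Partial Connected Red-Blue Dominating Set is $\mathcal{I}=(G_{\mathrm{conn}},G_{\mathrm{cov}},k,t)$ where $G_{\mathrm{conn}}=(R,E)$ is an arbitrary graph (the connectivity graph), $G_{\mathrm{cov}}=(R\uplus B,E')$ is a bipartite graph with sides $R$ (red) and $B$ (blue) (the coverage graph), and $k,t$ are non-negative integers; the question is whether there is $S\subseteq R$ with $|S|\le k$, $G_{\mathrm{conn}}[S]$ connected and $|N_{G_{\mathrm{cov}}}(S)|\ge t$. For an integer $d\ge1$, $G_{\mathrm{cov}}$ is $K_{d,d}$-free if it contains no $K_{d,d}$ subgraph, i.e., no $d$ red vertices have $d$ common blue neighbours. $|\mathcal{I}|$ denotes the input size. *)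

(* Defs.v *)
From mathcomp Require Import all_boot.

Set Implicit Arguments.
Unset Strict Implicit.
Unset Printing Implicit Defensive.

(** * Machine model

    A random access machine with structured control flow: one unbounded memory
    of natural numbers, indirect addressing, addition and truncated subtraction
    as the only arithmetic (in particular no unit-cost multiplication), and
    uniform cost.  Up to polynomial overhead this is the usual RAM, hence also
    the multitape Turing machine. *)

Definition memory := nat -> nat.

Inductive expr : Type :=
| Cst of nat
| Mem of expr
| Add of expr & expr
| Sub of expr & expr.

Fixpoint eval (m : memory) (e : expr) : nat :=
  match e with
  | Cst c => c
  | Mem a => m (eval m a)
  | Add e1 e2 => eval m e1 + eval m e2
  | Sub e1 e2 => eval m e1 - eval m e2
  end.

Fixpoint ecost (e : expr) : nat :=
  match e with
  | Cst _ => 1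
  | Mem a => (ecost a).+1
  | Add e1 e2 | Sub e1 e2 => (ecost e1 + ecost e2).+1
  end.

Inductive program : Type :=
| Skip
| Store of expr & expr
| Seq of program & program
| If of expr & program & program
| While of expr & program.

(** [exec p m n m'] : started in memory [m], the program [p] halts after
    exactly [n] steps in memory [m'].  Zero is read as "false" in tests. *)
Inductive exec : program -> memory -> nat -> memory -> Prop :=
| ExecSkip m :
    exec Skip m 1 m
| ExecStore a e m :
    exec (Store a e) m (ecost a + ecost e).+1
         [eta m with eval m a |-> eval m e]
| ExecSeq p q m n1 m1 n2 m2 :
    exec p m n1 m1 -> exec q m1 n2 m2 ->
    exec (Seq p q) m (n1 + n2) m2
| ExecIfTrue e p q m n m1 :
    eval m e != 0 -> exec p m n m1 ->
    exec (If e p q) m (ecost e + n).+1 m1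
| ExecIfFalse e p q m n m1 :
    eval m e = 0 -> exec q m n m1 ->
    exec (If e p q) m (ecost e + n).+1 m1
| ExecWhileTrue e p m n1 m1 n2 m2 :
    eval m e != 0 -> exec p m n1 m1 -> exec (While e p) m1 n2 m2 ->
    exec (While e p) m (ecost e + n1 + n2).+1 m2
| ExecWhileFalse e p m :
    eval m e = 0 ->
    exec (While e p) m (ecost e).+1 m.

(** The halting time and the final memory are determined by the program and
    the initial memory, so that bounding some execution bounds the running
    time. *)
Lemma exec_det p m n1 m1 n2 m2 :
  exec p m n1 m1 -> exec p m n2 m2 -> n1 = n2 /\ m1 = m2.
Proof.
move=> E; elim: E n2 m2 => {p m n1 m1}.
- by move=> m n2 m2 E; inversion E.
- by move=> a e m n2 m2 E; inversion E.
- move=> p q m n1 m1 n2 m2 _ IH1 _ IH2 n m' E; inversion E; subst.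
  match goal with H : exec p _ _ _ |- _ => case: (IH1 _ _ H) => ? ?; subst end.
  by match goal with H : exec q _ _ _ |- _ => case: (IH2 _ _ H) => ? ?; subst end.
- move=> e p q m n m1 ne _ IH n2 m2 E; inversion E; subst; last first.
    by match goal with H : eval _ _ = 0 |- _ => rewrite H in ne end.
  by match goal with H : exec p _ _ _ |- _ => case: (IH _ _ H) => -> -> end.
- move=> e p q m n m1 e0 _ IH n2 m2 E; inversion E; subst.
    by match goal with H : is_true (eval _ _ != 0) |- _ => rewrite e0 in H end.
  by match goal with H : exec q _ _ _ |- _ => case: (IH _ _ H) => -> -> end.
- move=> e p m n1 m1 n2 m2 ne _ IH1 _ IH2 n m' E; inversion E; subst; last first.
    by match goal with H : eval _ _ = 0 |- _ => rewrite H in ne end.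
  match goal with H : exec p _ _ _ |- _ => case: (IH1 _ _ H) => ? ?; subst end.
  by match goal with H : exec (While e p) _ _ _ |- _ =>
    case: (IH2 _ _ H) => ? ?; subst end.
- move=> e p m e0 n2 m2 E; inversion E; subst => //.
  by match goal with H : is_true (eval _ _ != 0) |- _ => rewrite e0 in H end.
Qed.

(** * Partial Connected Red-Blue Dominating Set

    The red and the blue vertices are numbered, as they have to be in order to
    be handed to a machine.  The bipartite coverage graph is given by its
    red-blue incidence relation. *)
Record instance : Type := Instance {
  nred : nat;
  nblue : nat;
  conn : rel 'I_nred;
  conn_sym : symmetric conn;
  conn_irr : irreflexive conn;
  cov : 'I_nred -> 'I_nblue -> bool;
  budget : nat;
  demand : nat
}.

(** [G[S]] is connected; the empty set counts as connected. *)
Definition induced_connected (T : finType) (e : rel T) (S : {set T}) : Prop :=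
  {in S &, forall x y,
     connect [rel u v | [&& u \in S, v \in S & e u v]] x y}.

Definition covered (I : instance) (S : {set 'I_(nred I)}) : {set 'I_(nblue I)} :=
  [set b | [exists r in S, cov r b]].

Definition biclique_free (I : instance) (d : nat) : Prop :=
  ~ exists (X : {set 'I_(nred I)}) (Y : {set 'I_(nblue I)}),
      [/\ #|X| = d, #|Y| = d & {in X & Y, forall r b, cov r b}].

Definition bit_length (n : nat) : nat := (trunc_log 2 n).+1.

(** Vertices and edges of both graphs, plus the binary lengths of the two
    integers; each edge of the connectivity graph is counted in both
    directions.  This is always at least 2. *)
Definition instance_size (I : instance) : nat :=
  nred I + nblue I
  + #|[set p : 'I_(nred I) * 'I_(nred I) | conn p.1 p.2]|
  + #|[set p : 'I_(nred I) * 'I_(nblue I) | cov p.1 p.2]|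
  + bit_length (budget I) + bit_length (demand I).

(** * Input and output conventions

    The input consists of the five numbers below, the adjacency matrix of the
    connectivity graph and the red-blue incidence matrix of the coverage graph,
    both in row-major order; all other cells are zero. *)
Definition input_cells (I : instance) (d : nat) : seq nat :=
  [:: nred I; nblue I; budget I; demand I; d]
  ++ [seq nat_of_bool (conn i j) | i <- enum 'I_(nred I), j <- enum 'I_(nred I)]
  ++ [seq nat_of_bool (cov i j) | i <- enum 'I_(nred I), j <- enum 'I_(nblue I)].

Definition input (I : instance) (d : nat) : memory :=
  fun a => nth 0 (input_cells I d) a.

(** Cell 0 of the final memory holds the answer, 1 for a set and 0 for the
    report that there is none; the set itself is given by its characteristic
    vector in the cells 1, ..., [nred I]. *)
Definition output_answer (m : memory) : nat := m 0.

Definition output_set (I : instance) (m : memory) : {set 'I_(nred I)} :=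
  [set i : 'I_(nred I) | m i.+1 != 0].

(* Main.v *)
(** The algorithm runs through all advice strings of O(k d (k^2 + log d) + q log |I|)
    bits, where q > 1/eps, and turns each of them in polynomial time into a
    candidate, which is verified; hence only the existence of a good advice is
    at stake.

    Let S be a solution. The advice names vertices X of S one at a time. As long as
    much remains to be covered, some y in S covers a fraction 1/k of the rest. If y
    has distance more than k/q from X, it is named outright, with log |I| bits; this
    happens at most 2q times, since the balls of radius k/2q around such vertices
    are disjoint in the connected set S. Otherwise y is named by its rank among the
    heavy vertices near X. If this rank exceeds N = d (6k^3)^d, then, because at most
    N red vertices can meet a set in many points when there is no K_{d,d}, one of the
    first heavy vertices u meets what S covers in few points. Adding u costs a path of
    at most k/q vertices, and it yields a surplus, which pays for the approximate
    treatment of the rest.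

    The remaining set of O(k^3 d) blue vertices is split into groups through a perfect
    hash function with O(k^3 d) bits of labels, and a dynamic program along an
    ordering of S as a tree, which is part of the advice, picks for every node a vertex
    that covers as much as possible of the group of that node. Nodes of the same
    group may overlap: large overlaps are suppressed through residues modulo a
    number that tells apart the few vertices in conflict, while small ones are
    outweighed by the surplus. *)

Require Import Defs.
From mathcomp Require Import all_boot all_order all_algebra.
From mathcomp Require Import reals exp.
From mathcomp Require boolp.
From mathcomp Require Import zify lra.
(* Otherwise [Mem] is a constructor of ssrbool instead of [expr]. *)
Import Defs.

Set Implicit Arguments.
Unset Strict Implicit.
Unset Printing Implicit Defensive.

(** * A table language and its compilation *)

Inductive arr : Type :=
  aB | aNR | aQ | aD | aPOW | aDIST | aW | aTOP | aBIT | aX | aVAL | aTR | aFND | aOUT.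

Definition acode (a : arr) : nat :=
  match a with
  | aB => 0 | aNR => 1 | aQ => 2 | aD => 3 | aPOW => 4 | aDIST => 5 | aW => 6
  | aTOP => 7 | aBIT => 8 | aX => 9 | aVAL => 10 | aTR => 11 | aFND => 12 | aOUT => 13
  end.

Lemma acode_inj : injective acode.
Proof. by case; case. Qed.

Lemma acode_lt16 a : (acode a).+2 < 16.
Proof. by case: a. Qed.

Definition state := arr -> nat -> nat.

Definition upd (s : state) (a : arr) (i v : nat) : state :=
  fun a' i' => if (acode a == acode a') && (i == i') then v else s a' i'.

(* Variables are de Bruijn indices. Every loop runs below the content of the
   cell [aB], so that the running time is bounded by the shape of the term. *)
Inductive term : Type :=
| TCst of nat
| TVar of nat
| TArr of arr & term
| TInp of term
| TAdd of term & term
| TSub of term & term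
| TIte of term & term & term
| TSum of term.

Lemma iteriSl T n (f : nat -> T -> T) x :
  iteri n.+1 f x = iteri n (fun i => f i.+1) (f 0 x).
Proof. by elim: n => //= n <-. Qed.

Section Semantics.

Variable inp : nat -> nat.

Fixpoint teval (s : state) (r : seq nat) (t : term) : nat :=
  match t with
  | TCst c => c
  | TVar x => nth 0 r x
  | TArr a t => s a (teval s r t)
  | TInp t => if teval s r t < inp 0 then inp (teval s r t) else 0
  | TAdd t u => teval s r t + teval s r u
  | TSub t u => teval s r t - teval s r u
  | TIte t u v => if teval s r t != 0 then teval s r u else teval s r v
  | TSum t => \sum_(i < s aB 0) teval s (val i :: r) t
  end.

Inductive stmt : Type :=
| SSet of arr & term
| STab of arr & term
| SSeq of stmt & stmt.

Fixpoint srun (c : stmt) (s : state) : state :=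
  match c with
  | SSet a t => upd s a 0 (teval s [::] t)
  | STab a t => iteri (s aB 0) (fun i s => upd s a i (teval s [:: i] t)) s
  | SSeq c d => srun d (srun c s)
  end.

Fixpoint keeps (a : arr) (c : stmt) : bool :=
  match c with
  | SSet b _ | STab b _ => acode b != acode a
  | SSeq c d => keeps a c && keeps a d
  end.

Lemma upd_keeps s a b i v j : acode b != acode a -> upd s b i v a j = s a j.
Proof. by move=> h; rewrite /upd (negbTE h). Qed.

Lemma srun_keeps a c s i : keeps a c -> srun c s a i = s a i.
Proof.
elim: c s => [b t|b t|c ihc d ihd] s /=.
- by move=> h; rewrite upd_keeps.
- by move=> h; elim: (s aB 0) => //= n ih; rewrite upd_keeps.
- by case/andP => hc hd; rewrite ihd // ihc.
Qed.

(* Memory layout: cell 0 points behind the input, from where on sixteen arrays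
   are interleaved: registers, loop variables, and the arrays of [arr]. *)
Definition cell (c i : nat) : nat := inp 0 + (16 * i + c).

Definition x16 (e : expr) : expr :=
  let e2 := Add e e in let e4 := Add e2 e2 in let e8 := Add e4 e4 in Add e8 e8.

Definition acell (c : nat) (e : expr) : expr := Add (Mem (Cst 0)) (Add (x16 e) (Cst c)).
Definition ccell (c i : nat) : expr := Add (Mem (Cst 0)) (Cst (16 * i + c)).
Definition rd (c i : nat) : expr := Mem (ccell c i).

Record rep (s : state) (r : seq nat) (m : memory) : Prop := Rep {
  rep_inp : forall a, a < inp 0 -> m a = inp a;
  rep_arr : forall a i, m (cell (acode a).+2 i) = s a i;
  rep_var : forall x, x < size r -> m (cell 1 x) = nth 0 r (size r - x.+1)
}.

Fixpoint tcomp (t : term) (n h : nat) : program :=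
  match t with
  | TCst c => Store (ccell 0 h) (Cst c)
  | TVar x => Store (ccell 0 h) (if x < n then rd 1 (n - x.+1) else Cst 0)
  | TArr a t =>
    Seq (tcomp t n h) (Store (ccell 0 h) (Mem (acell (acode a).+2 (rd 0 h))))
  | TInp t =>
    Seq (tcomp t n h)
        (If (Sub (Mem (Cst 0)) (rd 0 h)) (Store (ccell 0 h) (Mem (rd 0 h)))
            (Store (ccell 0 h) (Cst 0)))
  | TAdd t u =>
    Seq (tcomp t n h)
        (Seq (tcomp u n h.+1) (Store (ccell 0 h) (Add (rd 0 h) (rd 0 h.+1))))
  | TSub t u =>
    Seq (tcomp t n h)
        (Seq (tcomp u n h.+1) (Store (ccell 0 h) (Sub (rd 0 h) (rd 0 h.+1))))
  | TIte t u v => Seq (tcomp t n h) (If (rd 0 h) (tcomp u n h) (tcomp v n h))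
  | TSum t =>
    Seq (Store (ccell 0 h) (Cst 0))
      (Seq (Store (ccell 1 n) (Cst 0))
        (While (Sub (rd (acode aB).+2 0) (rd 1 n))
          (Seq (tcomp t n.+1 h.+1)
            (Seq (Store (ccell 0 h) (Add (rd 0 h) (rd 0 h.+1)))
                 (Store (ccell 1 n) (Add (rd 1 n) (Cst 1)))))))
  end.

Fixpoint tcost (b : nat) (t : term) : nat :=
  match t with
  | TCst _ | TVar _ => 20
  | TArr _ t | TInp t => tcost b t + 200
  | TAdd t u | TSub t u => tcost b t + tcost b u + 50
  | TIte t u v => tcost b t + tcost b u + tcost b v + 50
  | TSum t => b * (tcost b t + 100) + 100
  end.

Hypothesis inp_gt0 : 0 < inp 0.

Lemma eval_Mem m e : eval m (Mem e) = m (eval m e).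
Proof. by []. Qed.

Lemma eval_Add m e f : eval m (Add e f) = eval m e + eval m f.
Proof. by []. Qed.

Lemma eval_Sub m e f : eval m (Sub e f) = eval m e - eval m f.
Proof. by []. Qed.

Lemma exec_store a e m c v : eval m a = c -> eval m e = v ->
  exec (Store a e) m (ecost a + ecost e).+1 [eta m with c |-> v].
Proof. by move=> <- <-; exact: ExecStore. Qed.

Lemma rep0 s r m : rep s r m -> m 0 = inp 0.
Proof. by move=> H; apply: (rep_inp H). Qed.

Lemma eval_rd s r m c i : rep s r m -> eval m (rd c i) = m (cell c i).
Proof. by move=> H; rewrite /= (rep0 H). Qed.

Lemma eval_ccell s r m c i : rep s r m -> eval m (ccell c i) = cell c i.
Proof. by move=> H; rewrite /= (rep0 H). Qed.

Lemma eval_acell s r m c e : rep s r m -> eval m (acell c e) = cell c (eval m e).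
Proof. by move=> H; rewrite /= (rep0 H) /cell; lia. Qed.

Lemma ecost_acell c e : ecost (acell c e) = 16 * ecost e + 20.
Proof. by rewrite /=; lia. Qed.

Lemma cell_inj c c' i i' :
  c < 16 -> c' < 16 -> (cell c i == cell c' i') = (c == c') && (i == i').
Proof. by move=> h h'; rewrite /cell; lia. Qed.

Lemma cell_ge c i : (cell c i < inp 0) = false.
Proof. by rewrite /cell; lia. Qed.

Lemma rep_reg s r m h v : rep s r m -> rep s r [eta m with cell 0 h |-> v].
Proof.
move=> [h1 h2 h3]; split=> [a ha|a i|x hx] /=.
- by case: eqP => [e|_]; [rewrite e cell_ge in ha | exact: h1].
- by rewrite cell_inj ?acode_lt16 //= h2.
- by rewrite cell_inj ?h3.
Qed.

Lemma rep_push s r m v : rep s r m -> rep s (v :: r) [eta m with cell 1 (size r) |-> v].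
Proof.
move=> [h1 h2 h3]; split=> [a ha|a i|x hx] /=.
- by case: eqP => [e|_]; [rewrite e cell_ge in ha | exact: h1].
- by rewrite cell_inj ?acode_lt16 //= h2.
- rewrite cell_inj //=; case: eqP => [->|nx]; first by rewrite subnn.
  have lx : x < size r by rewrite /= in hx; lia.
  have -> : (size r).+1 - x.+1 = (size r - x.+1).+1 by lia.
  by rewrite h3.
Qed.

Lemma rep_pop s r m v : rep s (v :: r) m -> rep s r m.
Proof.
move=> [h1 h2 h3]; split=> // x hx.
have e : (size r).+1 - x.+1 = (size r - x.+1).+1 by lia.
by rewrite h3 /= ?e // ltnS ltnW.
Qed.

Lemma rep_upd s r m a i v : rep s r m ->
  rep (upd s a i v) r [eta m with cell (acode a).+2 i |-> v].
Proof.
move=> [h1 h2 h3]; split=> [b hb|b j|x hx] /=.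
- by case: eqP => [e|_]; [rewrite e cell_ge in hb | exact: h1].
- by rewrite cell_inj ?acode_lt16 // !eqSS /upd [_ == i]eq_sym [_ == acode a]eq_sym h2.
- by rewrite cell_inj ?h3 ?acode_lt16.
Qed.

Lemma tcomp_ok t n h s r m : rep s r m -> size r = n ->
  exists tau m', [/\ exec (tcomp t n h) m tau m', tau <= tcost (s aB 0) t,
    rep s r m', m' (cell 0 h) = teval s r t
    & forall y, y < h -> m' (cell 0 y) = m (cell 0 y)].
Proof.
have regs m1 h1 v y : y < h1 -> [eta m1 with cell 0 h1 |-> v] (cell 0 y) = m1 (cell 0 y).
  by move=> ly; rewrite /= cell_inj //=; case: eqP => // e; lia.
elim: t n h s r m => [c|x|a t iht|t iht|t iht u ihu|t iht u ihu|t iht u ihu v ihv|t iht]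
  n h s r m H sr.
- exists (ecost (ccell 0 h) + ecost (Cst c)).+1, [eta m with cell 0 h |-> c].
  split=> //.
  + exact: exec_store (eval_ccell 0 h H) _.
  + exact: rep_reg.
  + by rewrite /= eqxx.
  + by move=> y ly; rewrite regs.
- exists (ecost (ccell 0 h) + ecost (if x < n then rd 1 (n - x.+1) else Cst 0)).+1.
  exists [eta m with cell 0 h |-> nth 0 r x].
  have E : eval m (if x < n then rd 1 (n - x.+1) else Cst 0) = nth 0 r x.
    case: ltnP => hx; last by rewrite nth_default ?sr.
    rewrite (eval_rd _ _ H) (rep_var H) sr; last by lia.
    by congr nth; lia.
  split.
  + exact: exec_store (eval_ccell 0 h H) E.
  + by rewrite /=; case: ifP.
  + exact: rep_reg.
  + by rewrite /= eqxx.
  + by move=> y ly; rewrite regs.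
- have [t1 [m1 [e1 c1 r1 v1 k1]]] := iht n h s r m H sr.
  exists (t1 + (ecost (ccell 0 h) + ecost (Mem (acell (acode a).+2 (rd 0 h)))).+1).
  exists [eta m1 with cell 0 h |-> s a (teval s r t)].
  split.
  + apply: ExecSeq e1 _.
    have E : eval m1 (Mem (acell (acode a).+2 (rd 0 h))) = s a (teval s r t).
      by rewrite eval_Mem (eval_acell _ _ r1) (eval_rd _ _ r1) v1 (rep_arr r1).
    exact: exec_store (eval_ccell 0 h r1) E.
  + by rewrite /=; lia.
  + exact: rep_reg.
  + by rewrite /= eqxx.
  + by move=> y ly; rewrite regs // k1.
- have [t1 [m1 [e1 c1 r1 v1 k1]]] := iht n h s r m H sr.
  case: (ltnP (teval s r t) (inp 0)) => hl.
  + exists (t1 + (ecost (Sub (Mem (Cst 0)) (rd 0 h))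
      + (ecost (ccell 0 h) + ecost (Mem (rd 0 h))).+1).+1).
    exists [eta m1 with cell 0 h |-> inp (teval s r t)]; split.
    * apply: ExecSeq e1 _; apply: ExecIfTrue.
        by rewrite eval_Sub (eval_rd _ _ r1) v1 /= (rep0 r1); lia.
      have E : eval m1 (Mem (rd 0 h)) = inp (teval s r t).
        rewrite eval_Mem (eval_rd _ _ r1) v1.
        exact: (rep_inp r1).
      exact: exec_store (eval_ccell 0 h r1) E.
    * by rewrite /=; lia.
    * exact: rep_reg.
    * by rewrite /= eqxx hl.
    * by move=> y ly; rewrite regs // k1.
  + exists (t1 + (ecost (Sub (Mem (Cst 0)) (rd 0 h))
      + (ecost (ccell 0 h) + ecost (Cst 0)).+1).+1).
    exists [eta m1 with cell 0 h |-> 0]; split.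
    * apply: ExecSeq e1 _; apply: ExecIfFalse.
        by rewrite eval_Sub (eval_rd _ _ r1) v1 /= (rep0 r1); lia.
      exact: exec_store (eval_ccell 0 h r1) _.
    * by rewrite /=; lia.
    * exact: rep_reg.
    * by rewrite /= eqxx ltnNge hl.
    * by move=> y ly; rewrite regs // k1.
- have [t1 [m1 [e1 c1 r1 v1 k1]]] := iht n h s r m H sr.
  have [t2 [m2 [e2 c2 r2 v2 k2]]] := ihu n h.+1 s r m1 r1 sr.
  exists (t1 + (t2 + (ecost (ccell 0 h) + ecost (Add (rd 0 h) (rd 0 h.+1))).+1)).
  exists [eta m2 with cell 0 h |-> teval s r t + teval s r u]; split.
  + apply: ExecSeq e1 _; apply: ExecSeq e2 _.
    have E : eval m2 (Add (rd 0 h) (rd 0 h.+1)) = teval s r t + teval s r u.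
      rewrite ?(eval_Add, eval_Sub) !(eval_rd _ _ r2).
      by rewrite v2 k2 // v1.
    exact: exec_store (eval_ccell 0 h r2) E.
  + by rewrite /=; lia.
  + exact: rep_reg.
  + by rewrite /= eqxx.
  + by move=> y ly; rewrite regs // k2 ?k1 //; lia.
- have [t1 [m1 [e1 c1 r1 v1 k1]]] := iht n h s r m H sr.
  have [t2 [m2 [e2 c2 r2 v2 k2]]] := ihu n h.+1 s r m1 r1 sr.
  exists (t1 + (t2 + (ecost (ccell 0 h) + ecost (Sub (rd 0 h) (rd 0 h.+1))).+1)).
  exists [eta m2 with cell 0 h |-> teval s r t - teval s r u]; split.
  + apply: ExecSeq e1 _; apply: ExecSeq e2 _.
    have E : eval m2 (Sub (rd 0 h) (rd 0 h.+1)) = teval s r t - teval s r u.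
      rewrite ?(eval_Add, eval_Sub) !(eval_rd _ _ r2).
      by rewrite v2 k2 // v1.
    exact: exec_store (eval_ccell 0 h r2) E.
  + by rewrite /=; lia.
  + exact: rep_reg.
  + by rewrite /= eqxx.
  + by move=> y ly; rewrite regs // k2 ?k1 //; lia.
- have [t1 [m1 [e1 c1 r1 v1 k1]]] := iht n h s r m H sr.
  have [z|nz] := eqVneq (teval s r t) 0.
  + have [t2 [m2 [e2 c2 r2 v2 k2]]] := ihv n h s r m1 r1 sr.
    exists (t1 + (ecost (rd 0 h) + t2).+1), m2; split=> //.
    * apply: ExecSeq e1 _; apply: ExecIfFalse e2.
      by rewrite (eval_rd _ _ r1) v1.
    * by rewrite /=; lia.
    * by rewrite /= z.
    * by move=> y ly; rewrite k2 // k1.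
  + have [t2 [m2 [e2 c2 r2 v2 k2]]] := ihu n h s r m1 r1 sr.
    exists (t1 + (ecost (rd 0 h) + t2).+1), m2; split=> //.
    * apply: ExecSeq e1 _; apply: ExecIfTrue e2.
      by rewrite (eval_rd _ _ r1) v1.
    * by rewrite /=; lia.
    * by rewrite /= nz.
    * by move=> y ly; rewrite k2 // k1.
- rewrite [tcomp _ _ _]/=; set loop := While _ _.
  have L j i m1 : i + j = s aB 0 -> rep s (i :: r) m1 ->
      m1 (cell 0 h) = \sum_(l < i) teval s (val l :: r) t ->
      exists tau m', [/\ exec loop m1 tau m', tau <= j * (tcost (s aB 0) t + 100) + 20,
        rep s r m', m' (cell 0 h) = \sum_(l < s aB 0) teval s (val l :: r) t
        & forall y, y < h -> m' (cell 0 y) = m1 (cell 0 y)].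
    elim: j i m1 => [|j ihj] i m1 ij H1 a1.
      exists (ecost (Sub (rd (acode aB).+2 0) (rd 1 n))).+1, m1; split=> //.
      + apply: ExecWhileFalse.
        rewrite ?(eval_Add, eval_Sub) !(eval_rd _ _ H1).
        rewrite (rep_arr H1 aB) (rep_var H1) /= -?sr // subSS subnn /=; lia.
      + exact: rep_pop H1.
      + by rewrite a1; have -> : i = s aB 0 by lia.
    have [t1 [m2 [e1 c1 r1 v1 k1]]] := iht n.+1 h.+1 s (i :: r) m1 H1 (congr1 S sr).
    have r2 := rep_reg h (m2 (cell 0 h) + m2 (cell 0 h.+1)) r1.
    set m3 := [eta m2 with _ |-> _] in r2.
    have vn : m3 (cell 1 n) = i.
      by rewrite (rep_var r2) /= -?sr // subSS subnn.
    have r3 := rep_push i.+1 (rep_pop r2).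
    have [||t4 [m4 [e4 c4 r4 v4 k4]]] := ihj i.+1 _ _ r3; first by lia.
      rewrite big_ord_recr /= cell_inj //= eqxx v1 k1 // a1.
      by [].
    exists (ecost (Sub (rd (acode aB).+2 0) (rd 1 n)) +
      (t1 + ((ecost (ccell 0 h) + ecost (Add (rd 0 h) (rd 0 h.+1))).+1
          + (ecost (ccell 1 n) + ecost (Add (rd 1 n) (Cst 1))).+1)) + t4).+1, m4.
    split=> //.
    + apply: ExecWhileTrue e4.
        rewrite ?(eval_Add, eval_Sub) !(eval_rd _ _ H1).
        rewrite (rep_arr H1 aB) (rep_var H1) /= -?sr // subSS subnn /=; lia.
      apply: ExecSeq e1 _; apply: (@ExecSeq _ _ _ _ m3).
        have E : eval m2 (Add (rd 0 h) (rd 0 h.+1)) = m2 (cell 0 h) + m2 (cell 0 h.+1).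
          rewrite eval_Add.
          by rewrite !(eval_rd _ _ r1).
        exact: exec_store (eval_ccell 0 h r1) E.
      have E : eval m3 (Add (rd 1 n) (Cst 1)) = i.+1.
        by rewrite ?(eval_Add, eval_Sub) (eval_rd _ _ r2) vn /= addn1.
      by apply: (exec_store _ E); rewrite (eval_ccell 1 n r2) sr.
    + by rewrite /=; nia.
    + move=> y ly; rewrite k4 //= !cell_inj //=.
      by case: eqP => [e|_]; [lia | rewrite k1 //; lia].
  have r1 := rep_reg h 0 H; set m1 := [eta m with _ |-> _] in r1.
  have r2 := rep_push 0 r1.
  have [|t3 [m3 [e3 c3 r3 v3 k3]]] := L (s aB 0) 0 _ erefl r2.
    by rewrite big_ord0 /= !cell_inj //= eqxx.
  exists ((ecost (ccell 0 h) + ecost (Cst 0)).+1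
     + ((ecost (ccell 1 n) + ecost (Cst 0)).+1 + t3)), m3; split=> //.
  + apply: (@ExecSeq _ _ _ _ m1).
      exact: exec_store (eval_ccell 0 h H) _.
    apply: ExecSeq e3.
    by apply: exec_store; rewrite // (eval_ccell 1 n r1) sr.
  + by rewrite /=; nia.
  + move=> y ly; rewrite k3 //= !cell_inj //=.
    by case: eqP => [e|//]; lia.
Qed.

Fixpoint scomp (c : stmt) : program :=
  match c with
  | SSet a t => Seq (tcomp t 0 0) (Store (ccell (acode a).+2 0) (rd 0 0))
  | STab a t =>
    Seq (Store (ccell 1 0) (Cst 0))
      (While (Sub (rd (acode aB).+2 0) (rd 1 0))
        (Seq (tcomp t 1 0)
          (Seq (Store (acell (acode a).+2 (rd 1 0)) (rd 0 0))
               (Store (ccell 1 0) (Add (rd 1 0) (Cst 1))))))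
  | SSeq c d => Seq (scomp c) (scomp d)
  end.

Fixpoint scost (b : nat) (c : stmt) : nat :=
  match c with
  | SSet _ t => tcost b t + 100
  | STab _ t => b * (tcost b t + 200) + 100
  | SSeq c d => scost b c + scost b d
  end.

Lemma sset_ok a t s m : rep s [::] m ->
  exists tau m', [/\ exec (scomp (SSet a t)) m tau m', tau <= scost (s aB 0) (SSet a t)
    & rep (srun (SSet a t) s) [::] m'].
Proof.
move=> H; have [t1 [m1 [e1 c1 r1 v1 _]]] := tcomp_ok t 0 H erefl.
exists (t1 + (ecost (ccell (acode a).+2 0) + ecost (rd 0 0)).+1).
exists [eta m1 with cell (acode a).+2 0 |-> teval s [::] t]; split.
- apply: ExecSeq e1 _; apply: exec_store; first exact: eval_ccell r1.
  by rewrite (eval_rd _ _ r1) v1.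
- by rewrite /=; lia.
- exact: rep_upd.
Qed.

Lemma scomp_ok c s m : keeps aB c -> rep s [::] m ->
  exists tau m', [/\ exec (scomp c) m tau m', tau <= scost (s aB 0) c
    & rep (srun c s) [::] m'].
Proof.
elim: c s m => [a t|a t|c ihc d ihd] s m.
- by move=> _; exact: sset_ok.
- move=> ka H; rewrite [scomp _]/=; set loop := While _ _.
  pose f i s := upd s a i (teval s [:: i] t).
  have L j i s1 m1 : i + j = s aB 0 -> s1 aB 0 = s aB 0 -> rep s1 [:: i] m1 ->
      exists tau m', [/\ exec loop m1 tau m',
        tau <= j * (tcost (s aB 0) t + 200) + 20
        & rep (iteri j (fun l => f (i + l)) s1) [::] m'].
    elim: j i s1 m1 => [|j ihj] i s1 m1 ij b1 H1.
      exists (ecost (Sub (rd (acode aB).+2 0) (rd 1 0))).+1, m1; split=> //.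
        apply: ExecWhileFalse.
        rewrite ?(eval_Add, eval_Sub) !(eval_rd _ _ H1).
        by rewrite (rep_arr H1 aB) (rep_var H1) //= b1; lia.
      exact: rep_pop H1.
    have [t1 [m2 [e1 c1 r1 v1 k1]]] := tcomp_ok t 0 H1 erefl.
    have r2 := rep_upd a i (m2 (cell 0 0)) r1; set m3 := [eta m2 with _ |-> _] in r2.
    have v2 : m2 (cell 1 0) = i := rep_var r1 (isT : 0 < size [:: i]).
    have v3 : m3 (cell 1 0) = i := rep_var r2 (isT : 0 < size [:: i]).
    have r3 := rep_push i.+1 (rep_pop r2).
    have [||t4 [m4 [e4 c4 r4]]] := ihj i.+1 _ _ _ _ r3; first by lia.
      by rewrite upd_keeps.
    exists (ecost (Sub (rd (acode aB).+2 0) (rd 1 0)) +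
      (t1 + ((ecost (acell (acode a).+2 (rd 1 0)) + ecost (rd 0 0)).+1
          + (ecost (ccell 1 0) + ecost (Add (rd 1 0) (Cst 1))).+1)) + t4).+1, m4.
    split.
    + apply: ExecWhileTrue e4.
        rewrite ?(eval_Add, eval_Sub) !(eval_rd _ _ H1).
        by rewrite (rep_arr H1 aB) (rep_var H1) //= b1; lia.
      apply: ExecSeq e1 _; apply: (@ExecSeq _ _ _ _ m3).
        by apply: exec_store; rewrite ?(eval_acell _ _ r1) (eval_rd _ _ r1) ?v2.
      apply: exec_store; first exact: eval_ccell r2.
      by rewrite eval_Add (eval_rd _ _ r2) v3 /= addn1.
    + by rewrite b1 in c1; rewrite ecost_acell /=; nia.
    + rewrite iteriSl addn0 /f -v1 -/(f _).
      rewrite (@eq_iteri _ _ (fun l => f (i.+1 + l))) // => l z.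
      by rewrite addnS.
  have r1 := rep_push 0 H.
  have [||t3 [m3 [e3 c3 r3]]] := L (s aB 0) 0 _ _ _ _ r1 => //.
  exists ((ecost (ccell 1 0) + ecost (Cst 0)).+1 + t3), m3; split=> //.
  + by apply: ExecSeq e3; apply: exec_store; rewrite // (eval_ccell _ _ H).
  + by rewrite /=; nia.
- rewrite /= => /andP [kc kd] H.
  have [t1 [m1 [e1 c1 r1]]] := ihc s m kc H.
  have [t2 [m2 [e2 c2 r2]]] := ihd _ m1 kd r1.
  exists (t1 + t2), m2; split=> //; first exact: ExecSeq e1 e2.
  by rewrite srun_keeps // in c2; rewrite leq_add.
Qed.

Definition wloop (c : stmt) : program :=
  While (Sub (rd (acode aTOP).+2 0) (rd (acode aW).+2 0)) (scomp c).

Lemma wloop_ok c s m : keeps aB c -> keeps aTOP c ->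
  (forall s, srun c s aW 0 = (s aW 0).+1) -> rep s [::] m ->
  exists tau m', [/\ exec (wloop c) m tau m',
    tau <= (s aTOP 0 - s aW 0) * (scost (s aB 0) c + 20) + 20
    & rep (iter (s aTOP 0 - s aW 0) (srun c) s) [::] m'].
Proof.
move=> kB kT hW; move En : (s aTOP 0 - s aW 0) => n.
elim: n s m En => [|n ih] s m En H.
- exists (ecost (Sub (rd (acode aTOP).+2 0) (rd (acode aW).+2 0))).+1, m; split=> //.
  apply: ExecWhileFalse.
  by rewrite eval_Sub !(eval_rd _ _ H) !(rep_arr H) En.
- have [t1 [m1 [e1 c1 r1]]] := scomp_ok kB H.
  have [|t2 [m2 [e2 c2 r2]]] := ih (srun c s) m1 _ r1.
    by rewrite srun_keeps // hW; lia.
  rewrite srun_keeps // in c2.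
  exists (ecost (Sub (rd (acode aTOP).+2 0) (rd (acode aW).+2 0)) + t1 + t2).+1, m2.
  split.
  + apply: ExecWhileTrue e1 e2.
    by rewrite eval_Sub !(eval_rd _ _ H) !(rep_arr H) En.
  + by rewrite /=; nia.
  + by rewrite iterSr.
Qed.

End Semantics.

Lemma leq_add_mul a b c k1 k2 p1 p2 : 0 < p1 -> 0 < p2 ->
  a <= k1 * p1 -> b <= k2 * p2 -> a + b + c <= (k1 + k2 + c) * (p1 * p2).
Proof.
move=> h1 h2 ha hb.
have e1 : k1 * p1 <= k1 * (p1 * p2) by rewrite leq_mul2l leq_pmulr ?orbT.
have e2 : k2 * p2 <= k2 * (p1 * p2) by rewrite leq_mul2l leq_pmull ?orbT.
have e3 : c <= c * (p1 * p2) by rewrite leq_pmulr // muln_gt0 h1.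
by rewrite !mulnDl; lia.
Qed.

Lemma tcost_poly t : exists K D, forall b, tcost b t <= K * b.+1 ^ D.
Proof.
have comb (f g : nat -> nat) c : (exists K D, forall b, f b <= K * b.+1 ^ D) ->
    (exists K D, forall b, g b <= K * b.+1 ^ D) ->
    exists K D, forall b, f b + g b + c <= K * b.+1 ^ D.
  move=> [K1 [D1 h1]] [K2 [D2 h2]]; exists (K1 + K2 + c), (D1 + D2) => b.
  by rewrite expnD; apply: leq_add_mul; rewrite ?expn_gt0.
have cst c : exists K D, forall b : nat, c <= K * b.+1 ^ D.
  by exists c, 0 => b; rewrite expn0 muln1.
elim: t => [c|x|a t ih|t ih|t iht u ihu|t iht u ihu|t iht u ihu v ihv|t ih] /=.
- exact: cst.
- exact: cst.
- have [K [D h]] := comb _ _ 200 ih (cst 0).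
  by exists K, D => b; apply: leq_trans (h b); rewrite addn0.
- have [K [D h]] := comb _ _ 200 ih (cst 0).
  by exists K, D => b; apply: leq_trans (h b); rewrite addn0.
- exact: comb.
- exact: comb.
- have [K [D h]] := comb _ _ 50 (comb _ _ 0 iht ihu) ihv.
  by exists K, D => b; apply: leq_trans (h b); rewrite addn0.
- have [K [D h]] := ih; exists (K + 200), D.+1 => b.
  have := h b; have p1 : 0 < b.+1 ^ D by rewrite expn_gt0.
  by rewrite expnS; nia.
Qed.

Lemma scost_poly c : exists K D, forall b, scost b c <= K * b.+1 ^ D.
Proof.
elim: c => [a t|a t|c [K1 [D1 h1]] d [K2 [D2 h2]]] /=.
- have [K [D h]] := tcost_poly t; exists (K + 100), D => b.
  have := h b; have p1 : 0 < b.+1 ^ D by rewrite expn_gt0.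
  by nia.
- have [K [D h]] := tcost_poly t; exists (K + 400), D.+1 => b.
  have := h b; have p1 : 0 < b.+1 ^ D by rewrite expn_gt0.
  by rewrite expnS; nia.
- exists (K1 + K2), (D1 + D2) => b.
  rewrite -[scost b c + _]addn0 expnD -[K1 + K2]addn0.
  by apply: leq_add_mul; rewrite ?expn_gt0.
Qed.

(** * Functions given by terms *)

Definition mach : Type := ((nat -> nat) * state)%type.

Definition bound (z : mach) : nat := z.2 aB 0.

Definition Comp (F : mach -> seq nat -> nat) : Prop :=
  exists t, forall z r, teval z.1 z.2 r t = F z r.

Fixpoint tren (f : nat -> nat) (t : term) : term :=
  match t with
  | TCst c => TCst c
  | TVar x => TVar (f x)
  | TArr a t => TArr a (tren f t)
  | TInp t => TInp (tren f t)
  | TAdd t u => TAdd (tren f t) (tren f u)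
  | TSub t u => TSub (tren f t) (tren f u)
  | TIte t u v => TIte (tren f t) (tren f u) (tren f v)
  | TSum t => TSum (tren (fun x => if x is y.+1 then (f y).+1 else 0) t)
  end.

Lemma teval_ren inp s t f r r' : (forall x, nth 0 r' x = nth 0 r (f x)) ->
  teval inp s r (tren f t) = teval inp s r' t.
Proof.
elim: t f r r' => [c|x|a t ih|t ih|t iht u ihu|t iht u ihu|t iht u ihu v ihv|t ih] f r r' h //=;
  rewrite ?(ih _ _ _ h) ?(iht _ _ _ h) ?(ihu _ _ _ h) ?(ihv _ _ _ h) //.
by apply: eq_bigr => i _; apply: ih => -[|x] /=.
Qed.

Lemma comp_weak F : Comp F -> Comp (fun z r => F z (behead r)).
Proof.
move=> [t ht]; exists (tren S t) => z r; rewrite -ht; apply: teval_ren => x.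
by rewrite nth_behead.
Qed.

Lemma comp_cst c : Comp (fun _ _ => c).
Proof. by exists (TCst c). Qed.

Lemma comp_var : Comp (fun _ r => head 0 r).
Proof. by exists (TVar 0) => z [|x r]. Qed.

Lemma comp_arr a F : Comp F -> Comp (fun z r => z.2 a (F z r)).
Proof. by move=> [t ht]; exists (TArr a t) => z r /=; rewrite ht. Qed.

Definition rdinp (z : mach) (a : nat) : nat := if a < z.1 0 then z.1 a else 0.

Lemma comp_inp F : Comp F -> Comp (fun z r => rdinp z (F z r)).
Proof. by move=> [t ht]; exists (TInp t) => z r /=; rewrite ht. Qed.

Lemma comp_add F G : Comp F -> Comp G -> Comp (fun z r => F z r + G z r).
Proof. by move=> [t ht] [u hu]; exists (TAdd t u) => z r /=; rewrite ht hu. Qed.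

Lemma comp_sub F G : Comp F -> Comp G -> Comp (fun z r => F z r - G z r).
Proof. by move=> [t ht] [u hu]; exists (TSub t u) => z r /=; rewrite ht hu. Qed.

Lemma comp_if (P : mach -> seq nat -> bool) F G :
  Comp (fun z r => P z r) -> Comp F -> Comp G ->
  Comp (fun z r => if P z r then F z r else G z r).
Proof.
move=> [p hp] [t ht] [u hu]; exists (TIte p t u) => z r /=.
by rewrite hp ht hu; case: (P z r).
Qed.

Lemma comp_sumB (F : mach -> seq nat -> nat -> nat) :
  Comp (fun z r => F z (behead r) (head 0 r)) ->
  Comp (fun z r => \sum_(i < bound z) F z r i).
Proof.
by move=> [t ht]; exists (TSum t) => z r /=; apply: eq_bigr => i _; rewrite ht.
Qed.

Lemma comp_ext F G : (forall z r, F z r = G z r) -> Comp F -> Comp G.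
Proof. by move=> e [t ht]; exists t => z r; rewrite ht e. Qed.

Lemma comp_leq F G : Comp F -> Comp G -> Comp (fun z r => F z r <= G z r).
Proof.
move=> hF hG; apply: (comp_ext (F := fun z r => 1 - (F z r - G z r))) => [z r|].
  by case: leqP; lia.
by apply: comp_sub (comp_cst 1) _; apply: comp_sub.
Qed.

Lemma comp_neg (P : mach -> seq nat -> bool) :
  Comp (fun z r => P z r) -> Comp (fun z r => ~~ P z r).
Proof.
move=> hP; apply: (comp_ext (F := fun z r => 1 - P z r)) => [z r|]; first by case: (P z r).
exact: comp_sub (comp_cst 1) hP.
Qed.

Lemma comp_and (P Q : mach -> seq nat -> bool) :
  Comp (fun z r => P z r) -> Comp (fun z r => Q z r) -> Comp (fun z r => P z r && Q z r).
Proof.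
move=> hP hQ; apply: (comp_ext (F := fun z r => if P z r then Q z r : nat else 0)).
  by move=> z r; case: (P z r).
exact: comp_if hP hQ (comp_cst 0).
Qed.

Lemma comp_or (P Q : mach -> seq nat -> bool) :
  Comp (fun z r => P z r) -> Comp (fun z r => Q z r) -> Comp (fun z r => P z r || Q z r).
Proof.
move=> hP hQ; apply: (comp_ext (F := fun z r => if P z r then 1 else Q z r : nat)).
  by move=> z r; case: (P z r).
exact: comp_if hP (comp_cst 1) hQ.
Qed.

Lemma comp_imp (P Q : mach -> seq nat -> bool) :
  Comp (fun z r => P z r) -> Comp (fun z r => Q z r) -> Comp (fun z r => P z r ==> Q z r).
Proof.
move=> hP hQ; apply: (comp_ext (F := fun z r => if P z r then Q z r : nat else 1)).
  by move=> z r; case: (P z r).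
exact: comp_if hP hQ (comp_cst 1).
Qed.

Lemma comp_eq F G : Comp F -> Comp G -> Comp (fun z r => F z r == G z r).
Proof.
move=> hF hG; apply: (comp_ext (F := fun z r => (F z r <= G z r) && (G z r <= F z r))).
  by move=> z r; rewrite eqn_leq.
by apply: (comp_and (P := fun z r => F z r <= G z r)); apply: comp_leq.
Qed.

Lemma comp_succ F : Comp F -> Comp (fun z r => (F z r).+1).
Proof.
move=> hF; apply: (comp_ext (F := fun z r => F z r + 1)) => [z r|]; first by rewrite addn1.
exact: comp_add hF (comp_cst 1).
Qed.

Lemma comp_pred F : Comp F -> Comp (fun z r => (F z r).-1).
Proof.
move=> hF; apply: (comp_ext (F := fun z r => F z r - 1)) => [z r|]; first by rewrite subn1.
exact: comp_sub hF (comp_cst 1).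
Qed.

(* Sums, quantifiers and searches below [n], cut off at the loop bound [b]. *)
Definition Sm (b n : nat) (F : nat -> nat) : nat := \sum_(i < minn n b) F i.
Definition Hs (b n : nat) (P : pred nat) : bool := has P (iota 0 (minn n b)).
Definition Al (b n : nat) (P : pred nat) : bool := all P (iota 0 (minn n b)).
Definition Fd (b n : nat) (P : pred nat) : nat := find P (iota 0 (minn n b)).
Definition Ml (b x y : nat) : nat := minn x b * y.
Definition Dv (b x y : nat) : nat := minn (x %/ y) b.
Definition Md (b x y : nat) : nat := x - Dv b x y * y.

Lemma sum_if_lt b n (F : nat -> nat) :
  \sum_(i < b) (if i < n then F i else 0) = \sum_(i < minn n b) F i.
Proof.
rewrite -big_mkcond /=; case: (leqP n b) => h.
  by rewrite (big_ord_widen _ _ h).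
by apply: eq_bigl => i; rewrite (ltn_trans (ltn_ord i) h).
Qed.

Lemma comp_Sm N (F : mach -> seq nat -> nat -> nat) :
  Comp N -> Comp (fun z r => F z (behead r) (head 0 r)) ->
  Comp (fun z r => Sm (bound z) (N z r) (F z r)).
Proof.
move=> hN hF; apply: (comp_ext (F := fun z r =>
    \sum_(i < bound z) (if i < N z r then F z r i else 0))).
  by move=> z r; rewrite sum_if_lt.
apply: (comp_sumB (F := fun z r i => if i < N z r then F z r i else 0)).
apply: (comp_if (P := fun z r => head 0 r < N z (behead r))) hF (comp_cst 0).
by apply: comp_leq (comp_succ comp_var) (comp_weak hN).
Qed.

Lemma sum_has n (P : pred nat) : (0 < \sum_(i < n) (P i : nat)) = has P (iota 0 n).
Proof.
rewrite lt0n sum_nat_eq0 negb_forall.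
apply/existsP/hasP => [[i]|[i]]; rewrite ?mem_iota /=.
  by case pi: (P i) => // _; exists (val i); rewrite ?mem_iota /= ?ltn_ord.
by rewrite add0n => li pi; exists (Ordinal li); rewrite /= pi.
Qed.

Lemma comp_Hs N (P : mach -> seq nat -> nat -> bool) :
  Comp N -> Comp (fun z r => P z (behead r) (head 0 r)) ->
  Comp (fun z r => Hs (bound z) (N z r) (P z r)).
Proof.
move=> hN hP; apply: (comp_ext (F := fun z r =>
    0 < Sm (bound z) (N z r) (fun i => P z r i : nat))).
  by move=> z r; rewrite /Sm sum_has.
by apply: comp_leq (comp_cst 1) _; apply: (comp_Sm (F := fun z r i => P z r i : nat)).
Qed.

Lemma comp_Al N (P : mach -> seq nat -> nat -> bool) :
  Comp N -> Comp (fun z r => P z (behead r) (head 0 r)) ->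
  Comp (fun z r => Al (bound z) (N z r) (P z r)).
Proof.
move=> hN hP; apply: (comp_ext (F := fun z r =>
    ~~ Hs (bound z) (N z r) (fun i => ~~ P z r i) : nat)).
  by move=> z r; rewrite /Hs /Al -all_predC; congr nat_of_bool; apply: eq_all => i /=; rewrite negbK.
apply: (comp_neg (P := fun z r => Hs (bound z) (N z r) (fun i => ~~ P z r i))).
by apply: (comp_Hs (P := fun z r i => ~~ P z r i)) => //; apply: comp_neg hP.
Qed.

Lemma find_sum n (P : pred nat) :
  find P (iota 0 n) = \sum_(i < n) (all (fun j => ~~ P j) (iota 0 i.+1) : nat).
Proof.
have e m : iota 0 m.+1 = iota 0 m ++ [:: m] by rewrite -[m.+1]addn1 iotaD.
pose g i : nat := all (fun j => ~~ P j) (iota 0 i.+1); rewrite -[RHS]/(\sum_(i < n) g i).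
have gE i : g i = ~~ has P (iota 0 i) && ~~ P i by rewrite /g e all_cat -all_predC /= andbT.
elim: n => [|n ih]; first by rewrite big_ord0.
rewrite big_ord_recr -ih gE e find_cat.
case: ifP => h /=; first by rewrite addn0.
by rewrite hasNfind ?h // size_iota; case: (P n).
Qed.

Lemma comp_Fd N (P : mach -> seq nat -> nat -> bool) :
  Comp N -> Comp (fun z r => P z (behead r) (head 0 r)) ->
  Comp (fun z r => Fd (bound z) (N z r) (P z r)).
Proof.
move=> hN hP; apply: (comp_ext (F := fun z r =>
    Sm (bound z) (N z r) (fun i => Al (bound z) i.+1 (fun j => ~~ P z r j)))).
  move=> z r; rewrite /Fd find_sum; apply: eq_bigr => i _.
  by rewrite /Al; have /minn_idPl -> : i.+1 <= bound z by have := ltn_ord i; lia.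
apply: (comp_Sm (F := fun z r i => Al (bound z) i.+1 (fun j => ~~ P z r j) : nat)) => //.
apply: (comp_Al (N := fun z r => (head 0 r).+1)
  (P := fun z r j => ~~ P z (behead r) j)); first exact: comp_succ comp_var.
apply: comp_neg; have [t ht] := hP.
exists (tren (fun x => if x is y.+1 then y.+2 else 0) t) => z r.
rewrite -[RHS](ht z (head 0 r :: behead (behead r))).
by apply: teval_ren => -[|x] /=; rewrite ?nth0 // !nth_behead.
Qed.

Lemma comp_Ml F G : Comp F -> Comp G -> Comp (fun z r => Ml (bound z) (F z r) (G z r)).
Proof.
move=> hF hG; apply: (comp_ext (F := fun z r => Sm (bound z) (F z r) (fun=> G z r))).
  by move=> z r; rewrite /Sm sum_nat_const card_ord.
by apply: (comp_Sm (F := fun z r i => G z r)) => //; exact: comp_weak.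
Qed.

Lemma comp_Dv F G : Comp F -> Comp G -> Comp (fun z r => Dv (bound z) (F z r) (G z r)).
Proof.
move=> hF hG; apply: (comp_ext (F := fun z r => \sum_(i < bound z)
    ((0 < G z r) && (Ml (bound z) i.+1 (G z r) <= F z r) : nat))).
  move=> z r; rewrite /Dv; move: (F z r) (G z r) => x y.
  case: (posnP y) => [->|y0]; first by rewrite divn0 min0n big1.
  under eq_bigr => i _.
    rewrite /Ml (minn_idPl (ltn_ord i)) /= -leq_divRL //.
    have -> : (i.+1 <= x %/ y : nat) = if i < x %/ y then 1 else 0 by case: ltnP.
    over.
  by rewrite (sum_if_lt _ _ (fun=> 1)) sum_nat_const card_ord muln1.
apply: (comp_sumB (F := fun z r i => (0 < G z r) && (Ml (bound z) i.+1 (G z r) <= F z r) : nat)).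
apply: (comp_and (P := fun z r => 0 < G z (behead r))).
  exact: comp_leq (comp_cst 1) (comp_weak hG).
apply: comp_leq (comp_Ml _ (comp_weak hG)) (comp_weak hF); exact: comp_succ comp_var.
Qed.

Lemma comp_Md F G : Comp F -> Comp G -> Comp (fun z r => Md (bound z) (F z r) (G z r)).
Proof.
move=> hF hG; apply: (comp_ext (F := fun z r =>
    F z r - Ml (bound z) (Dv (bound z) (F z r) (G z r)) (G z r))).
  by move=> z r; rewrite /Md /Ml /Dv -minnA minnn.
exact: comp_sub hF (comp_Ml (comp_Dv hF hG) hG).
Qed.

Lemma MdE b x y : x %/ y <= b -> Md b x y = x %% y.
Proof. by move=> h; rewrite /Md /Dv (minn_idPl h) {1}(divn_eq x y) addKn. Qed.

(** * The candidate determined by an advice *)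

Definition powb (b j : nat) : nat := if j < b then 2 ^ j else 0.

Section Candidate.

Variables (b nr nb k t : nat) (cn cv : nat -> nat -> bool).
Variable near : nat -> nat -> bool.
Variable pow : nat -> nat.
Variables (p ell e m mb nu : nat).
Variables (far step par cls rho seed lab : nat -> nat).
Variable KK : nat.

Section Prefix.

Variable X : nat -> nat.

Definition covX (l x : nat) : bool := Hs b l (fun j => cv (X j) x).
Definition fX (l : nat) : nat := Sm b nb (fun x => covX l x).
Definition rdeg (l u : nat) : nat := Sm b nb (fun x => cv u x && ~~ covX l x).
Definition heavy (l u : nat) : bool :=
  Hs b l (fun j => near (X j) u) && (t - fX l <= Ml b k (rdeg l u)).
Definition nextX (l : nat) : nat :=
  if step l == 0 then far (Sm b l (fun j => step j == 0))
  else Fd b nr (fun v => heavy l v && (Sm b v (fun u => heavy l u) == (step l).-1)).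

Definition bitof (y j : nat) : nat := Md b (Dv b y (pow j)) 2.
Definition hsh (i y : nat) : nat :=
  Md b (Sm b nu (fun j => Ml b (bitof y j) (seed (Ml b i nu + j)))) (pow i).
Definition slot (i y : nat) : nat := lab (pow i + hsh i y).
Definition phi (x : nat) : nat :=
  (slot (e - Fd b e.+1 (fun j => slot (e - j) (Md b x mb) != 0)) (Md b x mb)).-1.

Definition comm (u v : nat) : nat :=
  Sm b nb (fun x => cv u x && (cv v x && ~~ covX p x)).
Definition clash (i v x : nat) : bool :=
  Hs b i (fun j => (cls j == cls i) &&
    Hs b nr (fun u => (Md b u m == rho j) && ((ell <= comm u v) && cv u x))).
Definition weight (i v : nat) : nat :=
  if cls i < p then
    if v == X (cls i) then Sm b nb (fun x => cv v x && ~~ covX (cls i) x) else 0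
  else if Md b v m == rho i then
    Sm b nb (fun x => cv v x &&
      (~~ covX p x && ((phi x == cls i - p) && ~~ clash i v x)))
  else 0.

Definition best (Val : nat -> nat -> nat) (c v : nat) : nat :=
  Fd b nr (fun u => ((u == v) || cn v u) &&
    Al b nr (fun u' => ((u' == v) || cn v u') ==> (Val c u' <= Val c u))).
Definition nextVal (Val : nat -> nat -> nat) (i v : nat) : nat :=
  weight i v + Sm b KK (fun c => if (i < c) && (par c == i) then Val c (best Val c v) else 0).
Definition nextTR (Val : nat -> nat -> nat) (TR : nat -> nat) (i : nat) : nat :=
  if i == 0 then Fd b nr (fun u => Al b nr (fun u' => Val 0 u' <= Val 0 u))
  else if par i < i then best Val i (TR (par i)) else 0.

End Prefix.

Definition valid (TR : nat -> nat) : bool :=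
  Al b KK (fun i => (TR i < nr) &&
    ((i == 0) || ((par i < i) && ((TR i == TR (par i)) || cn (TR (par i)) (TR i)))))
  && (t <= Sm b nb (fun x => Hs b KK (fun i => cv (TR i) x))).

End Candidate.

(** * Counting in biclique-free incidence relations *)

Lemma ffact_ge n k : k <= n -> (n - k).+1 ^ k <= n ^_ k.
Proof.
elim: k n => [|k ih] [|n] //= h.
rewrite ffactSS subSS expnS leq_mul ?ltnS ?leq_subr //.
exact: ih.
Qed.

Lemma ffact_le n k : n ^_ k <= n ^ k.
Proof.
elim: k n => [|k ih] [|n] //; rewrite ffactSS expnS leq_mul2l /=.
by apply: leq_trans (ih n) _; case: k {ih} => // k; rewrite leq_exp2r.
Qed.

Lemma few_large_traces (U T : finType) (f : U -> {set T}) d (W : {set T}) l A :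
  (forall (X : {set U}) (Y : {set T}), #|X| = d -> #|Y| = d -> {in X, forall u, Y \subset f u} -> False) ->
  d <= l -> #|W| <= A * (l - d).+1 ->
  #|[set u | l <= #|f u :&: W|]| <= d * A ^ d.
Proof.
move=> free dl hW; set B := [set u | _].
pose D (C : {set T}) := [set Y : {set T} | Y \subset C & #|Y| == d].
have dbl : \sum_(u in B) #|D (f u :&: W)| = \sum_(Y in D W) #|[set u in B | Y \subset f u]|.
  under eq_bigr => u _ do rewrite -sum1dep_card.
  rewrite (exchange_big_dep (fun Y => Y \in D W)) /=.
    apply: eq_bigr => Y; rewrite inE => /andP [sY cY].
    rewrite -sum1dep_card; apply: eq_bigl => u.
    by rewrite subsetI sY cY !andbT.
  by move=> u Y _; rewrite subsetI inE => /andP [/andP [_ ->] ->].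
have up : \sum_(Y in D W) #|[set u in B | Y \subset f u]| <= 'C(#|W|, d) * d.
  rewrite -cards_draws -sum_nat_const leq_sum // => Y; rewrite inE => /andP [_ /eqP cY].
  rewrite leqNgt; apply/negP => h.
  have [X sX cX] : exists2 X : {set U}, X \subset [set u in B | Y \subset f u] & #|X| = d.
    have : 0 < #|[set X : {set U} | X \subset [set u in B | Y \subset f u] & #|X| == d]|.
      by rewrite cards_draws bin_gt0 ltnW.
    by case/card_gt0P => X; rewrite inE => /andP [sX /eqP cX]; exists X.
  apply: (free X Y) => // u /(subsetP sX).
  by rewrite inE => /andP [].
have lo : #|B| * 'C(l, d) <= \sum_(u in B) #|D (f u :&: W)|.
  rewrite -sum_nat_const leq_sum // => u; rewrite inE => hu.
  by rewrite cards_draws leq_bin2l.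
have := leq_trans lo (leq_trans (eq_leq dbl) up).
rewrite -(leq_pmul2r (fact_gt0 d)) -mulnA bin_ffact mulnAC bin_ffact => h.
set y := (l - d).+1 in hW.
have y0 : 0 < y ^ d by rewrite expn_gt0.
rewrite -(leq_pmul2r y0).
apply: leq_trans (leq_mul (leqnn _) (ffact_ge dl)) _.
apply: leq_trans h _; rewrite mulnC -mulnA leq_mul2l -expnMn.
by rewrite (leq_trans (ffact_le _ _)) ?orbT //; case: (d) => // d'; rewrite leq_exp2r.
Qed.

Lemma big_mul_dvd (D : seq nat) x : x \in D -> x %| \prod_(y <- D) y.
Proof. by move=> h; rewrite (big_rem x h) /= dvdn_mulr. Qed.

Lemma logn_bin_le q n j : prime q -> 0 < n -> j <= n -> q ^ logn q 'C(n, j) <= n.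
Proof.
move=> pq n0 jn.
have [z|l0] := posnP (logn q 'C(n, j)); first by rewrite z.
have e : logn q n`! = logn q 'C(n, j) + logn q j`! + logn q (n - j)`!.
  by rewrite -(bin_fact jn) !lognM ?muln_gt0 ?fact_gt0 ?bin_gt0 ?jn // addnA.
pose c i := (q ^ i <= n).
have key : logn q 'C(n, j) <= trunc_log q n.
  have q1 := prime_gt1 pq.
  pose s (m : nat) := \sum_(1 <= i < n.+1) m %/ q ^ i.
  have sE m : m <= n -> logn q m`! = s m.
    move=> mn; rewrite logn_fact // /s (@big_cat_nat _ _ _ m.+1 1 n.+1) //=.
    rewrite [X in _ + X]big_nat_cond [X in _ + X]big1 ?addn0 // => i.
    rewrite andbT => /andP [h1 h2]; apply: divn_small.
    exact: leq_trans h1 (ltnW (ltn_expl _ q1)).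
  have hs : s n <= s j + s (n - j) + trunc_log q n.
    have -> : trunc_log q n = \sum_(1 <= i < n.+1) (i <= trunc_log q n).
      rewrite (@big_cat_nat _ _ _ (trunc_log q n).+1) //=; last first.
        by rewrite ltnS ltnW // -(ltn_exp2l _ _ q1) (leq_ltn_trans (trunc_logP q1 n0)) // ltn_expl.
      rewrite [X in _ + X]big_nat_cond [X in _ + X]big1 ?addn0; last first.
        by move=> i; rewrite andbT => /andP [h _]; rewrite leqNgt h.
      rewrite big_nat_cond (eq_bigr (fun=> 1)).
        by rewrite -big_nat_cond sum_nat_const_nat subn1 muln1.
      by move=> i; rewrite andbT ltnS => /andP [_ ->].
    rewrite /s -!big_split /= [leqLHS]big_nat_cond [leqRHS]big_nat_cond; apply: leq_sum => i.
    rewrite andbT => /andP [i1 _].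
    case: (leqP i (trunc_log q n)) => hi /=.
      rewrite -{1}(subnKC jn) divnD ?expn_gt0 ?prime_gt0 //.
      by rewrite leq_add2l leq_b1.
    rewrite divn_small //; apply: leq_trans (trunc_log_ltn n q1) _.
    by rewrite leq_exp2l.
  by move: e; rewrite !sE // ?leq_subr //; lia.
apply: leq_trans (trunc_logP (prime_gt1 pq) n0).
by rewrite leq_exp2l ?prime_gt1.
Qed.

(* Otherwise every prime power below [2h], hence the central binomial
   coefficient, divides the product of [D], which is too small. *)
Lemma modulus_avoiding (D : seq nat) w : all (fun x => 0 < x < 2 ^ w) D ->
  exists2 m, 0 < m <= 2 * (size D * w).+1 & all (fun x => ~~ (m %| x)) D.
Proof.
move=> hD; set h := (size D * w).+1.
have [/hasP [m] | no] := boolP (has (fun m => all (fun x => ~~ (m %| x)) D) (iota 1 (2 * h))).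
  by rewrite mem_iota add1n ltnS => hm hall; exists m.
have dv m : 0 < m <= 2 * h -> m %| \prod_(y <- D) y.
  move=> hm; have : m \in iota 1 (2 * h) by rewrite mem_iota add1n ltnS.
  move/(hasPn no); rewrite -has_predC => /hasP [x xD /=].
  rewrite negbK => /dvdn_trans; apply; exact: big_mul_dvd.
have P0 : 0 < \prod_(y <- D) y.
  by rewrite big_seq; apply: prodn_cond_gt0 => y yD; case/andP: (allP hD y yD).
have hb : 'C(2 * h, h) %| \prod_(y <- D) y.
  have c0 : 0 < 'C(2 * h, h) by rewrite bin_gt0 leq_pmull.
  apply/(dvdn_partP _ c0) => q; rewrite mem_primes => /and3P [pq _ _]; rewrite p_part; apply: dv.
  by rewrite expn_gt0 prime_gt0 // logn_bin_le // leq_pmull.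
have lo i : 2 ^ i <= 'C(2 * i, i).
  elim: i => [|i ih]; first by rewrite bin0.
  have e : i.+1 * 'C(2 * i.+1, i.+1) = 2 * (2 * i).+1 * 'C(2 * i, i).
    have -> : 2 * i.+1 = (2 * i).+2 by lia.
    rewrite -mul_bin_diag /= -[in LHS](@bin_sub _ i); last by lia.
    have -> : (2 * i).+1 - i = i.+1 by lia.
    have -> : (2 * i).+2 = 2 * i.+1 by lia.
    by rewrite -[in LHS]mulnA -mul_bin_diag mulnA.
  apply: (@leq_trans (2 * 'C(2 * i, i))); first by rewrite expnS leq_mul2l.
  by rewrite -(leq_pmul2l (ltn0Sn i)) e mulnA leq_mul2r; apply/orP; right; lia.
have up : \prod_(y <- D) y < 2 ^ h.
  apply: (@leq_ltn_trans (2 ^ (size D * w))); last by rewrite ltn_exp2l.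
  rewrite {dv no P0 hb}/h; elim: D hD => [|y D ih] /=; first by rewrite big_nil.
  case/andP => /andP [_ hy] /ih hh.
  by rewrite big_cons mulSn expnD leq_mul // ltnW.
have := leq_trans up (leq_trans (lo h) (dvdn_leq P0 hb)).
by rewrite ltnn.
Qed.

(** * Hashing by peeling *)

Definition hashv (nu : nat) (s : nat -> nat) (q y : nat) : nat :=
  (\sum_(j < nu) (y %/ 2 ^ j) %% 2 * s j) %% q.

Lemma bits_inj nu y y' : y < 2 ^ nu -> y' < 2 ^ nu ->
  (forall j, j < nu -> (y %/ 2 ^ j) %% 2 = (y' %/ 2 ^ j) %% 2) -> y = y'.
Proof.
elim: nu y y' => [|nu ih] y y'; first by rewrite expn0; case: y; case: y'.
rewrite expnS => hy hy' h.
have h0 := h 0 isT; rewrite expn0 !divn1 in h0.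
rewrite (divn_eq y 2) (divn_eq y' 2) h0 (ih (y %/ 2) (y' %/ 2)) //.
- by rewrite ltn_divLR // mulnC.
- by rewrite ltn_divLR // mulnC.
- by move=> j hj; rewrite -!divnMA -expnS h.
Qed.

Lemma hash_collisions nu q y y' : 0 < q -> y < 2 ^ nu -> y' < 2 ^ nu -> y != y' ->
  q * #|[set r : {ffun 'I_nu -> 'I_q} |
      hashv nu (fun j => oapp (fun j : 'I_nu => r j : nat) 0 (insub j)) q y ==
      hashv nu (fun j => oapp (fun j : 'I_nu => r j : nat) 0 (insub j)) q y']| <= q ^ nu.
Proof.
move=> q0 hy hy' ne; set A := [set r | _].
have [j0 d0] : exists j : 'I_nu, (y %/ 2 ^ j) %% 2 != (y' %/ 2 ^ j) %% 2.
  apply/existsP; rewrite -[X in is_true X]negbK negb_exists; apply/negP => /forallP h.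
  case/eqP: ne; apply: bits_inj hy hy' _ => j hj.
  by have := h (Ordinal hj); rewrite negbK => /eqP.
pose sh (x : {ffun 'I_nu -> 'I_q} * 'I_q) : {ffun 'I_nu -> 'I_q} :=
  [ffun j => if j == j0 then Ordinal (ltn_pmod (x.1 j + x.2) q0) else x.1 j].
have inj : {in setX A setT &, injective sh}.
  move=> [r d] [r' d']; rewrite !inE !andbT /= => hr hr' e.
  have off j : j != j0 -> r j = r' j.
    by move=> nj; move/ffunP/(_ j): e; rewrite !ffunE (negbTE nj).
  have E s z : hashv nu (fun j => oapp (fun j : 'I_nu => s j : nat) 0 (insub j)) q z =
      (\sum_(j | j != j0) (z %/ 2 ^ j) %% 2 * s j + (z %/ 2 ^ j0) %% 2 * (s j0 : nat)) %% q.
    rewrite /hashv (bigD1 j0) //= addnC valK /=.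
    by congr ((_ + _) %% q); apply: eq_bigr => j _; rewrite valK.
  rewrite !E in hr hr'.
  have S z : \sum_(j | j != j0) (z %/ 2 ^ j) %% 2 * r' j =
             \sum_(j | j != j0) (z %/ 2 ^ j) %% 2 * r j.
    by apply: eq_bigr => j /off ->.
  rewrite !S in hr'.
  have e0 : r j0 = r' j0.
    apply: val_inj => /=.
    rewrite -(modn_small (ltn_ord (r j0))) -(modn_small (ltn_ord (r' j0))).
    move: d0 hr hr'; have := ltn_pmod (y %/ 2 ^ j0) (isT : 0 < 2).
    have := ltn_pmod (y' %/ 2 ^ j0) (isT : 0 < 2).
    set a := \sum_(_ | _) _; set a' := \sum_(_ | _) _.
    case: (_ %% 2) => [|[|//]] _; case: (_ %% 2) => [|[|//]] _ //= _;
      rewrite !mul0n !mul1n !addn0.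
      move=> /eqP h /eqP h'.
      by apply/eqP; rewrite -(eqn_modDl a) h h'.
    move=> /eqP h /eqP h'.
    by apply/eqP; rewrite -(eqn_modDl a') -h -h'.
  have er : r = r' by apply/ffunP => j; case: (eqVneq j j0) => [->|/off].
  rewrite er; congr pair; apply: val_inj => /=.
  move/ffunP/(_ j0): e; rewrite !ffunE eqxx er => /(congr1 val) /= /eqP.
  by rewrite eqn_modDl !modn_small // => /eqP.
have := subset_leq_card (subsetT (sh @: setX A setT)).
rewrite (card_in_imset inj) cardsX cardsT card_ord cardsT card_ffun !card_ord.
by rewrite mulnC.
Qed.

Definition collide (h : nat -> nat) (T : seq nat) : seq nat :=
  [seq y <- T | has (fun y' => (y != y') && (h y == h y')) T].

Lemma hash_exists nu q T : 0 < q -> uniq T -> all (fun y => y < 2 ^ nu) T ->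
  exists2 s : nat -> nat, forall j, s j < q &
    size (collide (hashv nu s q) T) * q <= size T * size T.
Proof.
move=> q0 uT hT.
pose ext (r : {ffun 'I_nu -> 'I_q}) j := oapp (fun j : 'I_nu => r j : nat) 0 (insub j).
pose c r := size (collide (hashv nu (ext r) q) T).
have [/existsP [r hr] | no] := boolP [exists r, c r * q <= size T * size T].
  by exists (ext r) => // j; rewrite /ext; case: insub => /=.
suff : \sum_r c r * q <= \sum_(r : {ffun 'I_nu -> 'I_q}) size T * size T.
  have : \sum_(r : {ffun 'I_nu -> 'I_q}) (size T * size T).+1 <= \sum_r c r * q.
    apply: leq_sum => r _; rewrite ltnNge; apply: contra no => h.
    by apply/existsP; exists r.
  move=> h1 h2; have := leq_trans h1 h2; rewrite !sum_nat_const leq_mul2l.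
  by rewrite card_ffun !card_ord ltnn orbF expn_eq0; case: (q) q0.
have cE r : c r <= \sum_(y <- T) \sum_(y' <- T)
    ((y != y') && (hashv nu (ext r) q y == hashv nu (ext r) q y')).
  rewrite /c size_filter -sum1_count big_mkcond; apply: leq_sum => y _ /=.
  case: ifP => // /hasP [y' yT h]; rewrite (big_rem y' yT) /= h; exact: leq_addr.
rewrite sum_nat_const card_ffun !card_ord.
apply: (@leq_trans (\sum_(y <- T) \sum_(y' <- T) q ^ nu)); last first.
  rewrite !big_const_seq !count_predT !iter_addn_0; lia.
under eq_bigr => r _ do rewrite mulnC.
rewrite -big_distrr /=.
apply: (@leq_trans (q * \sum_(y <- T) \sum_(y' <- T)
   \sum_(r : {ffun 'I_nu -> 'I_q}) ((y != y') && (hashv nu (ext r) q y == hashv nu (ext r) q y')))).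
  rewrite leq_mul2l; apply/orP; right.
  apply: leq_trans (leq_sum _ (fun r _ => cE r)) _.
  rewrite exchange_big leq_sum // => y _; by rewrite exchange_big.
rewrite big_distrr /= !big_seq leq_sum // => y yT.
rewrite big_distrr /= !big_seq leq_sum // => y' yT'.
have [->|ne] := eqVneq y y'; first by rewrite big1 ?muln0.
rewrite (eq_bigr (fun r => if hashv nu (ext r) q y == hashv nu (ext r) q y' then 1 else 0));
  last by move=> r _; rewrite /=; case: (_ == _).
rewrite -big_mkcond sum1dep_card.
by apply: hash_collisions => //; apply: (allP hT).
Qed.

Section Peeling.

Variable nu : nat.

Definition slotp (seed lab : nat -> nat) (i y : nat) : nat :=
  lab (2 ^ i + hashv nu (fun j => seed (i * nu + j)) (2 ^ i) y).

Definition resolve (seed lab : nat -> nat) (e y : nat) : nat :=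
  (slotp seed lab (e - find (fun j => slotp seed lab (e - j) y != 0) (iota 0 e.+1)) y).-1.

Lemma resolveS seed lab e y : resolve seed lab e.+1 y =
  if slotp seed lab e.+1 y != 0 then (slotp seed lab e.+1 y).-1 else resolve seed lab e y.
Proof.
rewrite /resolve; set P := fun j => _.
have find1 : find P (iota 0 e.+2) = if P 0 then 0 else (find P (iota 1 e.+1)).+1 by [].
have P0 : P 0 = (slotp seed lab e.+1 y != 0) by rewrite /P subn0.
rewrite find1 P0; case: ifP => h; first by rewrite subn0.
rewrite subSS (_ : find P _ = find (fun j => slotp seed lab (e - j) y != 0) (iota 0 e.+1)) //.
by rewrite (iotaDl 1 0 e.+1 : iota 1 e.+1 = _) find_map; apply: eq_find => j; rewrite /P /= add1n subSS.
Qed.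

Lemma slotp_local seed lab seed' lab' i y :
  (forall x, x < i.+1 * nu -> seed x = seed' x) ->
  (forall x, x < 2 ^ i.+1 -> lab x = lab' x) -> slotp seed lab i y = slotp seed' lab' i y.
Proof.
move=> hs hl; rewrite /slotp.
have -> : hashv nu (fun j => seed (i * nu + j)) (2 ^ i) y =
          hashv nu (fun j => seed' (i * nu + j)) (2 ^ i) y.
  congr (_ %% _); apply: eq_bigr => j _; rewrite hs //.
  by rewrite mulSn addnC ltn_add2r.
by rewrite hl // expnS mul2n -addnn ltn_add2l ltn_pmod // expn_gt0.
Qed.

Lemma resolve_local seed lab seed' lab' i y :
  (forall x, x < i.+1 * nu -> seed x = seed' x) ->
  (forall x, x < 2 ^ i.+1 -> lab x = lab' x) -> resolve seed lab i y = resolve seed' lab' i y.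
Proof.
elim: i => [|i ih] hs hl.
  by rewrite /resolve sub0n (slotp_local y hs hl).
rewrite !resolveS (slotp_local y hs hl) ih // => x hx.
  by apply: hs; apply: leq_trans hx _; rewrite leq_mul2r ltnW ?orbT.
by apply: hl; apply: leq_trans hx _; rewrite leq_exp2l.
Qed.

(* A function on a set [T] of hash values is coded by O(|T|) small labels: in
   round [i] the elements alone in their slot are settled, and the at most
   quarter of them which collide are passed to the next round. *)
Lemma peel e T (lb : nat -> nat) g : uniq T -> all (fun y => y < 2 ^ nu) T ->
  4 * size T <= 2 ^ e -> (forall y, lb y < g) ->
  exists seed lab, [/\ forall x, seed x < 2 ^ e, forall x, lab x <= g
    & {in T, forall y, resolve seed lab e y = lb y}].
Proof.
elim: e T => [|e ih] T uT hT sT hg.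
  exists (fun=> 0), (fun=> 0); split=> // y; move: sT; case: T {uT hT} => //= a T.
  by rewrite expn0; lia.
have [|s hs hc] := @hash_exists nu (2 ^ e.+1) T _ uT hT; first by rewrite expn_gt0.
set h := hashv nu s (2 ^ e.+1) in hc; set T' := collide h T in hc.
have sT' : 4 * size T' <= 2 ^ e.
  have q0 : 0 < 2 ^ e by rewrite expn_gt0.
  move: sT hc; rewrite expnS; move: (size T') (size T) (2 ^ e) q0 => a c q q0 h1 h2.
  have [c0|c0] := posnP c; first by move: h2; rewrite c0 mul0n leqn0 !muln_eq0; lia.
  have : 4 * a <= c by rewrite -(leq_pmul2r c0) (leq_trans _ h2) // -mulnA mulnCA leq_mul2l h1 orbT.
  by lia.
have [||seed [lab [h1 h2 h3]]] := ih T' _ _ sT' hg.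
- by rewrite filter_uniq.
- by apply/allP => y; rewrite mem_filter => /andP [_ /(allP hT)].
pose cl v := [seq y <- T | h y == v].
pose seed' x := if x < e.+1 * nu then seed x else s (x - e.+1 * nu).
pose lab' x := if x < 2 ^ e.+1 then lab x else
  if size (cl (x - 2 ^ e.+1)) == 1 then (lb (head 0 (cl (x - 2 ^ e.+1)))).+1 else 0.
have low y : resolve seed' lab' e y = resolve seed lab e y.
  by apply: resolve_local => x hx; rewrite ?/seed' ?/lab' hx.
have top y : slotp seed' lab' e.+1 y =
    if size (cl (h y)) == 1 then (lb (head 0 (cl (h y)))).+1 else 0.
  rewrite /slotp; have -> : hashv nu (fun j => seed' (e.+1 * nu + j)) (2 ^ e.+1) y = h y.
    by congr (_ %% _); apply: eq_bigr => j _; rewrite /seed' ltnNge leq_addr /= addKn.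
  by rewrite /lab' ltnNge leq_addr /= addKn.
exists seed', lab'; split.
- move=> x; rewrite /seed'; case: ifP => _ //; apply: leq_trans (h1 x) _.
  by rewrite leq_exp2l.
- by move=> x; rewrite /lab'; case: ifP => _ //; case: ifP.
move=> y yT; rewrite resolveS low top.
have ycl : y \in cl (h y) by rewrite mem_filter eqxx.
have ucl : uniq (cl (h y)) by rewrite filter_uniq.
have [yT'|nyT'] := boolP (y \in T').
  suff -> : (size (cl (h y)) == 1) = false by rewrite h3.
  move: yT'; rewrite mem_filter yT andbT => /hasP [y' y'T /andP [ne /eqP hy]].
  have y'cl : y' \in cl (h y) by rewrite mem_filter hy eqxx.
  move: ycl y'cl; case: (cl _) => [|a [|a' c]] //; rewrite !inE => /eqP <- /eqP e'.
  by rewrite e' eqxx in ne.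
have alone y' : y' \in cl (h y) -> y' = y.
  rewrite mem_filter => /andP [/eqP hy y'T]; apply/eqP; rewrite eq_sym.
  apply: contraR nyT' => ne; rewrite mem_filter yT andbT.
  by apply/hasP; exists y' => //; rewrite ne hy /=.
have e1 : cl (h y) = [:: y].
  move: ycl ucl alone; case: (cl _) => [|a [|a' c]] // _ /= => [_|/andP [na _]] al.
    by rewrite (al a) ?inE.
  by move: na; rewrite (al a) ?inE ?eqxx // (al a') ?inE ?eqxx ?orbT.
by rewrite e1.
Qed.

End Peeling.

(** * Connected vertex sets *)

Section Connected.

Variables (nr : nat) (cn : nat -> nat -> bool).
Hypothesis cn_sym : forall u v, cn u v = cn v u.

Fixpoint walk (r u v : nat) : bool :=
  if r is r'.+1 then has (fun w => walk r' u w && ((w == v) || cn w v)) (iota 0 nr)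
  else u == v.

Lemma walk_succ r u v :
  walk r.+1 u v = has (fun w => walk r u w && ((w == v) || cn w v)) (iota 0 nr).
Proof. by []. Qed.

Definition grows (S : seq nat) : Prop := forall A : pred nat,
  has A S -> has (predC A) S -> exists u v, [/\ u \in S, A u, v \in S, ~~ A v & cn u v].

Definition treelike (ts : seq nat) : Prop := forall i, 0 < i < size ts ->
  exists2 j, j < i & nth 0 ts j = nth 0 ts i \/ cn (nth 0 ts j) (nth 0 ts i).

Lemma treelike_rcons ts v : treelike ts ->
  (size ts = 0 \/ exists2 u, u \in ts & u = v \/ cn u v) -> treelike (rcons ts v).
Proof.
move=> tt h i; rewrite size_rcons ltnS [i <= _]leq_eqVlt => /andP [i0 /orP [/eqP ei|li]].
  case: h => [z|[u uts hu]]; first by move: i0; rewrite ei z.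
  exists (index u ts); first by rewrite ei index_mem.
  rewrite !nth_rcons index_mem uts ei ltnn eqxx nth_index //.
have [|j ji hj] := tt i; first by rewrite i0.
exists j => //; rewrite !nth_rcons li (ltn_trans ji li) //.
Qed.

Lemma grows_treelike S : uniq S -> grows S -> exists2 ts, treelike ts & perm_eq ts S.
Proof.
move=> uS gS; suff : forall n, n <= size S ->
    exists ts, [/\ treelike ts, uniq ts, {subset ts <= S} & size ts = n].
  move=> /(_ _ (leqnn _)) [ts [tt ut sub sz]]; exists ts => //.
  apply: uniq_perm => //.
  by have [] := uniq_min_size ut sub (eq_leq (esym sz)).
elim=> [|n ih] hn; first by exists [::]; split=> // i; rewrite ltn0 andbF.
have [ts [tt ut sub sz]] := ih (ltnW hn).
have [v [vS vts hv]] : exists v, [/\ v \in S, v \notin ts &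
    size ts = 0 \/ exists2 u, u \in ts & u = v \/ cn u v].
  have hC : has (predC (mem ts)) S.
    rewrite -[has _ _]negbK has_predC negbK; apply/negP => /allP h.
    by have := uniq_leq_size uS h; rewrite sz leqNgt hn.
  case: ts tt ut sub sz hC => [|a ts] tt ut sub sz hC.
    case: S uS gS hn ih sub hC => [|v S] //= *; exists v; split=> //; last by left.
    by rewrite inE eqxx.
  have [|u [v [uS' ua vS va c]]] := gS (mem (a :: ts)) _ hC.
    by apply/hasP; exists a; [apply: sub; exact: mem_head | exact: mem_head].
  by exists v; split=> //; right; exists u => //; right.
exists (rcons ts v); split.
- exact: treelike_rcons.
- by rewrite rcons_uniq vts.
- by move=> x; rewrite mem_rcons inE => /orP [/eqP ->|/sub].
- by rewrite size_rcons sz.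
Qed.

Lemma treelike_walk ts r x u : treelike ts -> x \in ts -> x < nr -> u < nr -> walk r x u ->
  exists ps, [/\ treelike (ts ++ ps), size ps <= r, all (fun v => v < nr) ps & u \in ts ++ ps].
Proof.
move=> tt xts xn; elim: r u => [|r ih] u un /=.
  by move/eqP => <-; exists [::]; rewrite cats0.
case/hasP => w; rewrite mem_iota add0n /= => wn /andP [hw hu].
have [ps [h1 h2 h3 h4]] := ih w wn hw.
exists (rcons ps u); rewrite -rcons_cat size_rcons all_rcons un h3 mem_rcons inE eqxx.
split=> //; apply: treelike_rcons => //; right; exists w => //.
by case/orP: hu => [/eqP|]; [left | right].
Qed.

Lemma treelike_pad ts n : treelike ts -> 0 < size ts -> treelike (ts ++ nseq n (head 0 ts)).
Proof.
move=> tt s0; elim: n => [|n ih]; first by rewrite cats0.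
rewrite -addn1 nseqD catA cats1; apply: treelike_rcons => //; right.
exists (head 0 ts); last by left.
by rewrite mem_cat -nth0 mem_nth.
Qed.

Lemma walkD r1 r2 u v w : w < nr -> walk r1 u w -> walk r2 w v -> walk (r1 + r2) u v.
Proof.
move=> wn h1; elim: r2 v => [|r2 ih] v /=; first by move/eqP => <-; rewrite addn0.
case/hasP => x xn /andP [hx hv]; rewrite addnS walk_succ; apply/hasP; exists x => //.
by rewrite hv andbT; apply: ih.
Qed.

Lemma walk_sym r u v : u < nr -> v < nr -> walk r u v -> walk r v u.
Proof.
move=> un; elim: r v => [|r ih] v vn /=; first by rewrite eq_sym.
case/hasP => w; rewrite mem_iota add0n /= => wn /andP [hw hv].
rewrite -walk_succ -add1n; apply: (@walkD _ _ _ _ w) => //; last exact: ih.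
apply/hasP; exists v; first by rewrite mem_iota.
by rewrite /= eqxx /= eq_sym cn_sym.
Qed.

Lemma walkS r u v : v < nr -> walk r u v -> walk r.+1 u v.
Proof.
move=> vn h; rewrite walk_succ; apply/hasP; exists v; first by rewrite mem_iota.
by rewrite /= h eqxx.
Qed.

Lemma walk_le r r' u v : v < nr -> r <= r' -> walk r u v -> walk r' u v.
Proof.
move=> vn; elim: r' => [|r' ih]; first by rewrite leqn0 => /eqP ->.
by rewrite leq_eqVlt => /orP [/eqP -> //|h1 h2]; apply: walkS => //; apply: ih.
Qed.

Lemma ball_size S y r : uniq S -> grows S -> all (fun v => v < nr) S -> y \in S ->
  minn r.+1 (size S) <= count (walk r y) S.
Proof.
move=> uS gS /allP Sn yS; elim: r => [|r ih].
  by rewrite (leq_trans (geq_minl _ _)) // -has_count; apply/hasP; exists y => /=.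
have [no|/hasPn all1] := boolP (has (predC (walk r y)) S); last first.
  suff -> : count (walk r.+1 y) S = size S by rewrite geq_minr.
  apply/eqP; rewrite -all_count; apply/allP => v vS; apply: walkS; first exact: Sn.
  by have := all1 v vS; rewrite /= negbK.
have y0 : has (walk r y) S.
  rewrite has_count (leq_trans _ ih) // leq_min /=.
  by case: (S) yS.
have [u [v [uS' hu vS hv c]]] := gS _ y0 no.
have sub : subpred (walk r y) [pred x | walk r.+1 y x || ~~ (x < nr)].
  by move=> x hx /=; case: ltnP => xn; rewrite ?orbT // -/(walk r.+1 y x) walkS.
have lt : count (walk r y) S < count (walk r.+1 y) S.
  rewrite -!size_filter.
  have : {subset v :: [seq x <- S | walk r y x] <= [seq x <- S | walk r.+1 y x]}.
    move=> x; rewrite inE => /orP [/eqP ->|].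
      rewrite mem_filter vS andbT walk_succ; apply/hasP; exists u; last by rewrite hu c orbT.
      by rewrite mem_iota; apply: Sn.
    by rewrite !mem_filter => /andP [hx xS]; rewrite xS walkS // Sn.
  by move/(uniq_leq_size _) => /=; apply; rewrite /= mem_filter (negbTE hv) filter_uniq.
by lia.
Qed.

(* Balls of half the radius around pairwise far vertices are disjoint. *)
Lemma packing S Y D k q : uniq S -> grows S -> all (fun v => v < nr) S -> size S <= k ->
  0 < q -> k < D.+1 * q -> uniq Y -> {subset Y <= S} ->
  {in Y &, forall y y', y != y' -> ~~ walk D y y'} -> size Y <= 2 * q.
Proof.
move=> uS gS Sn sk q0 hD uY sub far.
have Sn' v : v \in S -> v < nr := allP Sn v.
case: Y uY sub far => [|y0 [|y1 Y]] //; first by rewrite /=; lia.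
set Z := y0 :: _ => uY sub far; set r := D./2.
have big y : y \in Z -> r.+1 <= count (walk r y) S.
  move=> yZ; have := ball_size r uS gS Sn (sub _ yZ); rewrite geq_min => /orP [//|h].
  have hall : all (walk r y) S by rewrite all_count eqn_leq count_size.
  have [y' y'Z ne] : exists2 y', y' \in Z & y != y'.
    have [->|ne] := eqVneq y y0; last by exists y0; rewrite ?inE ?eqxx.
    exists y1; first by rewrite !inE eqxx orbT.
    by move: uY; rewrite /= inE negb_or => /andP [/andP []].
  case/negP: (far _ _ yZ y'Z ne); apply: (walk_le (r := r)); first exact/Sn'/sub.
    by rewrite /r; lia.
  by apply: (allP hall); apply: sub.
have dis v : v \in S -> \sum_(y <- Z) walk r y v <= 1.
  move=> vS.
  have -> : \sum_(y <- Z) walk r y v = size [seq y <- Z | walk r y v].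
    by rewrite size_filter -sum1_count [RHS]big_mkcond; apply: eq_bigr => y _; case: walk.
  rewrite leqNgt; apply/negP; case E : [seq y <- Z | walk r y v] => [|a [|a' l]] // _.
  have ha : a \in [seq y <- Z | walk r y v] by rewrite E inE eqxx.
  have ha' : a' \in [seq y <- Z | walk r y v] by rewrite E !inE eqxx orbT.
  have ne : a != a'.
    have : uniq [seq y <- Z | walk r y v] by rewrite filter_uniq.
    by rewrite E /= inE negb_or => /andP [/andP []].
  move: ha ha'; rewrite !mem_filter => /andP [wa aZ] /andP [wa' aZ'].
  case/negP: (far _ _ aZ aZ' ne); apply: (walk_le (r := r + r)); first exact/Sn'/sub.
    by rewrite /r; lia.
  by apply: walkD wa _; rewrite ?Sn' // walk_sym // Sn' // sub.
have h1 : size Z * r.+1 <= \sum_(y <- Z) count (walk r y) S.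
  rewrite -[size Z]count_predT -sum1_count big_distrl /= !big_seq leq_sum // => y yZ.
  by rewrite mul1n big.
have h2 : \sum_(y <- Z) count (walk r y) S <= size S.
  have -> : \sum_(y <- Z) count (walk r y) S = \sum_(v <- S) \sum_(y <- Z) walk r y v.
    rewrite exchange_big /=; apply: eq_bigr => y _.
    by rewrite -sum1_count [LHS]big_mkcond; apply: eq_bigr => v _; case: walk.
  rewrite -[size S]count_predT -sum1_count !big_seq leq_sum // => v vS; exact: dis.
have : size Z * r.+1 <= k by apply: leq_trans h1 (leq_trans h2 sk).
have : D.+1 <= 2 * r.+1 by rewrite /r; lia.
move: (size Z) => z; rewrite leqNgt; nia.
Qed.

End Connected.

(** * Correctness of the candidate *)

Lemma SmE b n F : n <= b -> Sm b n F = \sum_(i < n) F i.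
Proof. by rewrite /Sm => /minn_idPl ->. Qed.

Lemma HsE b n P : n <= b -> Hs b n P = has P (iota 0 n).
Proof. by rewrite /Hs => /minn_idPl ->. Qed.

Lemma AlE b n P : n <= b -> Al b n P = all P (iota 0 n).
Proof. by rewrite /Al => /minn_idPl ->. Qed.

Lemma hasI n (P : pred nat) : reflect (exists2 i, i < n & P i) (has P (iota 0 n)).
Proof.
by apply: (iffP hasP) => [] [i]; rewrite ?mem_iota => h1 h2; exists i; rewrite ?mem_iota.
Qed.

Lemma allI n (P : pred nat) : reflect (forall i, i < n -> P i) (all P (iota 0 n)).
Proof.
apply: (iffP allP) => h i; first by move=> hi; apply: h; rewrite mem_iota.
by rewrite mem_iota => hi; apply: h.
Qed.

Lemma FdP b n (P : pred nat) : n <= b -> (exists2 i, i < n & P i) ->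
  [/\ Fd b n P < n, P (Fd b n P) & forall i, i < Fd b n P -> ~~ P i].
Proof.
move=> nb ex; rewrite /Fd (minn_idPl nb).
have hP : has P (iota 0 n) by apply/hasI.
have lt : find P (iota 0 n) < n by rewrite -{2}(size_iota 0 n) -has_find.
split=> // [|i hi].
  by have := nth_find 0 hP; rewrite nth_iota.
by have := before_find 0 hi; rewrite nth_iota ?(ltn_trans hi) // => ->.
Qed.

Lemma max_exists n (Q : pred nat) (f : nat -> nat) : (exists2 u, u < n & Q u) ->
  exists u, [/\ u < n, Q u & forall u', u' < n -> Q u' -> f u' <= f u].
Proof.
elim: n => [|n ih] [u0 hu0 q0]; first by [].
have [ex|no] := boolP (has Q (iota 0 n)).
  have [u [un qu mx]] := ih (hasI _ _ ex).
  have [|] := boolP (Q n && (f u <= f n)) => [/andP [qn le]|nle].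
    exists n; split=> // u'; rewrite ltnS leq_eqVlt => /orP [/eqP -> //|lt] q'.
    exact: leq_trans (mx _ lt q') le.
  exists u; split=> //; first exact: leqW.
  move=> u'; rewrite ltnS leq_eqVlt => /orP [/eqP -> q'|lt]; last exact: mx.
  by move: nle; rewrite q' /= -ltnNge => /ltnW.
have e : u0 = n.
  move: hu0; rewrite ltnS leq_eqVlt => /orP [/eqP //|lt]; case/negP: no.
  by apply/hasI; exists u0.
exists n; split=> //; first by rewrite -e.
move=> u'; rewrite ltnS leq_eqVlt => /orP [/eqP -> //|lt] q'; case/negP: no.
by apply/hasI; exists u'.
Qed.

Section TreeProgramming.

Variables (b nr KK : nat) (cn : nat -> nat -> bool) (par : nat -> nat).
Variables (W Val : nat -> nat -> nat) (TR : nat -> nat).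
Hypotheses (nrb : nr <= b) (Kb : KK <= b).
Hypothesis par_lt : forall i, 0 < i < KK -> par i < i.
Hypothesis ValE : forall i v, i < KK -> v < nr -> Val i v = W i v +
  Sm b KK (fun c => if (i < c) && (par c == i) then Val c (best b nr cn Val c v) else 0).
Hypothesis TRE : forall i, i < KK -> TR i = nextTR b nr cn par Val TR i.

Definition hom (a : nat -> nat) : Prop := forall i, i < KK ->
  a i < nr /\ (i = 0 \/ a i = a (par i) \/ cn (a (par i)) (a i)).

Lemma best_spec c v : v < nr ->
  let u := best b nr cn Val c v in
  [/\ u < nr, u = v \/ cn v u &
    forall u', u' < nr -> u' = v \/ cn v u' -> Val c u' <= Val c u].
Proof.
move=> vn; pose Q u := (u == v) || cn v u.
have [|u0 [h1 h2 h3]] := @max_exists nr Q (Val c); first by exists v => //; rewrite /Q eqxx.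
have [|lt /andP [q al] _] := @FdP b nr (fun u => ((u == v) || cn v u) &&
    Al b nr (fun u' => ((u' == v) || cn v u') ==> (Val c u' <= Val c u))) nrb.
  exists u0 => //; rewrite -/(Q u0) h2 AlE //; apply/allI => u' hu'.
  by apply/implyP; apply: h3.
split=> //; first by case/orP: q => [/eqP|]; [left | right].
move=> u' hu' h; move: al; rewrite AlE // => /allI /(_ u' hu') /implyP; apply.
by case: h => [->|->]; rewrite ?eqxx ?orbT.
Qed.

Lemma sum_children (F : nat -> nat) :
  \sum_(i < KK) \sum_(c < KK) (if (i < c) && (par c == i) then F c else 0) =
  \sum_(c < KK) (if 0 < c then F c else 0).
Proof.
rewrite exchange_big /=; apply: eq_bigr => c _.
case: posnP => [c0|c0]; first by rewrite big1 // => i _; rewrite c0 ltn0.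
have hp : par c < c by apply: par_lt; rewrite c0 /=.
rewrite (bigD1 (Ordinal (ltn_trans hp (ltn_ord c)))) //= hp eqxx big1 ?addn0 // => i ne.
by case: eqP => [e|]; rewrite ?andbF //; case/eqP: ne; apply: val_inj.
Qed.

Lemma split_root (F : nat -> nat) : 0 < KK ->
  \sum_(i < KK) F i = F 0 + \sum_(c < KK) (if 0 < c then F c else 0).
Proof. by case: KK => // n _; rewrite !big_ord_recl /= add0n. Qed.

Lemma hom_le_root a : 0 < KK -> hom a -> \sum_(i < KK) W i (a i) <= Val 0 (a 0).
Proof.
move=> K0 ha; pose F i := Val i (a i).
have le (i : 'I_KK) : W i (a i) + \sum_(c < KK) (if (i < c) && (par c == i) then F c else 0) <= F i.
  have [ai _] := ha i (ltn_ord i).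
  rewrite /F ValE // SmE // leq_add2l leq_sum // => c _.
  case: ifP => // /andP [ic /eqP pc].
  have [ac hc] := ha c (ltn_ord c).
  have [_ _ mx] := best_spec c ai; apply: mx => //.
  by rewrite pc in hc; case: hc => [e|//]; rewrite e in ic.
have : \sum_(i < KK) W i (a i) + \sum_(i < KK) \sum_(c < KK)
    (if (i < c) && (par c == i) then F c else 0) <= \sum_(i < KK) F i.
  by rewrite -big_split leq_sum.
by rewrite sum_children [leqRHS](split_root _ K0) leq_add2r.
Qed.

Lemma traceback : 0 < nr -> hom TR /\ (0 < KK -> forall a, hom a ->
  \sum_(i < KK) W i (a i) <= \sum_(i < KK) W i (TR i)).
Proof.
move=> n0.
have root : 0 < KK -> TR 0 < nr /\ forall u', u' < nr -> Val 0 u' <= Val 0 (TR 0).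
  move=> K0; rewrite TRE // /nextTR eqxx.
  have [|u0 [h1 h2 h3]] := @max_exists nr predT (Val 0); first by exists 0.
  have [|lt al _] := @FdP b nr (fun u => Al b nr (fun u' => Val 0 u' <= Val 0 u)) nrb.
    by exists u0 => //; rewrite AlE //; apply/allI => u' hu'; apply: h3.
  by split=> // u' hu'; move: al; rewrite AlE // => /allI /(_ u' hu').
have hT : hom TR.
  move=> i; elim/ltn_ind: i => i ih hi; have [e|i0] := posnP i.
    by rewrite e in hi *; have [h _] := root hi; split=> //; left.
  have hp : par i < i by apply: par_lt; rewrite i0.
  have [pn _] := ih _ hp (ltn_trans hp hi).
  have -> : TR i = best b nr cn Val i (TR (par i)).
    by rewrite TRE // /nextTR eqn0Ngt i0 hp.
  by have [h1 h2 _] := best_spec i pn; split=> //; right.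
split=> // K0 a ha; apply: leq_trans (hom_le_root K0 ha) _.
have [r0 mx] := root K0; have [a0 _] := ha 0 K0.
apply: leq_trans (mx _ a0) _; pose F i := Val i (TR i).
have eq (i : 'I_KK) : F i = W i (TR i) + \sum_(c < KK) (if (i < c) && (par c == i) then F c else 0).
  have [ai _] := hT i (ltn_ord i).
  rewrite {1}/F ValE // SmE //; congr addn; apply: eq_bigr => c _.
  case: ifP => // /andP [ic /eqP pc].
  by rewrite /F [in RHS](TRE (ltn_ord c)) /nextTR pc ic eqn0Ngt (leq_ltn_trans _ ic).
have : \sum_(i < KK) F i = \sum_(i < KK) W i (TR i) + \sum_(i < KK) \sum_(c < KK)
    (if (i < c) && (par c == i) then F c else 0).
  by rewrite -big_split; apply: eq_bigr => i _; rewrite eq.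
rewrite sum_children [LHS](split_root _ K0) => /eqP; rewrite eqn_add2r => /eqP <-.
exact: leqnn.
Qed.

End TreeProgramming.

Lemma card_bigcup_le (T I : finType) (P : pred I) (G : I -> {set T}) :
  #|\bigcup_(i | P i) G i| <= \sum_(i | P i) #|G i|.
Proof.
elim/big_rec2: _ => [|i n A _ h]; first by rewrite cards0.
by rewrite (leq_trans (leq_card_setU _ _)) // leq_add2l.
Qed.

Lemma sum_card_le (T : finType) n (G : nat -> {set T}) :
  \sum_(i < n) #|G i| <= #|\bigcup_(i < n) G i| + \sum_(i < n) \sum_(j < i) #|G i :&: G j|.
Proof.
elim: n => [|n ih]; first by rewrite !big_ord0.
have aux a u d v g w : a <= u + d -> v <= w -> v <= g -> a + g <= u + g - v + (d + w) by lia.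
rewrite !big_ord_recr /= cardsU; apply: aux ih _ (subset_leq_card (subsetIr _ _)).
by rewrite setIC big_distrr /= card_bigcup_le.
Qed.

Lemma sum_card (n : nat) (P : pred 'I_n) : \sum_(x < n) (P x : nat) = #|[set x : 'I_n | P x]|.
Proof.
rewrite -sum1dep_card [RHS]big_mkcond; apply: eq_bigr => x _ /=; by case: (P x).
Qed.

Section Ending.

Variables (b nr nb t : nat) (cn cv : nat -> nat -> bool) (pow : nat -> nat).
Variables (p ell e m mb nu g : nat) (par cls rho seed lab : nat -> nat) (KK : nat).
Variables (X TR : nat -> nat) (Val : nat -> nat -> nat).

Let ph := phi b pow e mb nu seed lab.
Let wt := weight b nr nb cv pow p ell e m mb nu cls rho seed lab X.
Let cx := covX b cv X.
Let co := comm b nb cv p X.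
Let cl := clash b nr nb cv p ell m cls rho X.

Hypotheses (nrb : nr <= b) (nbb : nb <= b) (Kb : KK <= b) (pb : p <= b).
Hypothesis nr_gt0 : 0 < nr.
Hypothesis par_lt : forall i, 0 < i < KK -> par i < i.
Hypothesis ValE : forall i v, i < KK -> v < nr -> Val i v =
  nextVal b nr nb cn cv pow p ell e m mb nu par cls rho seed lab KK X Val i v.
Hypothesis TRE : forall i, i < KK -> TR i = nextTR b nr cn par Val TR i.
Hypothesis ph_lt : forall x, x < nb -> ph x < g.
Hypothesis cls_inj : forall i j, i < KK -> j < KK -> cls i < p -> cls i = cls j -> i = j.

Definition counted (i v : nat) : {set 'I_nb} :=
  if cls i < p then
    if v == X (cls i) then [set x : 'I_nb | cv v x && ~~ cx (cls i) x] else set0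
  else if Md b v m == rho i then
    [set x : 'I_nb | cv v x && (~~ cx p x && ((ph x == cls i - p) && ~~ cl i v x))]
  else set0.

Lemma weightE i v : wt i v = #|counted i v|.
Proof.
rewrite /wt /weight /counted; case: ifP => _; case: ifP => _; rewrite ?cards0 // SmE //.
  by rewrite sum_card.
by rewrite sum_card.
Qed.

Definition sharing (i j : nat) : bool := (cls i == cls j) && (p <= cls i < p + g).

Lemma counted_meet a i j : (forall i, i < KK -> a i < nr) -> j < i -> i < KK ->
  #|counted i (a i) :&: counted j (a j)| <= if sharing i j then ell else 0.
Proof.
move=> an ji iK; have jK := ltn_trans ji iK.
have empty (A : {set 'I_nb}) : A =i set0 -> #|A| <= if sharing i j then ell else 0.
  by move/setP => ->; rewrite cards0.
have covM c c' x : c < c' -> c' <= p -> cv (X c) x -> cx c' x.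
  move=> cc' c'p h; rewrite /cx /covX HsE ?(leq_trans c'p) //.
  by apply/hasI; exists c.
rewrite /counted; case: (ltnP (cls i) p) => hi; case: (ltnP (cls j) p) => hj.
- case: eqP => [ei|_]; last by rewrite set0I; apply: empty.
  case: eqP => [ej|_]; last by rewrite setI0; apply: empty.
  apply: empty => x; rewrite !inE; apply/negbTE/negP.
  case/andP => /andP [c1 n1] /andP [c2 n2].
  case: (ltngtP (cls i) (cls j)) => h.
  + by case/negP: n2; apply: covM h (ltnW hj) _; rewrite -ei.
  + by case/negP: n1; apply: covM h (ltnW hi) _; rewrite -ej.
  + by have := cls_inj iK jK hi h => e'; rewrite e' ltnn in ji.
- case: eqP => [ei|_]; last by rewrite set0I; apply: empty.
  case: eqP => [ej|_]; last by rewrite setI0; apply: empty.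
  apply: empty => x; rewrite !inE; apply/negbTE/negP.
  case/andP => /andP [c1 n1] /andP [c2 /andP [n2 _]].
  by case/negP: n2; apply: covM hi (leqnn _) _; rewrite -ei.
- case: eqP => [ei|_]; last by rewrite set0I; apply: empty.
  case: eqP => [ej|_]; last by rewrite setI0; apply: empty.
  apply: empty => x; rewrite !inE; apply/negbTE/negP.
  case/andP => /andP [c1 /andP [n1 _]] /andP [c2 n2].
  by case/negP: n1; apply: covM hj (leqnn _) _; rewrite -ej.
- case: eqP => [ei|_]; last by rewrite set0I; apply: empty.
  case: eqP => [ej|_]; last by rewrite setI0; apply: empty.
  rewrite /sharing hi /=.
  case: eqP => [eij|nij] /=; last first.
    apply: (leq_trans (n := 0)) => //; rewrite leqn0 cards_eq0; apply/eqP/setP => x.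
    rewrite !inE; apply/negbTE/negP.
    case/andP => /andP [_ /andP [_ /andP [/eqP p1 _]]] /andP [_ /andP [_ /andP [/eqP p2 _]]].
    by apply: nij; rewrite -(subnK hi) -(subnK hj) -p1 -p2.
  case: (ltnP (cls i) (p + g)) => hg; last first.
    rewrite leqn0 cards_eq0; apply/eqP/setP => x.
    rewrite !inE; apply/negbTE/negP.
    case/andP => /andP [_ /andP [_ /andP [/eqP p1 _]]] _.
    by have := ph_lt (ltn_ord x); rewrite p1; lia.
  case: (ltnP (co (a j) (a i)) ell) => hc.
    apply: leq_trans (ltnW hc); rewrite /co /comm SmE // sum_card subset_leq_card //.
    apply/subsetP => x; rewrite !inE.
    by case/andP => /andP [-> /andP [-> _]] /andP [-> _].
  apply: (leq_trans (n := 0)) => //; rewrite leqn0 cards_eq0; apply/eqP/setP => x.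
  rewrite !inE; apply/negbTE/negP.
  case/andP => /andP [_ /andP [_ /andP [_ /negP nc]]] /andP [cj _]; apply: nc.
  rewrite /cl /clash HsE ?(leq_trans (ltnW iK)) //; apply/hasI; exists j => //.
  rewrite eij eqxx /= HsE //; apply/hasI; exists (a j); first exact: an.
  by rewrite ej eqxx cj andbT /=.
Qed.

Lemma sum_weight_le a : (forall i, i < KK -> a i < nr) ->
  \sum_(i < KK) wt i (a i) <= Sm b nb (fun x => Hs b KK (fun i => cv (a i) x)) +
    \sum_(i < KK) \sum_(j < i) (if sharing i j then ell else 0).
Proof.
move=> an; under eq_bigr => i _ do rewrite weightE.
apply: leq_trans (sum_card_le _ (fun i => counted i (a i))) _; apply: leq_add.
  rewrite SmE // sum_card subset_leq_card //; apply/bigcupsP => i _; apply/subsetP => x hx.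
  rewrite inE HsE //; apply/hasI; exists (val i); first exact: ltn_ord.
  move: hx; rewrite /counted; case: ifP => _; case: ifP => _; rewrite inE //.
    by case/andP.
  by case/andP.
by apply: leq_sum => i _; apply: leq_sum => j _; apply: counted_meet.
Qed.

Variables (ts : nat -> nat) (T : {set 'I_nb}).

Hypothesis ts_hom : hom nr KK cn par ts.
Hypothesis fixed : forall c, c < p -> exists i, [/\ i < KK, cls i = c & ts i = X c].
Hypothesis T_new : forall x, x \in T -> ~~ cx p x.
Hypothesis T_owned : forall x, x \in T -> exists i, [/\ i < KK, p <= cls i, cv (ts i) x,
  ph x = cls i - p & rho i = Md b (ts i) m] /\
  forall j u, j < i -> cls j = cls i -> u < nr -> Md b u m = rho j ->
    ell <= co u (ts i) -> ~~ cv u x.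

Lemma sum_weight_ge : fX b nb cv X p + #|T| <= \sum_(i < KK) wt i (ts i).
Proof.
have tsn i : i < KK -> ts i < nr by case/ts_hom.
under eq_bigr => i _ do rewrite weightE.
apply: leq_trans (card_bigcup_le _ _).
rewrite /fX SmE // sum_card -/cx -(cardsID [set x : 'I_nb | cx p x] (\bigcup_(i < KK) _)).
apply: leq_add; apply/subset_leq_card/subsetP => x.
  rewrite inE => hx; rewrite 2!inE hx andbT.
  move: (hx); rewrite {1}/cx /covX HsE // => /hasI ex.
  have exn : exists c, (c < p) && cv (X c) x by case: ex => c h1 h2; exists c; rewrite h1.
  case: (ex_minnP exn) => c /andP [cp hc] mn.
  have [i [iK ci ti]] := fixed cp.
  apply/bigcupP; exists (Ordinal iK) => //; rewrite /counted /= ci cp ti eqxx inE hc /=.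
  apply/negP; rewrite /cx /covX HsE; last exact: leq_trans (ltnW cp) pb.
  case/hasI => c' h1 h2; have := mn c'; rewrite h2 (ltn_trans h1 cp) => /(_ isT).
  by rewrite leqNgt h1.
move=> xT; rewrite 2!inE (T_new xT) /=.
have [i [[iK pi hc hp hr] h]] := T_owned xT.
apply/bigcupP; exists (Ordinal iK) => //.
rewrite /counted /= ltnNge pi /= hr eqxx inE hc hp eqxx (T_new xT) /=.
apply/negP; rewrite /cl /clash HsE; last exact: leq_trans (ltnW iK) Kb.
case/hasI => j ji /andP [/eqP cj]; rewrite HsE // => /hasI [u un /andP [/eqP hu /andP [hc' cu]]].
by case/negP: (h j u ji cj un hu hc').
Qed.

Lemma ending : 0 < KK ->
  t + \sum_(i < KK) \sum_(j < i) (if sharing i j then ell else 0) <= fX b nb cv X p + #|T| ->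
  valid b nr nb t cn cv par KK TR.
Proof.
move=> K0 le; have [hT mx] := @traceback b nr KK cn par wt Val TR nrb Kb par_lt ValE TRE nr_gt0.
have tn i : i < KK -> TR i < nr by case/hT.
rewrite /valid AlE //; apply/andP; split.
  apply/allI => i iK; have [-> h] := hT i iK; have [//|i0] := posnP i.
  rewrite par_lt ?i0 //=; case: h => [e0|[->|->]]; rewrite ?eqxx ?orbT //.
  by rewrite e0 in i0.
have := leq_trans le (leq_trans sum_weight_ge (leq_trans (mx K0 ts ts_hom) (sum_weight_le tn))).
by rewrite leq_add2r.
Qed.

End Ending.

Lemma subset_of_card (T : finType) (A : {set T}) n : n <= #|A| ->
  exists2 B : {set T}, B \subset A & #|B| = n.
Proof.
move=> h; have : 0 < #|[set B : {set T} | B \subset A & #|B| == n]|.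
  by rewrite cards_draws bin_gt0.
by case/card_gt0P => B; rewrite inE => /andP [sB /eqP cB]; exists B.
Qed.

Section Guessing.

Variables (b nr nb k t d q N : nat) (cn cv : nat -> nat -> bool) (S : seq nat).

Variable near : nat -> nat -> bool.
Let dl := k %/ q.

Definition nbh (u : nat) : {set 'I_nb} := [set x : 'I_nb | cv u x].
Definition cov_by (xs : seq nat) : {set 'I_nb} := [set x : 'I_nb | has (fun u => cv u x) xs].

Hypotheses (nrb : nr <= b) (nbb : nb <= b) (kb : k < b).
Hypotheses (k0 : 0 < k) (q0 : 0 < q).
Hypothesis nearE : forall u v, u < nr -> v < nr -> near u v = walk nr cn dl u v.
Hypothesis cn_sym : forall u v, cn u v = cn v u.
Hypotheses (uS : uniq S) (Sn : all (fun v => v < nr) S) (Sk : size S <= k).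
Hypothesis gS : grows cn S.
Hypothesis tS : t <= #|cov_by S|.
Hypothesis few : forall (W : {set 'I_nb}) l, d <= l -> #|W| <= 6 * k ^ 3 * (l - d).+1 ->
  count (fun u => l <= #|nbh u :&: W|) (iota 0 nr) <= N.

Lemma covX_nth xs l x : l <= size xs -> l <= b ->
  covX b cv (nth 0 xs) l x = has (fun u => cv u x) (take l xs).
Proof.
move=> ls lb; rewrite /covX HsE //; apply/hasI/hasP => [[i il h]|[u /(nthP 0) [i il <-] h]].
  exists (nth 0 xs i) => //; apply/(nthP 0); exists i; first by rewrite size_takel.
  by rewrite nth_take.
rewrite size_takel // in il.
by exists i => //; rewrite -(nth_take 0 il).
Qed.

Lemma fX_nth xs l : l <= size xs -> l <= b ->
  fX b nb cv (nth 0 xs) l = #|cov_by (take l xs)|.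
Proof.
move=> ls lb; rewrite /fX SmE // sum_card; apply: eq_card => x.
by rewrite !inE covX_nth.
Qed.

Lemma rdeg_nth xs l u : l <= size xs -> l <= b ->
  rdeg b nb cv (nth 0 xs) l u = #|nbh u :\: cov_by (take l xs)|.
Proof.
move=> ls lb; rewrite /rdeg SmE // sum_card; apply: eq_card => x.
by rewrite !inE covX_nth // andbC.
Qed.

Lemma heavy_nth xs l u : l <= size xs -> l <= b ->
  heavy b nb k t cv near (nth 0 xs) l u =
  has (near^~ u) (take l xs) &&
  (t - #|cov_by (take l xs)| <= k * #|nbh u :\: cov_by (take l xs)|).
Proof.
move=> ls lb; rewrite /heavy fX_nth // rdeg_nth // HsE // /Ml (minn_idPl (ltnW kb)).
congr andb; apply/hasI/hasP => [[i il h]|[v /(nthP 0) [i il <-] h]].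
  exists (nth 0 xs i) => //; apply/(nthP 0); exists i; first by rewrite size_takel.
  by rewrite nth_take.
rewrite size_takel // in il.
by exists i => //; rewrite -(nth_take 0 il).
Qed.

Definition coded (xs ys st : seq nat) : Prop :=
  [/\ size st = size xs, size ys = count (pred1 0) st &
    forall l, l < size xs -> nth 0 xs l =
      nextX b nr nb k t cv near (nth 0 ys) (nth 0 st) (nth 0 xs) l].

Lemma nextX_local far far' step step' X X' l : l <= b ->
  (forall j, j < l -> X j = X' j) -> (forall j, j <= l -> step j = step' j) ->
  (step l = 0 -> far (count (fun j => step j == 0) (iota 0 l)) =
                 far' (count (fun j => step j == 0) (iota 0 l))) ->
  nextX b nr nb k t cv near far step X l = nextX b nr nb k t cv near far' step' X' l.
Proof.
move=> lb hX hs hf.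
have hc x : covX b cv X l x = covX b cv X' l x.
  rewrite /covX !HsE //; apply: eq_in_has => j; rewrite mem_iota add0n => /= jl.
  by rewrite hX.
have hh u : heavy b nb k t cv near X l u = heavy b nb k t cv near X' l u.
  rewrite /heavy; congr (_ && (_ - _ <= Ml _ _ _)).
  - rewrite !HsE //; apply: eq_in_has => j; rewrite mem_iota add0n => /= jl.
    by rewrite hX.
  - by apply: eq_bigr => x _; rewrite hc.
  - by apply: eq_bigr => x _; rewrite hc.
rewrite /nextX -hs //; case: eqP => z.
  have cE (s : nat -> nat) : (forall j, j < l -> step j = s j) ->
      Sm b l (fun j => s j == 0) = count (fun j => step j == 0) (iota 0 l).
    move=> e; rewrite SmE // -sum1_count [RHS]big_mkcond /=.
    have -> : iota 0 l = index_iota 0 l by rewrite /index_iota subn0.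
    by rewrite big_mkord; apply: eq_bigr => j _; rewrite e //; case: eqP.
  by rewrite (cE step) // (cE step') ?hf // => j jl; rewrite hs // ltnW.
rewrite /Fd; apply: eq_find => v; rewrite hh; congr (_ && (_ == _)).
by apply: eq_bigr => u _; rewrite hh.
Qed.

Lemma coded_X xs ys st far step X : coded xs ys st -> size xs <= b ->
  (forall l, l < size xs -> step l = nth 0 st l) ->
  (forall l, l < size ys -> far l = nth 0 ys l) ->
  (forall l, l < size xs -> X l = nextX b nr nb k t cv near far step X l) ->
  forall l, l < size xs -> X l = nth 0 xs l.
Proof.
move=> [s1 s2 h] xb hst hfar hX; elim/ltn_ind => l ih lx.
rewrite hX // h //; apply: nextX_local => //.
- by rewrite (leq_trans (ltnW lx)).
- by move=> j jl; apply: ih => //; apply: ltn_trans jl lx.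
- by move=> j jl; apply: hst; apply: leq_ltn_trans jl lx.
move=> z; apply: hfar; rewrite s2.
have -> : count (fun j => step j == 0) (iota 0 l) = count (pred1 0) (take l st).
  rewrite -[st in RHS](mkseq_nth 0) /mkseq -map_take take_iota s1 (minn_idPl (ltnW lx)) count_map.
  by apply: eq_in_count => j; rewrite mem_iota /= add0n => jl; rewrite hst // (ltn_trans jl).
rewrite -[st in X in _ < X](cat_take_drop l) count_cat -[ltnLHS]addn0 ltn_add2l.
by rewrite (drop_nth 0) ?s1 // -hst // z /= add1n.
Qed.

Lemma coded_rcons xs ys st y ys' s : coded xs ys st -> size xs <= b ->
  (ys' = ys /\ s != 0 \/ ys' = rcons ys y /\ s = 0) ->
  y = nextX b nr nb k t cv near (nth 0 ys') (nth 0 (rcons st s)) (nth 0 xs) (size xs) ->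
  coded (rcons xs y) ys' (rcons st s).
Proof.
move=> [s1 s2 h] xb hs hy; split.
- by rewrite !size_rcons s1.
- rewrite -cats1 count_cat /= addn0.
  by case: hs => [[-> /negbTE ->]|[-> ->]]; rewrite ?size_rcons ?s2 ?addn0 ?addn1.
move=> l; rewrite size_rcons ltnS leq_eqVlt => /orP [/eqP -> |lx].
  rewrite nth_rcons ltnn eqxx {1}hy; apply: nextX_local => // j jl.
  by rewrite nth_rcons jl.
rewrite nth_rcons lx h //; apply: nextX_local.
- by rewrite (leq_trans (ltnW lx)).
- by move=> j jl; rewrite nth_rcons (ltn_trans jl lx).
- by move=> j jl; rewrite nth_rcons s1 (leq_ltn_trans jl lx).
move=> z; case: hs => [[-> _]|[-> _]] //; rewrite nth_rcons s2.
suff -> : count (fun j => nth 0 st j == 0) (iota 0 l) < count (pred1 0) st by [].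
have -> : count (fun j => nth 0 st j == 0) (iota 0 l) = count (pred1 0) (take l st).
  rewrite -[st in RHS](mkseq_nth 0) /mkseq -map_take take_iota s1 (minn_idPl (ltnW lx)) count_map.
  by [].
rewrite -[st in X in _ < X](cat_take_drop l) count_cat -[ltnLHS]addn0 ltn_add2l.
by rewrite (drop_nth 0) ?s1 // z /= add1n.
Qed.

Record guess (xs ys st : seq nat) : Prop := Guess {
  g_coded : coded xs ys st;
  g_uniq : uniq xs;
  g_far : size ys <= 2 * q;
  g_step : all (fun s => s <= N.+1) st;
  g_nr : all (fun v => v < nr) xs;
  g_ynr : all (fun v => v < nr) ys
}.

(* The three ways in which the guessing of vertices of [S] stops: little
   remains to be covered; one vertex of [S] covers the rest; a further vertex
   near the guessed ones covers much that [S] does not. *)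
Definition stop_small (xs : seq nat) : Prop :=
  {subset xs <= S} /\ t <= #|cov_by xs| + 4 * k * d.

Definition stop_single (xs : seq nat) : Prop :=
  {subset xs <= S} /\ exists2 z, z \in S & t <= #|cov_by xs| + #|nbh z :\: cov_by xs|.

Definition stop_extra (xs : seq nat) : Prop :=
  exists xs0 u (T : {set 'I_nb}), let t' := t - #|cov_by xs0| in
  [/\ xs = rcons xs0 u, {subset xs0 <= S}, has (near^~ u) xs0,
    T \subset cov_by S :\: cov_by xs0 & #|T| = t'] /\
  [/\ 4 * k * d < t', #|nbh u :&: T| < d + t' %/ (6 * k ^ 3),
    t' <= k * #|nbh u :\: cov_by xs0| &
    forall z, z \in S -> #|nbh z :\: cov_by xs0| < t'].

Lemma cov_by_rcons xs u : cov_by (rcons xs u) = nbh u :|: cov_by xs.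
Proof. by apply/setP => x; rewrite !inE has_rcons. Qed.

Lemma heavy_member xs : t - #|cov_by xs| > 0 ->
  exists2 y, y \in S & t - #|cov_by xs| <= k * #|nbh y :\: cov_by xs|.
Proof.
set t' := t - _ => t0; apply/hasP; apply: contraT => /hasPn no.
have : t' <= \sum_(y <- S) #|nbh y :\: cov_by xs|.
  have h : t' <= #|cov_by S :\: cov_by xs|.
    have := cardsID (cov_by xs) (cov_by S).
    have := subset_leq_card (subsetIr (cov_by S) (cov_by xs)).
    by rewrite /t'; move: tS; lia.
  apply: leq_trans h _; elim: (S) => [|y s ih] /=.
    by rewrite big_nil leqn0 cards_eq0 -subset0; apply/subsetP => x; rewrite !inE andbF.
  rewrite big_cons; apply: leq_trans (leq_add (leqnn _) ih).
  rewrite -cardsUI; apply: leq_trans (leq_addr _ _); rewrite subset_leq_card //.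
  by apply/subsetP => x; rewrite !inE /= -andb_orr.
have : \sum_(y <- S) (k * #|nbh y :\: cov_by xs|).+1 <= \sum_(y <- S) t'.
  by rewrite !big_seq leq_sum // => y /no; rewrite -ltnNge.
under eq_bigr => y _ do rewrite -addn1.
rewrite big_split /= -big_distrr /= !big_const_seq !count_predT !iter_addn_0 mul1n => h1 h2.
have h3 : k * t' <= k * \sum_(y <- S) #|nbh y :\: cov_by xs| by rewrite leq_mul2l h2 orbT.
have h4 : t' * size S <= t' * k by rewrite leq_mul2l Sk orbT.
have : size S <= 0.
  rewrite -(leq_add2l (k * \sum_(i <- S) #|nbh i :\: cov_by xs|)) addn0.
  by apply: leq_trans h1 (leq_trans h4 _); rewrite mulnC.
by rewrite leqn0 => /nilP e; move: h2; rewrite e big_nil leqNgt t0.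
Qed.

Lemma count_iota_lt (P : pred nat) n m : n < m -> P n -> count P (iota 0 n) < count P (iota 0 m).
Proof.
move=> nm pn; have -> : m = n + (m - n.+1).+1 by lia.
by rewrite iotaD count_cat /= pn; lia.
Qed.

Lemma Fd_rank (P : pred nat) u : u < nr -> P u ->
  Fd b nr (fun v => P v && (Sm b v (fun w => P w : nat) == count P (iota 0 u))) = u.
Proof.
move=> un pu.
have cE v : v <= nr -> Sm b v (fun w => P w : nat) = count P (iota 0 v).
  move=> vn; rewrite SmE; last exact: leq_trans vn nrb.
  rewrite -sum1_count [RHS]big_mkcond /=.
  have -> : iota 0 v = index_iota 0 v by rewrite /index_iota subn0.
  by rewrite big_mkord; apply: eq_bigr => j _; case: (P j).
have [|lt /andP [pv /eqP cv'] mn] := @FdP b nr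
    (fun v => P v && (Sm b v (fun w => P w : nat) == count P (iota 0 u))) nrb.
  by exists u => //; rewrite pu cE ?eqxx // ltnW.
move: lt pv cv'; set v := Fd _ _ _ => lt pv; rewrite cE ?(ltnW lt) // => e.
case: (ltngtP v u) => // h.
  by have := count_iota_lt h pv; rewrite e ltnn.
by have := count_iota_lt h pu; rewrite e ltnn.
Qed.

Lemma guessing : exists xs ys st,
  [/\ guess xs ys st, size xs <= k.+1 & stop_small xs \/ stop_single xs \/ stop_extra xs].
Proof.
suff main n : forall xs ys st, size S - size xs <= n ->
    [/\ coded xs ys st, uniq xs, {subset xs <= S} & all (fun s => s <= N.+1) st] ->
    [/\ uniq ys, {subset ys <= xs} & {in ys &, forall y y', y != y' -> ~~ near y y'}] ->
    exists xs ys st,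
    [/\ guess xs ys st, size xs <= k.+1 & stop_small xs \/ stop_single xs \/ stop_extra xs].
  by apply: (main _ [::] [::] [::] (leqnn _)); split.
have Sn' v : v \in S -> v < nr := allP Sn v.
have farq ys : uniq ys -> {subset ys <= S} ->
    {in ys &, forall y y', y != y' -> ~~ near y y'} -> size ys <= 2 * q.
  move=> uy sub h; apply: (@packing nr cn cn_sym S ys dl k q) => //.
    by rewrite -ltn_divLR.
  by move=> y y' hy hy' /(h _ _ hy hy'); rewrite nearE // Sn' // sub.
elim: n => [|n ih] xs ys st hn [cd ux xS hst] [uy yx far].
all: have xk : size xs <= k by apply: leq_trans Sk; apply: uniq_leq_size.
all: have gd : guess xs ys st by split=> //; [apply: farq => // y /yx /xS | apply/allP => v /xS /Sn' | apply/allP => v /yx /xS /Sn'].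
all: have [sm|big] := leqP t (#|cov_by xs| + 4 * k * d);
  first by exists xs, ys, st; split=> //; [exact: leqW | left].
all: have [/hasP [z zS hz]|/hasPn single] :=
  boolP (has (fun z => t <= #|cov_by xs| + #|nbh z :\: cov_by xs|) S);
  first by exists xs, ys, st; split=> //; [exact: leqW | right; left; split=> //; exists z].
all: have [|y yS hy] := @heavy_member xs; first by lia.
all: have t0 : t - #|cov_by xs| > 0 by lia.
all: have newx v : t - #|cov_by xs| <= k * #|nbh v :\: cov_by xs| -> v \notin xs
  by move=> hv; apply/negP => vxs; move: t0; rewrite ltnNge (leq_trans hv) //;
     rewrite leqn0 muln_eq0 cards_eq0 -subset0; apply/orP; right; apply/subsetP => x;
     rewrite !inE => /andP [/hasPn /(_ v vxs) /negbTE ->].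
  case/negP: (newx _ hy).
  have [] := uniq_min_size ux xS; first by rewrite -subn_eq0 -leqn0.
  by move=> _ ->.
have xb : size xs <= b by apply: leq_trans xk (ltnW kb).
have hE u : heavy b nb k t cv near (nth 0 xs) (size xs) u =
    has (near^~ u) xs && (t - #|cov_by xs| <= k * #|nbh u :\: cov_by xs|).
  by rewrite heavy_nth // take_size.
have [nr_y|far_y] := boolP (has (near^~ y) xs); last first.
  apply: (ih (rcons xs y) (rcons ys y) (rcons st 0)).
  - by rewrite size_rcons; lia.
  - split.
    + apply: (coded_rcons cd xb _ _); first by right.
      have [s1 s2 _] := cd.
      rewrite /nextX nth_rcons s1 ltnn eqxx /= nth_rcons s2.
      suff -> : Sm b (size xs) (fun j => nth 0 (rcons st 0) j == 0) = count (pred1 0) st.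
        by rewrite ltnn eqxx.
      rewrite SmE // -s1 -[st in RHS](mkseq_nth 0) /mkseq count_map.
      rewrite -sum1_count [RHS]big_mkcond /=.
      have -> : iota 0 (size st) = index_iota 0 (size st) by rewrite /index_iota subn0.
      by rewrite big_mkord; apply: eq_bigr => j _; rewrite nth_rcons ltn_ord; case: eqP.
    + by rewrite rcons_uniq newx.
    + by move=> v; rewrite mem_rcons inE => /orP [/eqP ->|/xS].
    + by rewrite all_rcons.
  - split.
    + rewrite rcons_uniq uy andbT; apply/negP => /yx; apply/negP; exact: newx.
    + move=> v; rewrite !mem_rcons !inE => /orP [->//|/yx ->]; exact: orbT.
    + have hf v : v \in ys -> ~~ near v y.
        by move=> /yx vx; apply: (hasPn far_y).
      move=> v v'; rewrite !mem_rcons !inE => /orP [/eqP ->|vy] /orP [/eqP ->|vy'] ne.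
      * by rewrite eqxx in ne.
      * have vn' := Sn' _ (xS _ (yx _ vy')); have yn := Sn' _ yS.
        apply/negP; rewrite nearE // => h; case/negP: (hf v' vy').
        by rewrite nearE //; apply: walk_sym.
      * exact: hf.
      * exact: far.
set P := heavy b nb k t cv near (nth 0 xs) (size xs) in hE.
have step_near u : u < nr -> P u -> y = u \/ True ->
    coded (rcons xs u) ys (rcons st (count P (iota 0 u)).+1).
  move=> un pu _; apply: (coded_rcons cd xb _ _); first by left.
  have [s1 s2 _] := cd.
  by rewrite /nextX nth_rcons s1 ltnn eqxx /= Fd_rank.
have Py : P y by rewrite hE nr_y.
have [rk|rk] := leqP (count P (iota 0 y)) N.
  apply: (ih (rcons xs y) ys (rcons st (count P (iota 0 y)).+1)).
  - by rewrite size_rcons; lia.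
  - split.
    + by apply: step_near => //; [apply: Sn' | left].
    + by rewrite rcons_uniq newx.
    + by move=> v; rewrite mem_rcons inE => /orP [/eqP ->|/xS].
    + by rewrite all_rcons ltnS rk.
  - by split=> // v /yx; rewrite mem_rcons inE => ->; rewrite orbT.
set t' := t - #|cov_by xs| in t0 hE.
have [|T sT cT] := @subset_of_card _ (cov_by S :\: cov_by xs) t'.
  have := cardsID (cov_by xs) (cov_by S).
  have := subset_leq_card (subsetIr (cov_by S) (cov_by xs)).
  by rewrite /t'; move: tS; lia.
set l := d + t' %/ (6 * k ^ 3).
have k30 : 0 < 6 * k ^ 3 by rewrite muln_gt0 expn_gt0 k0.
have fewT : count (fun u => l <= #|nbh u :&: T|) (iota 0 nr) <= N.
  apply: few; first exact: leq_addr.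
  by rewrite cT /l addKn mulnC ltnW // ltn_ceil.
have exu : exists u, [&& u < nr, P u & #|nbh u :&: T| < l].

  case E : (has (fun u => P u && (#|nbh u :&: T| < l)) (iota 0 nr)).
    case/hasP: E => u; rewrite mem_iota add0n /= => un /andP [pu hu].
    by exists u; rewrite un pu.
  move/negbT/hasPn: E => no; move: rk; rewrite ltnNge => /negP; case.
  apply: leq_trans _ fewT; apply: (@leq_trans (count P (iota 0 nr))).
    rewrite -(subnKC (ltnW (Sn' _ yS))) iotaD count_cat; exact: leq_addr.
  rewrite (@eq_in_count _ _ (fun u => P u && (l <= #|nbh u :&: T|))) => [|u /no].
    by apply: sub_count => u /andP [].
  by rewrite negb_and -leqNgt; case: (P u) => //= ->.
case: (ex_minnP exu) => u /and3P [un pu hu] mn.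
have rku : count P (iota 0 u) <= N.
  apply: leq_trans _ fewT.
  apply: (@leq_trans (count (fun u => l <= #|nbh u :&: T|) (iota 0 u))); last first.
    by rewrite -(subnKC (ltnW un)) iotaD count_cat; exact: leq_addr.
  rewrite -!size_filter uniq_leq_size ?filter_uniq ?iota_uniq // => v.
  rewrite !mem_filter mem_iota add0n /= => /andP [pv vu]; rewrite vu andbT.
  rewrite leqNgt; apply/negP => hv; have := mn v.
  by rewrite pv hv (ltn_trans vu un) leqNgt vu => /(_ isT).
move: (pu); rewrite hE => /andP [nu' hvu].
exists (rcons xs u), ys, (rcons st (count P (iota 0 u)).+1); split.
- split.
  + by apply: step_near => //; right.
  + by rewrite rcons_uniq newx.
  + exact: g_far gd.
  + by rewrite all_rcons ltnS rku.
  + by rewrite all_rcons un (g_nr gd).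
  + exact: g_ynr gd.
- by rewrite size_rcons.
- right; right; exists xs, u, T; split; split=> //.
  + by rewrite ltn_subRL.
  + by move=> z /single; rewrite -ltnNge ltn_subRL.
Qed.

End Guessing.

Lemma modulus_separating (A B : seq nat) w :
  all (fun x => x < 2 ^ w) A -> all (fun x => x < 2 ^ w) B ->
  exists2 m, 0 < m <= 2 * (size A * size B * w).+1 &
    forall x y, x \in A -> y \in B -> x %% m = y %% m -> x = y.
Proof.
move=> hA hB.
pose D := [seq z <- [seq (x - y) + (y - x) | x <- A, y <- B] | z != 0].
have [|m hm hD] := @modulus_avoiding D w.
  apply/allP => z; rewrite mem_filter => /andP [z0 /allpairsP [[x y] /= [xA yB e]]].
  have := allP hA x xA; have := allP hB y yB; lia.
exists m.
  case/andP: hm => -> hm; apply: leq_trans hm _; rewrite leq_mul2l ltnS leq_mul2r /=.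
  by rewrite size_filter (leq_trans (count_size _ _)) ?size_allpairs // orbT.
move=> x y xA yB /eqP e; apply/eqP; apply: contraT => ne.
have : ~~ (m %| (x - y) + (y - x)).
  apply: (allP hD); rewrite mem_filter; apply/andP; split; first by move/eqP: ne; lia.
  by apply/allpairsP; exists (x, y).
case: (leqP x y) => h.
  rewrite (eqP (_ : x - y == 0)) ?subn_eq0 // add0n -eqn_mod_dvd // eq_sym.
  by rewrite e.
by rewrite (eqP (_ : y - x == 0)) ?subn_eq0 ?(ltnW h) // addn0 -eqn_mod_dvd ?(ltnW h) // e.
Qed.

Section PhiExists.

Variables (b nb nu wn : nat).
Hypotheses (nbb : nb <= b) (b2 : 1 < b) (nub : nu <= b).

Let pow := powb b.

Lemma phiE mb seed lab e x : x < nb -> e < b -> nu * 2 ^ e <= b ->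
  (forall j, seed j <= 2 ^ e) ->
  phi b pow e mb nu seed lab x = resolve nu seed lab e (x %% mb).
Proof.
move=> xn eb nue hs.
have xb : x <= b by apply: leq_trans (ltnW xn) nbb.
have mE : Md b x mb = x %% mb by rewrite MdE // (leq_trans (leq_div _ _)).
have yb : x %% mb <= b by apply: leq_trans (leq_mod _ _) xb.
rewrite /phi mE; set y := x %% mb in yb *.
have sE i : i <= e -> slot b pow nu seed lab i y = slotp nu seed lab i y.
  move=> ie; have ib := leq_ltn_trans ie eb; rewrite /slot /slotp /hsh /pow {1 3}/powb ib.
  have S1 : Sm b nu (fun j => Ml b (bitof b (powb b) y j) (seed (Ml b i nu + j))) =
      \sum_(j < nu) (y %/ 2 ^ j) %% 2 * seed (i * nu + j).
    rewrite SmE //; apply: eq_bigr => j _.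
    have dE : Dv b y (2 ^ j) = y %/ 2 ^ j.
      by rewrite /Dv (minn_idPl _) // (leq_trans (leq_div _ _)).
    rewrite /bitof {1}/powb (leq_trans (ltn_ord j) nub) dE MdE; last by rewrite (leq_trans (leq_div _ _)) // (leq_trans (leq_div _ _)).
    rewrite /Ml (minn_idPl (leq_trans ie (ltnW eb))) (minn_idPl _) //.
    by apply: leq_trans b2; rewrite ltnW // ltn_pmod.
  rewrite S1 MdE // (leq_trans (leq_div _ _)) //; apply: leq_trans nue.
  have -> : nu * 2 ^ e = \sum_(j < nu) 2 ^ e by rewrite sum_nat_const card_ord.
  apply: leq_sum => j _.
  rewrite -[2 ^ e]mul1n leq_mul //; first by rewrite -ltnS ltn_pmod.
rewrite /resolve sE ?leq_subr //; congr ((slotp _ _ _ (_ - _) _).-1).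
rewrite /Fd (minn_idPl eb); apply: eq_find => j; rewrite sE ?leq_subr //.
Qed.

Lemma phi_exists (T : {set 'I_nb}) e g (L : nat -> nat) : nb <= 2 ^ wn ->
  4 * #|T| <= 2 ^ e -> (forall x, L x < g) -> e < b -> nu * 2 ^ e <= b ->
  2 * (#|T| * #|T| * wn).+1 <= 2 ^ nu ->
  exists mb seed lab, [/\ mb <= 2 ^ nu,
    forall j, seed j < 2 ^ e /\ (e.+1 * nu <= j -> seed j = 0),
    forall z, lab z <= g /\ (2 ^ e.+1 <= z -> lab z = 0)
    & {in T, forall x : 'I_nb, phi b pow e mb nu seed lab x = L x}].
Proof.
move=> wn_nb cT hL eb nue hmb.
pose A := [seq val x | x <- enum T].
have memA (x : 'I_nb) : x \in T -> val x \in A by move=> xT; rewrite map_f // mem_enum.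
have An : all (fun x => x < 2 ^ wn) A.
  by apply/allP => _ /mapP [x _ ->]; exact: leq_trans (ltn_ord x) wn_nb.
have [mb] := modulus_separating An An; rewrite size_map -cardE => /andP [mb0 mbS] inj.
have mbn : mb <= 2 ^ nu by apply: leq_trans mbS hmb.
have uA : uniq A by rewrite map_inj_uniq ?enum_uniq //; exact: val_inj.
pose lb y := L (head 0 [seq x <- A | x %% mb == y]).
have [||||seed [lab [h1 h2 h3]]] := @peel nu e [seq x %% mb | x <- A] lb g.
- by rewrite map_inj_in_uniq // => x y hx hy; exact: inj.
- apply/allP => _ /mapP [x _ ->]; apply: leq_trans mbn; exact: ltn_pmod.
- by rewrite !size_map -cardE.
- by move=> y; exact: hL.
exists mb, (fun j => if j < e.+1 * nu then seed j else 0).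
exists (fun z => if z < 2 ^ e.+1 then lab z else 0); split=> // [j|z|x xT].
- split; first by case: ifP => _; rewrite ?expn_gt0.
  by move=> h; rewrite ltnNge h.
- split; first by case: ifP.
  by move=> h; rewrite ltnNge h.
rewrite phiE // => [|j]; last by case: ifP => // _; apply: ltnW.
rewrite (resolve_local (seed' := seed) (lab' := lab)) => [|z -> //|z -> //].
rewrite h3; last by apply/mapP; exists (val x) => //; exact: memA.
rewrite /lb; congr L.
have : val x \in [seq z <- A | z %% mb == x %% mb] by rewrite mem_filter eqxx memA.
case E : [seq z <- A | _] => [|a l] //= _.
have : a \in [seq z <- A | z %% mb == x %% mb] by rewrite E mem_head.
by rewrite mem_filter => /andP [/eqP h aA]; apply: inj => //; apply: memA.
Qed.

Lemma phi_trivial x : x < nb -> nu <= b -> 0 < b ->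
  phi b pow 0 1 nu (fun=> 0) (fun=> 0) x = 0.
Proof. by move=> *; rewrite phiE ?expn0 ?muln1. Qed.

End PhiExists.

Section EndingAdvice.

Variables (b nr nb t : nat) (cn cv : nat -> nat -> bool).
Variables (ell m g nu : nat) (KK : nat) (xs tsq : seq nat) (live : pred nat) (grp : nat -> nat).
Variables (T : {set 'I_nb}) (e mb : nat) (seed lab : nat -> nat).

Let pow := powb b.
Let p := size xs.
Let ts := nth 0 tsq.

Definition fresh (i : nat) : bool := (i < KK) && (index (ts i) tsq == i).
Definition labelled (i : nat) : bool := [&& fresh i, ts i \notin xs & live (ts i)].
Definition adv_cls (i : nat) : nat :=
  if fresh i && (ts i \in xs) then index (ts i) xs
  else if labelled i then p + grp i else if i < KK then p + g else 0.
Definition adv_par (i : nat) : nat :=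
  if i < KK then find (fun j => (ts j == ts i) || cn (ts j) (ts i)) (iota 0 i) else 0.
Definition adv_rho (i : nat) : nat := if i < KK then Md b (ts i) m else 0.

Hypotheses (nrb : nr <= b) (nbb : nb <= b) (Kb : KK <= b) (pb : p <= b).
Hypotheses (tt : treelike cn tsq) (szT : size tsq = KK) (K0 : 0 < KK).
Hypothesis tsn : all (fun v => v < nr) tsq.
Hypothesis xs_ts : {subset xs <= tsq}.
Hypothesis uxs : uniq xs.
Hypothesis grp_lt : forall i, i < KK -> grp i < g.
Hypothesis T_new : T \subset ~: cov_by nb cv xs.
Hypothesis T_cov : T \subset cov_by nb cv [seq v <- tsq | live v && (v \notin xs)].

Definition owner (x : nat) : nat := find (fun i => labelled i && cv (ts i) x) (iota 0 KK).

Hypothesis phiT : {in T, forall x : 'I_nb, phi b pow e mb nu seed lab x = grp (owner x)}.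
Hypothesis phi_lt : forall x, x < nb -> phi b pow e mb nu seed lab x < g.
Hypothesis separated : forall i j u, labelled i -> labelled j -> j < i -> grp j = grp i ->
  u < nr -> Md b u m = Md b (ts j) m ->
  ell <= #|(nbh nb cv u :&: nbh nb cv (ts i)) :\: cov_by nb cv xs| -> u = ts j.

Lemma adv_par_lt i : 0 < i < KK -> adv_par i < i.
Proof.
case/andP => i0 iK; rewrite /adv_par iK -[X in _ < X](size_iota 0 i) -has_find; apply/hasI.
have [|j ji h] := tt (i := i); first by rewrite i0 szT.
by exists j => //; apply/orP; case: h => h; [left; apply/eqP | right].
Qed.

Lemma nth_tsn i : i < KK -> ts i < nr.
Proof. by move=> iK; apply: (allP tsn); rewrite mem_nth // szT. Qed.

Lemma ts_hom : hom nr KK cn adv_par ts.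
Proof.
move=> i iK; split; first exact: nth_tsn.
have [i0|i0] := posnP i; [by left | right].
have lt : adv_par i < i by apply: adv_par_lt; rewrite i0.
have := nth_find 0 (a := fun j => (ts j == ts i) || cn (ts j) (ts i)) (s := iota 0 i).
move: (lt); rewrite /adv_par iK => lt'; rewrite nth_iota // add0n has_find size_iota => /(_ lt').
by case/orP => [/eqP ->|h]; [left | right].
Qed.

Lemma index_fresh v : v \in tsq -> fresh (index v tsq) /\ ts (index v tsq) = v.
Proof.
move=> h; have e' : ts (index v tsq) = v by apply: nth_index.
by rewrite /fresh e' eqxx andbT -szT index_mem.
Qed.

Lemma labelled_label i : labelled i -> adv_cls i = p + grp i.
Proof. by move=> h; rewrite /adv_cls h; case/and3P: h => -> /negbTE -> _. Qed.

Lemma cls_group i : i < KK -> p <= adv_cls i < p + g -> labelled i.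
Proof.
rewrite /adv_cls => iK; case: ifP => [/andP [_ h]|_]; first by rewrite leqNgt index_mem h.
by rewrite iK; case: ifP => // _; rewrite ltnn andbF.
Qed.

Lemma cls_fixed i : i < KK -> adv_cls i < p ->
  [/\ fresh i, ts i \in xs & adv_cls i = index (ts i) xs].
Proof.
rewrite /adv_cls => iK; case: ifP => [/andP [-> ->] //|_].
by rewrite iK; case: ifP => _; rewrite ltnNge leq_addr.
Qed.

Lemma ownerP (x : 'I_nb) : x \in T ->
  [/\ labelled (owner x), cv (ts (owner x)) x &
    forall j, labelled j -> j < owner x -> ~~ cv (ts j) x].
Proof.
move=> xT; have := subsetP T_cov x xT; rewrite inE => /hasP [v].
rewrite mem_filter => /andP [/andP [lv nv] vts] hv.
have [fv ev] := index_fresh vts.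
have hP : has (fun i => labelled i && cv (ts i) x) (iota 0 KK).
  apply/hasI; exists (index v tsq); first by case/andP: fv.
  by rewrite /labelled fv ev nv lv.
have lt : owner x < KK by rewrite /owner -{2}(size_iota 0 KK) -has_find.
have := nth_find 0 hP; rewrite -/(owner x) nth_iota // add0n => /andP [h1 h2].
split=> // j lj jx; have := before_find 0 jx.
by rewrite nth_iota ?(ltn_trans jx) // add0n lj /= => ->.
Qed.

Lemma ending_advice X Val TR :
  t + \sum_(i < KK) \sum_(j < i) (if labelled i && labelled j && (grp i == grp j) then ell else 0)
    <= #|cov_by nb cv xs| + #|T| ->
  (forall l, l < p -> X l = nth 0 xs l) ->
  (forall i v, i < KK -> v < nr -> Val i v =
    nextVal b nr nb cn cv pow p ell e m mb nu adv_par adv_cls adv_rho seed lab KK X Val i v) ->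
  (forall i, i < KK -> TR i = nextTR b nr cn adv_par Val TR i) ->
  valid b nr nb t cn cv adv_par KK TR.
Proof.
move=> le hX hVal hTR.
have nr0 : 0 < nr by apply: leq_ltn_trans (leq0n _) (nth_tsn K0).
have cxE x : covX b cv X p x = has (fun u => cv u x) xs.
  rewrite /covX HsE //; apply/hasI/hasP => [[i ip h]|[u /(nthP 0) [i ip <-] h]].
    by exists (nth 0 xs i); [exact: mem_nth | rewrite -hX].
  by exists i => //; rewrite hX.
have fXE : fX b nb cv X p = #|cov_by nb cv xs|.
  by rewrite /fX SmE // sum_card; apply: eq_card => x; rewrite !inE cxE.
apply: (@ending b nr nb t cn cv pow p ell e m mb nu g adv_par adv_cls adv_rho seed lab KK
  X TR Val nrb nbb Kb pb nr0 adv_par_lt hVal hTR phi_lt _ ts T) => //.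
- move=> i j iK jK hi hij; have [fi xi ei] := cls_fixed iK hi.
  rewrite hij in hi; have [fj xj ej] := cls_fixed jK hi.
  have e1 : ts i = ts j by rewrite -(nth_index 0 xi) -(nth_index 0 xj) -ei -ej hij.
  by case/andP: fi => _ /eqP <-; case/andP: fj => _ /eqP <-; rewrite e1.
- exact: ts_hom.
- move=> c cp; have cx : nth 0 xs c \in xs by exact: mem_nth.
  have [fr ev] := index_fresh (xs_ts cx).
  exists (index (nth 0 xs c) tsq); split.
  + by case/andP: fr.
  + by rewrite /adv_cls fr ev cx index_uniq.
  + by rewrite ev hX.
- by move=> x /(subsetP T_new); rewrite !inE cxE.
- move=> x xT; have [lo co mn] := ownerP xT.
  exists (owner x); split.
    split=> //.
    + by case/and3P: lo => /andP [].
    + by rewrite labelled_label // leq_addr.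
    + by rewrite labelled_label // addKn phiT.
    + by rewrite /adv_rho; case/and3P: lo => /andP [->].
  move=> j u ji ej un hu hc; have oK : owner x < KK by case/and3P: lo => /andP [].
  have jK := ltn_trans ji oK.
  have lj : labelled j.
    apply: cls_group => //; rewrite ej labelled_label // leq_addr ltn_add2l.
    exact: grp_lt.
  rewrite /adv_rho jK in hu.
  rewrite (separated lo lj ji _ un hu) ?mn //.
    by move: ej; rewrite !labelled_label // => /addnI.
  apply: leq_trans hc _; rewrite /comm SmE // sum_card; apply: eq_leq; apply: eq_card => y.
  by rewrite !inE cxE andbA andbC.
- rewrite fXE; apply: leq_trans le; rewrite leq_add2l.
  apply: leq_sum => i _; apply: leq_sum => j _; rewrite /sharing.
  case: ifP => // /andP [/eqP eij hij]; have lj : labelled j.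
    by apply: cls_group; rewrite -?eij // (ltn_trans (ltn_ord j)).
  have li : labelled i by apply: cls_group.
  rewrite li lj /=; move: eij; rewrite !labelled_label // => /addnI ->.
  by rewrite eqxx.
Qed.

End EndingAdvice.

Definition bl (x : nat) : nat := up_log 2 x.+1.

Lemma lt_bl x : x < 2 ^ bl x.
Proof. by rewrite /bl; exact: up_logP. Qed.

Lemma bl_le x : bl x <= x.
Proof. by apply: up_log_min => //; exact: ltn_expl. Qed.

Record advice : Type := Advice {
  a_ell : nat; a_p : nat; a_g : nat; a_e : nat; a_m : nat; a_mb : nat;
  a_far : nat -> nat; a_step : nat -> nat; a_par : nat -> nat; a_cls : nat -> nat;
  a_rho : nat -> nat; a_seed : nat -> nat; a_lab : nat -> nat
}.

Record bounded (k d q wn om nu : nat) (A : advice) : Prop := Bounded {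
  bd_ell : a_ell A < 2 ^ wn;
  bd_p : a_p A < 2 ^ om /\ a_p A <= k.+1;
  bd_g : a_g A < 2 ^ om;
  bd_e : a_e A < 2 ^ om /\ a_e A < nu;
  bd_m : a_m A < 2 ^ om;
  bd_mb : a_mb A < 2 ^ om;
  bd_far : forall f, a_far A f < 2 ^ wn /\ (2 * q <= f -> a_far A f = 0);
  bd_step : forall l, a_step A l < 2 ^ om /\ (k < l -> a_step A l = 0);
  bd_par : forall i, a_par A i < 2 ^ om /\ (k + k %/ q <= i -> a_par A i = 0);
  bd_cls : forall i, a_cls A i < 2 ^ om /\ (k + k %/ q <= i -> a_cls A i = 0);
  bd_rho : forall i, a_rho A i < 2 ^ om /\ (k + k %/ q <= i -> a_rho A i = 0);
  bd_seed : forall j, a_seed A j < 2 ^ nu /\ ((a_e A).+1 * nu <= j -> a_seed A j = 0);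
  bd_lab : forall z, a_lab A z <= a_g A /\ (2 ^ (a_e A).+1 <= z -> a_lab A z = 0);
  bd_cells : 2 ^ (a_e A).+1 * bl (a_g A) <= 512 * (k ^ 3 * d)
}.

Definition accepted (b nr nb k t d q nu : nat) (cn cv near : nat -> nat -> bool) (A : advice) : Prop :=
  forall X Val TR,
  (forall l, l < a_p A -> X l =
    nextX b nr nb k t cv near (a_far A) (a_step A) X l) ->
  (forall i v, i < k + k %/ q -> v < nr -> Val i v =
    nextVal b nr nb cn cv (powb b) (a_p A) (d + a_ell A) (a_e A) (a_m A) (a_mb A) nu
      (a_par A) (a_cls A) (a_rho A) (a_seed A) (a_lab A) (k + k %/ q) X Val i v) ->
  (forall i, i < k + k %/ q -> TR i = nextTR b nr cn (a_par A) Val TR i) ->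
  valid b nr nb t cn cv (a_par A) (k + k %/ q) TR.

Lemma exp_bracket x : exists e, x <= 2 ^ e /\ (0 < x -> 2 ^ e <= 2 * x) /\ (x = 0 -> e = 0).
Proof.
case: x => [|x]; first by exists 0.
exists (up_log 2 x.+1); split; [exact: up_logP | split=> // _].
case: x => [|x] //.
have [h _] := andP (up_log_bounds (isT : 1 < 2) (isT : 1 < x.+2)).
by rewrite -(prednK (_ : 0 < up_log 2 x.+2)) ?up_log_gt0 // expnS leq_mul2l ltnW.
Qed.

(* The surplus of an extra vertex outweighs all the overlaps of at most [d + ell']
   within the classes mod [g] of [KK] nodes. *)
Lemma surplus_suffices k d t' KK P Q a : let g := (8 * (k ^ 3 * d)) %/ t' + 1 in
  0 < k -> KK <= 2 * k -> g * P <= Q -> 2 * Q <= KK * KK ->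
  4 * k * d < t' -> t' <= k * a ->
  (d + t' %/ (6 * k ^ 3)) * P + (d + t' %/ (6 * k ^ 3)) <= a.
Proof.
move=> g k0 hK hP hQ ht ha.
have hQ2 : Q <= 2 * (k * k).
  have : KK * KK <= 2 * k * (2 * k) by rewrite leq_mul.
  by clear - hQ; lia.
have g0 : 0 < g by rewrite /g addn1.
have t0 : 0 < t' by apply: leq_ltn_trans ht.
have P2 : P <= 2 * (k * k) by apply: leq_trans _ (leq_trans hP hQ2); rewrite leq_pmull.
have g8 : 8 * (k ^ 3 * d) <= g * t' by rewrite /g addn1 ltnW // ltn_ceil.
have dP : 4 * (k * d * P) <= t'.
  have : P * (8 * (k ^ 3 * d)) <= 2 * (k * k) * t'.
    apply: (@leq_trans (P * (g * t'))); first by rewrite leq_mul2l g8 orbT.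
    by rewrite mulnA [P * g]mulnC leq_mul2r (leq_trans hP hQ2) orbT.
  have -> : P * (8 * (k ^ 3 * d)) = 2 * (k * k) * (4 * (k * d * P)).
    by rewrite !expnS expn0; clear; nia.
  by rewrite leq_pmul2l // !muln_gt0 k0.
have eP : 6 * (k * k * k) * (t' %/ (6 * k ^ 3)) <= t'.
  by rewrite mulnC; have := leq_trunc_div t' (6 * k ^ 3); rewrite !expnS expn0 muln1 !mulnA.
move: (t' %/ (6 * k ^ 3)) eP => l eP.
have lP : 2 * (k * (l * P)) + 2 * (k * l) <= t'.
  have h : k * l * P <= k * l * (2 * (k * k)) by rewrite leq_mul2l P2 orbT.
  have kl : k * l <= k * k * k * l by rewrite leq_mul2r -mulnA leq_pmulr ?orbT // muln_gt0 k0.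
  have e : k * l * (2 * (k * k)) = 2 * (k * k * k * l) by clear; lia.
  have e' : 6 * (k * k * k) * l = 6 * (k * k * k * l) by rewrite -!mulnA.
  have e'' : k * (l * P) = k * l * P by rewrite mulnA.
  by move: h kl eP; rewrite e e' e''; move: (k * k * k * l) (k * l * P) (k * l); clear; lia.
rewrite -(leq_pmul2l k0); apply: leq_trans _ ha.
have e1 : k * ((d + l) * P + (d + l)) = k * d * P + k * (l * P) + k * d + k * l.
  by clear; lia.
have ht' : 4 * (k * d) < t' by rewrite mulnA.
rewrite e1; move: dP lP ht'.
by move: (k * d * P) (k * (l * P)) (k * d) (k * l); clear; lia.
Qed.

Lemma extra_arith t z t' w l a y x :
  t <= z + t' -> w + l <= a -> y < l -> x + y = t' -> t + w <= a + z + x.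
Proof. by lia. Qed.

Lemma cells_arith y t s : y * t <= 8 * s -> 2 * (8 * t) * (2 * y) <= 512 * s.
Proof. by nia. Qed.

Section Completeness.

Variables (b nr nb k t d q wn om nu : nat) (cn cv : nat -> nat -> bool) (S : seq nat).

Let N := d * (6 * k ^ 3) ^ d.
Let S3 := k ^ 3 * d.
Let KK := k + k %/ q.

Hypotheses (nrb : nr <= b) (nbb : nb <= b) (kb : 2 * k + 2 <= b) (nub : nu <= b).
Hypothesis nuSb : nu * (64 * S3) <= b.
Hypotheses (k0 : 0 < k) (q0 : 0 < q) (d0 : 0 < d).
Hypotheses (nrw : nr < 2 ^ wn) (nbw : nb < 2 ^ wn).
Hypothesis hnu1 : 2 * ((8 * S3) * (8 * S3) * wn).+1 <= 2 ^ nu.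
Hypothesis hnu2 : 64 * S3 < 2 ^ nu.
Hypothesis hom1 : N.+1 < 2 ^ om.
Hypothesis hom2 : 2 * (KK * (KK * N) * wn).+1 < 2 ^ om.
Hypothesis nuom : nu < om.
Hypothesis cn_sym : forall u v, cn u v = cn v u.
Hypotheses (uS : uniq S) (Sn : all (fun v => v < nr) S) (Sk : size S <= k).
Hypotheses (S0 : 0 < size S) (gS : grows cn S).
Hypothesis tS : t <= #|cov_by nb cv S|.
Hypothesis few : forall (W : {set 'I_nb}) l, d <= l -> #|W| <= 6 * k ^ 3 * (l - d).+1 ->
  count (fun u => l <= #|nbh nb cv u :&: W|) (iota 0 nr) <= N.

Variable near : nat -> nat -> bool.
Hypothesis nearE : forall u v, u < nr -> v < nr -> near u v = walk nr cn (k %/ q) u v.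

Lemma S3_ge : k * d <= S3 /\ k * k * d <= S3.
Proof.
rewrite /S3 !expnS expn0 muln1 -!mulnA; split; last by rewrite leq_pmull.
by rewrite (leq_trans (leq_pmull _ k0)) // leq_pmull.
Qed.

Lemma KK_le : KK <= 2 * k.
Proof. by rewrite /KK; have := leq_div k q; lia. Qed.

Section Finish.

Variables (xs ys st tsq : seq nat) (live : pred nat) (grp : nat -> nat) (g ell' m e : nat).
Variable T : {set 'I_nb}.
Hypothesis hg : guess b nr nb k t q N cv near xs ys st.
Hypothesis xsk : size xs <= k.+1.
Hypotheses (tt : treelike cn tsq) (szT : size tsq = KK).
Hypothesis tsn : all (fun v => v < nr) tsq.
Hypothesis xs_ts : {subset xs <= tsq}.
Hypotheses (grp_lt : forall i, i < KK -> grp i < g) (g_le : g <= maxn KK (8 * S3).+1).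
Hypothesis T_new : T \subset ~: cov_by nb cv xs.
Hypothesis T_cov : T \subset cov_by nb cv [seq v <- tsq | live v && (v \notin xs)].
Hypothesis separated : forall i j u, labelled KK xs tsq live i -> labelled KK xs tsq live j ->
  j < i -> grp j = grp i ->
  u < nr -> Md b u m = Md b (nth 0 tsq j) m ->
  d + ell' <= #|(nbh nb cv u :&: nbh nb cv (nth 0 tsq i)) :\: cov_by nb cv xs| ->
  u = nth 0 tsq j.
Hypothesis target : t + \sum_(i < KK) \sum_(j < i)
  (if labelled KK xs tsq live i && labelled KK xs tsq live j && (grp i == grp j)
   then d + ell' else 0) <= #|cov_by nb cv xs| + #|T|.
Hypotheses (ellw : ell' < 2 ^ wn) (mw : 0 < m < 2 ^ om).
Hypothesis phi_case : g = 1 \/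
  [/\ 4 * #|T| <= 2 ^ e, 2 ^ e <= 64 * S3, #|T| <= 8 * S3 & 2 ^ e.+1 * bl g <= 512 * S3].

Lemma finish : exists2 A, bounded k d q wn om nu A &
  accepted b nr nb k t d q nu cn cv near A.
Proof.
have [h1 h2] := S3_ge; have hK := KK_le.
have S30 : 0 < S3 by rewrite muln_gt0 expn_gt0 k0.
have K0 : 0 < KK by rewrite addn_gt0 k0.
have KKe : KK = k + k %/ q by [].
have nu0 : 0 < nu by rewrite lt0n; apply/eqP => z; move: hnu2; rewrite z expn0 ltnS leqn0 muln_eq0 /= -leqn0 leqNgt S30.
have nuo : 2 ^ nu < 2 ^ om by rewrite ltn_exp2l.
have big x : x <= 64 * S3 -> x < 2 ^ om.
  by move=> h; apply: leq_ltn_trans h (ltn_trans hnu2 nuo).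
have [m0 m1] := andP mw.
have gb : 0 < g by apply: leq_ltn_trans (leq0n _) (grp_lt K0).
have b1 : 1 < b by apply: leq_trans kb; rewrite addn2.
pose L x := if owner cv KK xs tsq live x < KK then grp (owner cv KK xs tsq live x) else 0.
have Lg x : L x < g by rewrite /L; case: ifP => // /grp_lt.
have [e' [mb [seed [lab [e1 e2 e3 [e4 e5]]]]]] : exists e' mb seed lab,
    [/\ mb <= 2 ^ nu, e' < nu /\ 2 ^ e'.+1 * bl g <= 512 * S3,
        forall j, seed j < 2 ^ nu /\ (e'.+1 * nu <= j -> seed j = 0) &
        (forall z, lab z <= g /\ (2 ^ e'.+1 <= z -> lab z = 0)) /\
        {in T, forall x : 'I_nb, phi b (powb b) e' mb nu seed lab x = L x}].
  case: phi_case => [g1|[c1 c2 c3 c4]].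
    exists 0, 1, (fun=> 0), (fun=> 0); split.
    - by rewrite expn_gt0.
    - by split=> //; rewrite g1 /bl; have -> : up_log 2 2 = 1 by []; rewrite muln1; clear - S30; lia.
    - by move=> j; rewrite expn_gt0.
    - split=> // x _; rewrite (phi_trivial nbb) //; last by apply: ltn_trans b1.
      by have := Lg x; rewrite g1; case: (L x).
  have eb : e < nu.
    by rewrite -(@ltn_exp2l 2) // (leq_ltn_trans c2).
  have [|||mb [seed [lab [f1 f2 f3 f4]]]] :=
    @phi_exists b nb nu wn nbb b1 nub T e g L (ltnW nbw) c1 Lg _ _ _.
  - exact: leq_trans eb nub.
  - by apply: leq_trans nuSb; rewrite leq_mul2l c2 orbT.
  - apply: leq_trans hnu1; rewrite leq_mul2l ltnS leq_mul2r /=.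
    by rewrite leq_mul ?orbT.
  exists e, mb, seed, lab; split=> // j; have [f5 f6] := f2 j; split=> //.
  by apply: leq_trans f5 _; rewrite leq_exp2l // ltnW.
case: (hg) => cd ux uf us xn yn.
have nth_st l : nth 0 st l <= N.+1.
  have [lt|ge] := ltnP l (size st); last by rewrite nth_default.
  by apply: (allP us); apply: mem_nth.
have nth_ys l : nth 0 ys l < 2 ^ wn.
  have [lt|ge] := ltnP l (size ys); last by rewrite nth_default // expn_gt0.
  by apply: ltn_trans nrw; apply: (allP yn); apply: mem_nth.
have sts : size st = size xs by case: cd.
have kS : k <= S3 by apply: leq_trans (leq_pmulr k d0) h1.
have rng x : x <= 3 * k + 8 * S3 + 4 -> x < 2 ^ om.
  by move=> hx; apply: big; clear - hx kS S30; lia.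
have gm : g <= 2 * k + 8 * S3 + 1.
  by apply: leq_trans g_le _; rewrite geq_max; clear - hK; lia.
exists (Advice ell' (size xs) g e' m mb (nth 0 ys) (nth 0 st) (adv_par cn KK tsq)
  (adv_cls g KK xs tsq live grp) (adv_rho b m KK tsq) seed lab).
  split=> //=.
  - by split=> //; apply: rng; clear - xsk; lia.
  - by apply: rng; clear - gm; lia.
  - by case: e2 => [e2 _]; split=> //; apply: ltn_trans nuo; apply: ltn_trans e2 (ltn_expl _ _).
  - exact: leq_ltn_trans e1 nuo.
  - by move=> f; split=> // hf; rewrite nth_default // (leq_trans uf).
  - move=> l; split; first exact: leq_ltn_trans (nth_st l) hom1.
    by move=> kl; rewrite nth_default // sts (leq_trans xsk).
  - move=> i; split; last by move=> Ki; rewrite /adv_par ltnNge KKe Ki.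
    have [iK|iK] := ltnP i KK; last by rewrite /adv_par (ltnNge i) iK expn_gt0.
    apply: rng; rewrite /adv_par iK (leq_trans (find_size _ _)) // size_iota.
    by apply: leq_trans (ltnW iK) _; clear - hK; lia.
  - move=> i; have [iK|iK] := ltnP i KK; last first.
      by rewrite /adv_cls /labelled /fresh (ltnNge i) iK /= expn_gt0.
    split=> //.
    apply: rng.
    have hgi := grp_lt iK; rewrite /adv_cls; case: ifP => [/andP [_ xi]|_].
      rewrite -index_mem in xi; apply: leq_trans (ltnW xi) (leq_trans xsk _); clear; lia.
    by case: ifP => _; rewrite ?iK; clear - gm xsk hgi; lia.
  - move=> i; split; last by move=> Ki; rewrite /adv_rho ltnNge KKe Ki.
    rewrite /adv_rho; case: ifP => iK; last by rewrite expn_gt0.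
    have xn' : nth 0 tsq i < nr by apply: (allP tsn); rewrite mem_nth // szT.
    rewrite MdE; first by apply: ltn_trans m1; rewrite ltn_pmod.
    by rewrite (leq_trans (leq_div _ _)) // (leq_trans (ltnW xn')).
  - by case: e2.
move=> X Val TR hX hVal hTR; rewrite -/KK in hVal hTR *.
apply: (@ending_advice b nr nb t cn cv (d + ell') m g nu KK xs tsq live grp T e' mb seed lab
   nrb nbb _ _ tt szT K0 tsn xs_ts ux grp_lt T_new T_cov _ _ separated X Val TR target) => //.
- by apply: leq_trans kb; apply: leq_trans hK _; exact: leq_addr.
- by apply: leq_trans xsk _; apply: leq_trans kb; clear; lia.
- move=> x xT; rewrite e5 // /L.
  by have [] := ownerP szT T_cov xT => /and3P [/andP [-> _] _ _].
- move=> x _; rewrite /phi /slot; set y := (_ + hsh _ _ _ _ _ _).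
  have [lg _] := e4 y; move: lg; case: (lab y) => [|v] //.
- move=> l lp; apply: (coded_X cd) hX _ lp => //.
  by apply: leq_trans xsk _; apply: leq_trans kb; clear; lia.
Qed.

End Finish.

Lemma memS v : v \in S -> v < nr.
Proof. by move=> vS; apply: (allP Sn). Qed.

Lemma padded_tree ts : treelike cn ts -> 0 < size ts <= KK -> all (fun v => v < nr) ts ->
  exists tsq, [/\ treelike cn tsq, size tsq = KK, all (fun v => v < nr) tsq & tsq =i ts].
Proof.
move=> tt /andP [s0 sK] tn; exists (ts ++ nseq (KK - size ts) (head 0 ts)).
have hd : head 0 ts \in ts by rewrite -nth0 mem_nth.
split.
- exact: treelike_pad.
- by rewrite size_cat size_nseq subnKC.
- rewrite all_cat tn; apply/allP => v /nseqP [-> _]; exact: (allP tn).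
- move=> v; rewrite mem_cat; case: (boolP (v \in ts)) => //= nv.
  by apply/nseqP => -[e _]; rewrite e hd in nv.
Qed.

Lemma tree_of_S : exists tsq,
  [/\ treelike cn tsq, size tsq = KK, all (fun v => v < nr) tsq & tsq =i S].
Proof.
have [ts tt pe] := grows_treelike uS gS.
have [||tsq [h1 h2 h3 h4]] := @padded_tree ts tt.
- by rewrite (perm_size pe) S0 (leq_trans Sk) // leq_addr.
- by rewrite (perm_all _ pe).
by exists tsq; split=> // v; rewrite h4 (perm_mem pe).
Qed.

Lemma fresh_inj tsq i j : fresh KK tsq i -> fresh KK tsq j ->
  nth 0 tsq i = nth 0 tsq j -> i = j.
Proof. by case/andP => _ /eqP hi; case/andP => _ /eqP hj e; rewrite -hi e. Qed.

Lemma no_pairs (P : nat -> nat -> bool) x : (forall i j, j < i -> i < KK -> ~~ P i j) ->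
  \sum_(i < KK) \sum_(j < i) (if P i j then x else 0) = 0.
Proof.
move=> h; rewrite big1 // => i _; rewrite big1 // => j _.
by rewrite (negbTE (h _ _ (ltn_ord j) (ltn_ord i))).
Qed.

Lemma cov_rest xs : t - #|cov_by nb cv xs| <= #|cov_by nb cv S :\: cov_by nb cv xs|.
Proof.
rewrite cardsD leq_sub //.
by rewrite subset_leq_card // subsetIr.
Qed.

Lemma om0 : 1 < 2 ^ om.
Proof. by apply: leq_ltn_trans hom1. Qed.

Lemma completeness_small xs ys st : guess b nr nb k t q N cv near xs ys st ->
  size xs <= k.+1 -> stop_small nb k t d cv S xs ->
  exists2 A, bounded k d q wn om nu A & accepted b nr nb k t d q nu cn cv near A.
Proof.
move=> hg xk [xS small]; have [tsq [tt sz tn ts]] := tree_of_S.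
have [T sT cT] := subset_of_card (cov_rest xs).
have [h1 h2] := S3_ge; have hK := KK_le.
have cT4 : #|T| <= 4 * k * d by rewrite cT leq_subLR.
have [e [e1 [e2 e3]]] := exp_bracket (4 * #|T|).
have e4 : 2 ^ e <= 32 * (k * d).
  case: (posnP #|T|) => [z|p]; last by apply: leq_trans (e2 _) _; clear - p cT4; nia.
  rewrite e3 ?z // expn0; have := leq_mul k0 d0; clear; lia.
apply: (@finish xs ys st tsq (mem S) id KK 0 1 e T) => //.
- by move=> v /xS; rewrite ts.
- exact: leq_maxl.
- by apply: subset_trans sT _; apply/subsetP => x; rewrite !inE => /andP [].
- apply: subset_trans sT _; apply/subsetP => x; rewrite !inE => /andP [nx /hasP [v vS hv]].
  apply/hasP; exists v => //; rewrite mem_filter ts vS andbT; apply/andP; split=> //.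
  by apply: contra nx => vx; apply/hasP; exists v.
- by move=> i j u _ _ ji e'; rewrite e' ltnn in ji.
- rewrite (no_pairs (P := fun i j => labelled KK xs tsq (mem S) i &&
    labelled KK xs tsq (mem S) j && (i == j))) => [|i j ji _].
    by rewrite addn0 cT -leq_subLR.
  by rewrite !negb_and; apply/orP; right; rewrite neq_ltn ji orbT.
- by rewrite expn_gt0.
- by rewrite om0.
- right; split=> //.
  + by apply: leq_trans e4 _; clear - h1; lia.
  + by apply: leq_trans cT4 _; clear - h1; lia.
  + have b1 := bl_le KK; rewrite expnS.
    apply: (@leq_trans (2 * (32 * (k * d)) * (2 * k))).
      by rewrite leq_mul ?leq_mul2l ?(leq_trans b1).
    clear - h2; nia.
Qed.

Lemma completeness_single xs ys st : guess b nr nb k t q N cv near xs ys st ->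
  size xs <= k.+1 -> stop_single nb t cv S xs ->
  exists2 A, bounded k d q wn om nu A & accepted b nr nb k t d q nu cn cv near A.
Proof.
move=> hg xk [xS [z zS hz]]; have [tsq [tt sz tn ts]] := tree_of_S.
have lab1 i j : labelled KK xs tsq (pred1 z) i -> labelled KK xs tsq (pred1 z) j -> j < i -> False.
  move=> /and3P [fi _ /eqP ei] /and3P [fj _ /eqP ej] ji.
  by rewrite (fresh_inj fi fj) ?ltnn // ei in ji.
apply: (@finish xs ys st tsq (pred1 z) (fun=> 0) 1 0 1 0 (nbh nb cv z :\: cov_by nb cv xs)) => //.
- by move=> v /xS; rewrite ts.
- by rewrite leq_max orbT.
- by apply/subsetP => x; rewrite !inE => /andP [].
- apply/subsetP => x; rewrite !inE => /andP [nx hx].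
  apply/hasP; exists z => //; rewrite mem_filter ts zS andbT /= eqxx.
  by apply: contra nx => vx; apply/hasP; exists z.
- by move=> i j u li lj ji; case: (lab1 i j).
- rewrite (no_pairs (P := fun i j => labelled KK xs tsq (pred1 z) i &&
    labelled KK xs tsq (pred1 z) j && (0 == 0))) ?addn0 // => i j ji _; rewrite andbT.
  by apply/negP => /andP [li lj]; case: (lab1 i j).
- by rewrite expn_gt0.
- by rewrite om0.
- by left.
Qed.

Lemma sum_div_le n g : 0 < g -> g * \sum_(i < n) i %/ g <= \sum_(i < n) i.
Proof.
by move=> g0; rewrite big_distrr /= leq_sum // => i _; rewrite mulnC leq_trunc_div.
Qed.

Lemma count_congruent g i : 0 < g -> \sum_(j < i) (j == i %[mod g] : nat) <= i %/ g.
Proof.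
move=> g0; elim/ltn_ind: i => i ih.
have [ig|gi] := ltnP i g.
  rewrite big1 // => j _; rewrite !modn_small ?(ltn_trans (ltn_ord j)) //.
  by rewrite (ltn_eqF (ltn_ord j)).
have [a e] : exists a, i = a + g by exists (i - g); rewrite subnK.
subst i; rewrite big_split_ord /= divnDr ?dvdnn // divnn g0 modnDr.
apply: leq_add; first by apply: ih; clear - g0; lia.
rewrite sum_card; apply/card_le1_eqP => x y; rewrite !inE => /eqP hx /eqP hy.
apply: val_inj; rewrite /= -(modn_small (ltn_ord x)) -(modn_small (ltn_ord y)).
by apply/eqP; rewrite -(eqn_modDl a) hx hy.
Qed.

Lemma completeness_extra xs ys st : guess b nr nb k t q N cv near xs ys st ->
  size xs <= k.+1 -> stop_extra nb k t d cv S near xs ->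
  exists2 A, bounded k d q wn om nu A & accepted b nr nb k t d q nu cn cv near A.
Proof.
move=> hg xk [xs0 [u [T [[exs xS nu0 sT cT] [big ov hu single]]]]].
set t' := t - #|cov_by nb cv xs0| in cT big ov hu single.
have un : u < nr by apply: (allP (g_nr hg)); rewrite exs mem_rcons mem_head.
have [tsS ttS peS] := grows_treelike uS gS.
have [x0 x0S w0] := hasP nu0; rewrite nearE // in w0; last exact/memS/xS.
have [||ps [tps szps nps ups]] := treelike_walk ttS _ _ un w0.
- by rewrite (perm_mem peS) xS.
- exact/memS/xS.
have [||tsq [tt sz tn ts]] := @padded_tree (tsS ++ ps) tps.
- rewrite size_cat (perm_size peS) (leq_trans S0) ?leq_addr //=.
  exact: leq_add.
- by rewrite all_cat nps andbT (perm_all _ peS).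
have memts v : v \in S -> v \in tsq by move=> vS; rewrite ts mem_cat (perm_mem peS) vS.
have [h1 h2] := S3_ge; have hK := KK_le.
pose g := (8 * S3) %/ t' + 1.
pose ell' := t' %/ (6 * k ^ 3).
have g0 : 0 < g by rewrite /g addn1.
have t0 : 0 < t' by apply: leq_ltn_trans big.
have k30 : 0 < 6 * k ^ 3 by rewrite muln_gt0 expn_gt0 k0.
have xs0xs : {subset xs0 <= xs} by move=> v; rewrite exs mem_rcons inE orbC => ->.
have cov0 : cov_by nb cv xs0 \subset cov_by nb cv xs.
  by apply/subsetP => x; rewrite !inE => /hasP [v vx hv]; apply/hasP; exists v; rewrite ?xs0xs.
have fewz z : z \in S ->
    count (fun v => d + ell' <= #|(nbh nb cv v :&: nbh nb cv z) :\: cov_by nb cv xs|) (iota 0 nr) <= N.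
  move=> zS; have := few (W := nbh nb cv z :\: cov_by nb cv xs0) (leq_addr ell' d).
  rewrite addKn => /(_ _) h; apply: leq_trans (h _).
    apply: sub_count => v hv; apply: leq_trans hv _; apply: subset_leq_card.
    rewrite setIDA; exact: setDS.
  rewrite mulnC; apply: leq_trans (ltnW (single z zS)) _.
  by rewrite ltnW // ltn_ceil.
pose B := [seq v <- iota 0 nr | has (fun z =>
  d + ell' <= #|(nbh nb cv v :&: nbh nb cv z) :\: cov_by nb cv xs|) S].
have sB : size B <= k * N.
  rewrite size_filter; apply: (@leq_trans (\sum_(z <- S) N)); last first.
    by rewrite big_const_seq count_predT iter_addn_0 mulnC leq_mul2r Sk orbT.
  move: (S) fewz => S' fz.
  elim: S' fz => [|z S' ih] fz; first by rewrite big_nil leqn0 -leqn0 leqNgt -has_count; apply/hasPn.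
  rewrite big_cons; apply: leq_trans (leq_add (fz z (mem_head _ _)) (ih _)).
    rewrite -!size_filter -size_cat; apply: uniq_leq_size; first by rewrite filter_uniq ?iota_uniq.
    move=> v; rewrite mem_cat !mem_filter /= => /andP [/orP [->|->] ->] //.
    by rewrite orbT.
  by move=> z' hz'; apply: fz; rewrite inE hz' orbT.
have [||m /andP [m0 hm] sep] := @modulus_separating tsq B wn.
- by apply/allP => v /(allP tn) h; exact: ltn_trans h nrw.
- apply/allP => v; rewrite mem_filter mem_iota add0n /= => /andP [_ h].
  exact: ltn_trans h nrw.
have mw : m < 2 ^ om.
  apply: leq_ltn_trans hm (leq_ltn_trans _ hom2); rewrite leq_mul2l ltnS sz.
  rewrite leq_mul2r leq_mul2l (leq_trans sB) ?orbT // leq_mul2r leq_addr orbT //.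
have cxs : #|cov_by nb cv xs| = #|nbh nb cv u :\: cov_by nb cv xs0| + #|cov_by nb cv xs0|.
  rewrite exs cov_by_rcons -(cardsID (cov_by nb cv xs0)) addnC; congr addn.
    by rewrite setDUl setDv setU0.
  by rewrite (setIidPr _) // subsetUr.
set a := #|nbh nb cv u :\: _| in hu cxs.
set P := \sum_(i < KK) i %/ g.
have arith : (d + ell') * P + (d + ell') <= a.
  have hP : g * P <= \sum_(i < KK) i by exact: sum_div_le.
  have hS : 2 * \sum_(i < KK) i <= KK * KK.
    elim: (KK) => [|n ih]; first by rewrite big_ord0.
    rewrite big_ord_recr /=; move: (\sum_(i < n) i) ih => s ih; clear - ih; nia.
  exact: (surplus_suffices k0 hK hP hS big hu).
have eTu : #|T :\: nbh nb cv u| + #|nbh nb cv u :&: T| = t'.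
  by rewrite setIC addnC cardsID cT.
have [e [e1 [e2 e3]]] := exp_bracket (4 * #|T :\: nbh nb cv u|).
have e4 : 2 ^ e <= 8 * t'.
  case: (posnP #|T :\: nbh nb cv u|) => [z|p].
    by rewrite e3 ?z // expn0; clear - t0; lia.
  apply: leq_trans (e2 _) _; first by rewrite muln_gt0.
  by clear - eTu; lia.
apply: (@finish xs ys st tsq (mem S) (fun i => i %% g) g ell' m e (T :\: nbh nb cv u)) => //.
- move=> v; rewrite exs mem_rcons inE => /orP [/eqP ->|/xS /memts] //.
  by rewrite ts.
- by move=> i _; rewrite ltn_pmod.
- by rewrite leq_max /g addn1 ltnS leq_div orbT.
- apply/subsetP => x; rewrite exs cov_by_rcons !inE => /andP [nx xT].
  by have := subsetP sT x xT; rewrite !inE negb_or nx => /andP [->].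
- apply/subsetP => x; rewrite !inE => /andP [nx xT].
  have := subsetP sT x xT; rewrite !inE => /andP [nx0 /hasP [v vS hv]].
  apply/hasP; exists v => //; rewrite mem_filter memts // andbT; apply/andP; split=> //.
  rewrite exs mem_rcons inE negb_or; apply/andP; split.
    by apply: contra nx => /eqP <-.
  by apply: contra nx0 => vx; apply/hasP; exists v.
- move=> i j v /and3P [_ _ li] /and3P [/andP [jK _] _ _] ji _ vn hmod hc.
  have vb : v %/ m <= b by rewrite (leq_trans (leq_div _ _)) // ltnW // (leq_trans vn).
  have jt : nth 0 tsq j \in tsq by rewrite mem_nth // sz.
  have jb : nth 0 tsq j %/ m <= b.
    by rewrite (leq_trans (leq_div _ _)) // ltnW // (leq_trans (allP tn _ jt)).
  rewrite !MdE // in hmod; apply/esym/sep => //.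
  by rewrite mem_filter mem_iota /= vn andbT; apply/hasP; exists (nth 0 tsq i).
- apply: (@leq_trans (t + (d + ell') * P)).
    rewrite leq_add2l mulnC /P big_distrl /=; apply: leq_sum => i _.
    apply: (@leq_trans (\sum_(j < i) (j == i %[mod g] : nat) * (d + ell'))); last first.
      by rewrite -big_distrl leq_mul2r count_congruent // orbT.
    apply: leq_sum => j _; rewrite eq_sym; case: (_ == _); rewrite ?andbF // andbT mul1n.
    by case: ifP.
  rewrite cxs; apply: extra_arith arith ov eTu.
  by rewrite -leq_subLR.
- apply: leq_ltn_trans (leq_div _ _) (leq_ltn_trans _ nbw).
  by rewrite -cT -[nb in _ <= nb]card_ord max_card.
- by rewrite m0.
case: (ltnP (8 * S3) t') => ht; [left | right].
  by rewrite /g divn_small.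
have T1 : #|T :\: nbh nb cv u| <= t' by rewrite -eTu leq_addr.
split=> //.
- by apply: leq_trans e4 _; rewrite -(mulnA 8 8) leq_mul2l.
- exact: leq_trans T1 ht.
have y1 : 0 < 8 * S3 %/ t' by rewrite divn_gt0.
have y2 := leq_trunc_div (8 * S3) t'.
have bg : bl g <= 2 * (8 * S3 %/ t').
  by apply: leq_trans (bl_le _) _; rewrite /g; clear - y1; lia.
rewrite expnS; apply: (@leq_trans (2 * (8 * t') * (2 * (8 * S3 %/ t')))).
  by rewrite leq_mul // leq_mul2l.
exact: cells_arith y2.
Qed.

Theorem completeness :
  exists2 A, bounded k d q wn om nu A & accepted b nr nb k t d q nu cn cv near A.
Proof.
have kb' : k < b by apply: leq_trans kb; rewrite addn2 mul2n -addnn; clear; lia.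
have [xs [ys [st [hg xk [h|[h|h]]]]]] :=
  @guessing b nr nb k t d q N cn cv S near nrb nbb kb' k0 q0 nearE cn_sym uS Sn Sk gS tS few.
- exact: completeness_small hg xk h.
- exact: completeness_single hg xk h.
- exact: completeness_extra hg xk h.
Qed.

End Completeness.

(** * The machine program *)

Section MachineFunctions.

Variable z : mach.

Let b := bound z.
Definition zNR := z.2 aNR 0.
Definition zNB := rdinp z 1.
Definition zK := rdinp z 2.
Definition zT := rdinp z 3.
Definition zQ := z.2 aQ 0.
Definition zD := z.2 aD 0.
Definition zcn u v := (u < zNR) && ((v < zNR) && (rdinp z (5 + (Ml b u zNR + v)) != 0)).
Definition zcv u x :=
  (u < zNR) && ((x < zNB) && (rdinp z (5 + (Ml b zNR zNR + (Ml b u zNB + x))) != 0)).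
Definition zpow j := if j < b then z.2 aPOW j else 0.
Definition zbl x := Fd b b (fun i => x < zpow i).
Definition zwn := zbl (zNR + (zNB + 2)).
Definition znu := Ml b 6 (zbl zK) + (Ml b 2 (zbl zD) + (zbl zwn + 16)).
Definition zom := zbl zD + (Ml b zD (Ml b 3 (zbl zK) + 3) + znu).
Definition zS3 := Ml b zK (Ml b zK (Ml b zK zD)).
Definition zdl := Dv b zK zQ.
Definition zKK := zK + zdl.
Definition zL := Ml b 8 (Ml b (Ml b 2 zQ + 2) zwn + (Ml b (Ml b 2 zK + 8) zom +
  (Ml b znu (Ml b znu znu) + Ml b 512 zS3))).
Definition zdist r u v :=
  (u < zNR) && ((v < zNR) && (z.2 aDIST (Ml b (Ml b r zNR + u) zNR + v) != 0)).

Definition nextPOW x := if x == 0 then 1 else z.2 aPOW x.-1 + z.2 aPOW x.-1.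
Definition nextDIST x : nat :=
  let v := Md b x zNR in let u := Md b (Dv b x zNR) zNR in
  let r := Dv b (Dv b x zNR) zNR in
  if r == 0 then u == v : nat
  else Hs b zNR (fun w => zdist r.-1 u w && ((w == v) || zcn w v)) : nat.
Definition nextBIT x : nat :=
  zpow (zL - x.+1) <= z.2 aW 0 - Sm b x (fun y => if z.2 aBIT y != 0 then zpow (zL - y.+1) else 0).

(* The bits of region [r] of the advice are those at the positions [8 * o + r]. *)
Definition zbit i := z.2 aBIT (zL - i.+1).
Definition zfld r i w :=
  Sm b w (fun j => Ml b (zbit (Ml b 8 (Ml b i w + j) + r)) (zpow j)).
Definition zell := zD + zfld 0 0 zwn.
Definition zp := zfld 1 0 zom.
Definition zg := zfld 1 1 zom.
Definition ze := zfld 1 2 zom.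
Definition zm := zfld 1 3 zom.
Definition zmb := zfld 1 4 zom.
Definition zfar f := if f < Ml b 2 zQ then zfld 0 f.+1 zwn else 0.
Definition zstep l := if l <= zK then zfld 2 l zom else 0.
Definition zpar i := if i < zKK then zfld 3 i zom else 0.
Definition zcls i := if i < zKK then zfld 4 i zom else 0.
Definition zrho i := if i < zKK then zfld 5 i zom else 0.
Definition zseed j := if j < Ml b ze.+1 znu then zfld 6 j znu else 0.
Definition zlab c := if c < zpow ze.+1 then zfld 7 c (zbl zg) else 0.

Definition znextX l :=
  nextX b zNR zNB zK zT zcv (fun u v => zdist zdl u v) zfar zstep (fun j => z.2 aX j) l.
Definition zval i v := z.2 aVAL (Ml b (zKK - i.+1) zNR + v).
Definition znextVAL x :=
  nextVal b zNR zNB zcn zcv zpow zp zell ze zm zmb znu zpar zcls zrho zseed zlab zKK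
    (fun j => z.2 aX j) zval (zKK - (Dv b x zNR).+1) (Md b x zNR).
Definition znextTR i := nextTR b zNR zcn zpar zval (fun j => z.2 aTR j) i.
Definition zvalid := valid b zNR zNB zT zcn zcv zpar zKK (fun j => z.2 aTR j).
Definition znextFND :=
  if z.2 aFND 0 != 0 then z.2 aFND 0 else if zvalid then (z.2 aW 0).+1 else 0.
Definition znextOUT x : nat :=
  if z.2 aFND 0 != 0 then z.2 aOUT x else Hs b zKK (fun i => z.2 aTR i == x) : nat.

End MachineFunctions.

Lemma comp_bound : Comp (fun z _ => bound z).
Proof. exact: (comp_arr aB (comp_cst 0)). Qed.

Ltac comp_weaken H :=
  first [exact H | exact (comp_weak H)
  | let H' := constr:(comp_weak (comp_weak H)) in
    first [exact H' | exact (comp_weak H') | exact (comp_weak (comp_weak H'))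
    | exact (comp_weak (comp_weak (comp_weak H')))]].

Ltac comp_leaf :=
  first
  [ exact comp_bound
  | comp_weaken comp_var
  | match goal with H : Comp _ |- _ => comp_weaken H end ].

Ltac comp_user tac := fail.

Ltac termify :=
  cbv beta;
  lazymatch goal with
  | |- Comp (fun _ _ => ?c) => exact (comp_cst c)
  | |- Comp (fun z r => addn (@?F z r) (@?G z r)) => apply (@comp_add F G); termify
  | |- Comp (fun z r => subn (@?F z r) (@?G z r)) => apply (@comp_sub F G); termify
  | |- Comp (fun z r => S (@?F z r)) => apply (@comp_succ F); termify
  | |- Comp (fun z r => predn (@?F z r)) => apply (@comp_pred F); termify
  | |- Comp (fun z r => Ml (bound z) (@?F z r) (@?G z r)) => apply (@comp_Ml F G); termify
  | |- Comp (fun z r => Dv (bound z) (@?F z r) (@?G z r)) => apply (@comp_Dv F G); termify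
  | |- Comp (fun z r => Md (bound z) (@?F z r) (@?G z r)) => apply (@comp_Md F G); termify
  | |- Comp (fun z r => Sm (bound z) (@?N z r) (@?F z r)) => apply (@comp_Sm N F); termify
  | |- Comp (fun z r => Fd (bound z) (@?N z r) (@?P z r)) => apply (@comp_Fd N P); termify
  | |- Comp (fun z r => nat_of_bool (Hs (bound z) (@?N z r) (@?P z r))) =>
      apply (@comp_Hs N P); termify
  | |- Comp (fun z r => nat_of_bool (Al (bound z) (@?N z r) (@?P z r))) =>
      apply (@comp_Al N P); termify
  | |- Comp (fun z r => nat_of_bool (negb (@?P z r))) => apply (@comp_neg P); termify
  | |- Comp (fun z r => nat_of_bool (andb (@?P z r) (@?Q z r))) => apply (@comp_and P Q); termify
  | |- Comp (fun z r => nat_of_bool (orb (@?P z r) (@?Q z r))) => apply (@comp_or P Q); termify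
  | |- Comp (fun z r => nat_of_bool (implb (@?P z r) (@?Q z r))) => apply (@comp_imp P Q); termify
  | |- Comp (fun z r => nat_of_bool (leq (@?F z r) (@?G z r))) => apply (@comp_leq F G); termify
  | |- Comp (fun z r => nat_of_bool (eq_op (@?F z r) (@?G z r))) => apply (@comp_eq F G); termify
  | |- Comp (fun z r => rdinp z (@?F z r)) => apply (@comp_inp F); termify
  | |- Comp (fun z r => snd z ?a (@?F z r)) => apply (@comp_arr a F); termify
  | _ => first [comp_leaf | comp_user termify | refine (comp_if _ _ _); termify]
  end.

Lemma comp_zNR : Comp (fun z _ => zNR z).
Proof. rewrite /zNR; termify. Qed.

Lemma comp_zNB : Comp (fun z _ => zNB z).
Proof. rewrite /zNB; termify. Qed.

Lemma comp_zK : Comp (fun z _ => zK z).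
Proof. rewrite /zK; termify. Qed.

Lemma comp_zT : Comp (fun z _ => zT z).
Proof. rewrite /zT; termify. Qed.

Lemma comp_zQ : Comp (fun z _ => zQ z).
Proof. rewrite /zQ; termify. Qed.

Lemma comp_zD : Comp (fun z _ => zD z).
Proof. rewrite /zD; termify. Qed.

Lemma comp_zpow F : Comp F -> Comp (fun z r => zpow z (F z r)).
Proof. move=> hF; rewrite /zpow; termify. Qed.

Ltac terms1 tac := lazymatch goal with
  | |- Comp (fun z _ => zNR z) => exact comp_zNR
  | |- Comp (fun z _ => zNB z) => exact comp_zNB
  | |- Comp (fun z _ => zK z) => exact comp_zK
  | |- Comp (fun z _ => zT z) => exact comp_zT
  | |- Comp (fun z _ => zQ z) => exact comp_zQ
  | |- Comp (fun z _ => zD z) => exact comp_zD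
  | |- Comp (fun z r => zpow z (@?F z r)) => apply (@comp_zpow F); tac
  end.
Ltac comp_user tac ::= first [terms1 tac].

Lemma comp_zbl F : Comp F -> Comp (fun z r => zbl z (F z r)).
Proof. move=> hF; rewrite /zbl; termify. Qed.

Lemma comp_zcn F G : Comp F -> Comp G -> Comp (fun z r => zcn z (F z r) (G z r)).
Proof. move=> hF hG; rewrite /zcn; termify. Qed.

Lemma comp_zcv F G : Comp F -> Comp G -> Comp (fun z r => zcv z (F z r) (G z r)).
Proof. move=> hF hG; rewrite /zcv; termify. Qed.

Lemma comp_zdist F G H : Comp F -> Comp G -> Comp H ->
  Comp (fun z r => zdist z (F z r) (G z r) (H z r)).
Proof. move=> hF hG hH; rewrite /zdist; termify. Qed.

Ltac terms2 tac := lazymatch goal with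
  | |- Comp (fun z r => zbl z (@?F z r)) => apply (@comp_zbl F); tac
  | |- Comp (fun z r => nat_of_bool (zcn z (@?F z r) (@?G z r))) =>
      apply (@comp_zcn F G); tac
  | |- Comp (fun z r => nat_of_bool (zcv z (@?F z r) (@?G z r))) =>
      apply (@comp_zcv F G); tac
  | |- Comp (fun z r => nat_of_bool (zdist z (@?F z r) (@?G z r) (@?H z r))) =>
      apply (@comp_zdist F G H); tac
  end.
Ltac comp_user tac ::= first [terms2 tac | terms1 tac].

Lemma comp_zwn : Comp (fun z _ => zwn z).
Proof. rewrite /zwn; termify. Qed.

Lemma comp_znu : Comp (fun z _ => znu z).
Proof. rewrite /znu /zwn; termify. Qed.

Lemma comp_zom : Comp (fun z _ => zom z).
Proof. rewrite /zom /znu /zwn; termify. Qed.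

Lemma comp_zS3 : Comp (fun z _ => zS3 z).
Proof. rewrite /zS3; termify. Qed.

Lemma comp_zdl : Comp (fun z _ => zdl z).
Proof. rewrite /zdl; termify. Qed.

Lemma comp_zKK : Comp (fun z _ => zKK z).
Proof. rewrite /zKK /zdl; termify. Qed.

Lemma comp_zL : Comp (fun z _ => zL z).
Proof. rewrite /zL /zom /znu /zwn /zS3; termify. Qed.

Ltac terms3 tac := lazymatch goal with
  | |- Comp (fun z _ => zwn z) => exact comp_zwn
  | |- Comp (fun z _ => znu z) => exact comp_znu
  | |- Comp (fun z _ => zom z) => exact comp_zom
  | |- Comp (fun z _ => zS3 z) => exact comp_zS3
  | |- Comp (fun z _ => zdl z) => exact comp_zdl
  | |- Comp (fun z _ => zKK z) => exact comp_zKK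
  | |- Comp (fun z _ => zL z) => exact comp_zL
  end.
Ltac comp_user tac ::= first [terms3 tac | terms2 tac | terms1 tac].

Lemma comp_zfld F G H : Comp F -> Comp G -> Comp H ->
  Comp (fun z r => zfld z (F z r) (G z r) (H z r)).
Proof. move=> hF hG hH; rewrite /zfld /zbit; termify. Qed.

Ltac terms4 tac := lazymatch goal with
  | |- Comp (fun z r => zfld z (@?F z r) (@?G z r) (@?H z r)) =>
      apply (@comp_zfld F G H); tac
  end.
Ltac comp_user tac ::= first [terms4 tac | terms3 tac | terms2 tac | terms1 tac].

Lemma comp_zell : Comp (fun z _ => zell z).
Proof. rewrite /zell; termify. Qed.

Lemma comp_zp : Comp (fun z _ => zp z).
Proof. rewrite /zp; termify. Qed.

Lemma comp_zg : Comp (fun z _ => zg z).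
Proof. rewrite /zg; termify. Qed.

Lemma comp_ze : Comp (fun z _ => ze z).
Proof. rewrite /ze; termify. Qed.

Lemma comp_zm : Comp (fun z _ => zm z).
Proof. rewrite /zm; termify. Qed.

Lemma comp_zmb : Comp (fun z _ => zmb z).
Proof. rewrite /zmb; termify. Qed.

Lemma comp_zfar F : Comp F -> Comp (fun z r => zfar z (F z r)).
Proof. move=> hF; rewrite /zfar; termify. Qed.

Lemma comp_zstep F : Comp F -> Comp (fun z r => zstep z (F z r)).
Proof. move=> hF; rewrite /zstep; termify. Qed.

Lemma comp_zpar F : Comp F -> Comp (fun z r => zpar z (F z r)).
Proof. move=> hF; rewrite /zpar; termify. Qed.

Lemma comp_zcls F : Comp F -> Comp (fun z r => zcls z (F z r)).
Proof. move=> hF; rewrite /zcls; termify. Qed.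

Lemma comp_zrho F : Comp F -> Comp (fun z r => zrho z (F z r)).
Proof. move=> hF; rewrite /zrho; termify. Qed.

Lemma comp_zseed F : Comp F -> Comp (fun z r => zseed z (F z r)).
Proof. move=> hF; rewrite /zseed /ze; termify. Qed.

Lemma comp_zlab F : Comp F -> Comp (fun z r => zlab z (F z r)).
Proof. move=> hF; rewrite /zlab /ze /zg; termify. Qed.

Ltac terms5 tac := lazymatch goal with
  | |- Comp (fun z _ => zell z) => exact comp_zell
  | |- Comp (fun z _ => zp z) => exact comp_zp
  | |- Comp (fun z _ => zg z) => exact comp_zg
  | |- Comp (fun z _ => ze z) => exact comp_ze
  | |- Comp (fun z _ => zm z) => exact comp_zm
  | |- Comp (fun z _ => zmb z) => exact comp_zmb
  | |- Comp (fun z r => zfar z (@?F z r)) => apply (@comp_zfar F); tac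
  | |- Comp (fun z r => zstep z (@?F z r)) => apply (@comp_zstep F); tac
  | |- Comp (fun z r => zpar z (@?F z r)) => apply (@comp_zpar F); tac
  | |- Comp (fun z r => zcls z (@?F z r)) => apply (@comp_zcls F); tac
  | |- Comp (fun z r => zrho z (@?F z r)) => apply (@comp_zrho F); tac
  | |- Comp (fun z r => zseed z (@?F z r)) => apply (@comp_zseed F); tac
  | |- Comp (fun z r => zlab z (@?F z r)) => apply (@comp_zlab F); tac
  end.
Ltac comp_user tac ::= first [terms5 tac | terms4 tac | terms3 tac | terms2 tac | terms1 tac].

Lemma comp_phi F : Comp F -> Comp (fun z r =>
  phi (bound z) (zpow z) (ze z) (zmb z) (znu z) (zseed z) (zlab z) (F z r)).
Proof. move=> hF; rewrite /phi /slot /hsh /bitof; termify. Qed.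

Lemma comp_covX F G : Comp F -> Comp G -> Comp (fun z r =>
  covX (bound z) (zcv z) (fun j => z.2 aX j) (F z r) (G z r)).
Proof. move=> hF hG; rewrite /covX; termify. Qed.

Ltac terms6 tac := lazymatch goal with
  | |- Comp (fun z r => phi (bound z) (zpow z) (ze z) (zmb z) (znu z) (zseed z) (zlab z)
        (@?F z r)) => apply (@comp_phi F); tac
  | |- Comp (fun z r => nat_of_bool (covX (bound z) (zcv z) (fun j => snd z aX j)
        (@?F z r) (@?G z r))) => apply (@comp_covX F G); tac
  end.
Ltac comp_user tac ::= first [terms6 tac | terms5 tac | terms4 tac | terms3 tac | terms2 tac | terms1 tac].

Lemma comp_nextPOW : Comp (fun z r => nextPOW z (head 0 r)).
Proof. rewrite /nextPOW; termify. Qed.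

Lemma comp_nextDIST : Comp (fun z r => nextDIST z (head 0 r)).
Proof. rewrite /nextDIST /=; termify. Qed.

Lemma comp_nextBIT : Comp (fun z r => nextBIT z (head 0 r)).
Proof. rewrite /nextBIT; termify. Qed.

Lemma comp_nextX : Comp (fun z r => znextX z (head 0 r)).
Proof. rewrite /znextX /nextX /heavy /rdeg /fX; termify. Qed.

Lemma comp_nextVAL : Comp (fun z r => znextVAL z (head 0 r)).
Proof. rewrite /znextVAL /nextVal /weight /clash /comm /best /zval; termify. Qed.

Lemma comp_nextTR : Comp (fun z r => znextTR z (head 0 r)).
Proof. rewrite /znextTR /nextTR /best /zval; termify. Qed.

Lemma comp_nextFND : Comp (fun z _ => znextFND z).
Proof. rewrite /znextFND /zvalid /valid; termify. Qed.

Lemma comp_nextOUT : Comp (fun z r => znextOUT z (head 0 r)).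
Proof. rewrite /znextOUT; termify. Qed.

Lemma comp_top : Comp (fun z _ => zpow z (zL z)).
Proof. termify. Qed.

Definition setarr (s : state) (a : arr) (f : nat -> nat) : state :=
  fun a' => if acode a == acode a' then f else s a'.

Lemma setarr_upd s a f i v : upd (setarr s a f) a i v =
  setarr s a (fun j => if i == j then v else f j).
Proof.
apply: boolp.funext => a'; apply: boolp.funext => j; rewrite /upd /setarr.
by case: eqP => //= _; rewrite eq_sym.
Qed.

Lemma setarr_id s a : setarr s a (s a) = s.
Proof.
apply: boolp.funext => a'; rewrite /setarr; case: eqP => // e.
by rewrite (acode_inj e).
Qed.

Lemma tab_run inp (F : mach -> nat -> nat) a t s :
  (forall z r, teval z.1 z.2 r t = F z (head 0 r)) ->
  exists f, srun inp (STab a t) s = setarr s a f /\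
    ((forall i f1 f2, i < s aB 0 -> (forall j, j < i -> f1 j = f2 j) ->
      F (inp, setarr s a f1) i = F (inp, setarr s a f2) i) ->
     forall i, i < s aB 0 -> f i = F (inp, setarr s a f) i).
Proof.
move=> ht; pose step i s := upd s a i (teval inp s [:: i] t).
suff main n : n <= s aB 0 -> exists f, iteri n step s = setarr s a f /\
    ((forall i f1 f2, i < s aB 0 -> (forall j, j < i -> f1 j = f2 j) ->
      F (inp, setarr s a f1) i = F (inp, setarr s a f2) i) ->
     forall i, i < n -> f i = F (inp, setarr s a f) i) by exact: main.
elim: n => [|n ih] hn; first by exists (s a); rewrite setarr_id.
have [f [e hf]] := ih (ltnW hn).
exists (fun j => if n == j then F (inp, setarr s a f) n else f j); split.
  by rewrite /= e /step (ht (inp, _)) setarr_upd.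
move=> loc i; rewrite ltnS leq_eqVlt => /orP [/eqP ->|lt].
  by rewrite eqxx; apply: loc => // j jn; rewrite gtn_eqF.
rewrite gtn_eqF // (hf loc) //; apply: loc; first exact: ltn_trans lt hn.
by move=> j ji; rewrite gtn_eqF // (ltn_trans ji).
Qed.

Lemma tab_run_own inp (F : mach -> nat -> nat) a t s :
  (forall z r, teval z.1 z.2 r t = F z (head 0 r)) ->
  (forall i f, i < s aB 0 -> f i = s a i -> F (inp, setarr s a f) i = F (inp, s) i) ->
  exists f, srun inp (STab a t) s = setarr s a f /\
    forall i, i < s aB 0 -> f i = F (inp, s) i.
Proof.
move=> ht loc; pose step i s := upd s a i (teval inp s [:: i] t).
suff main n : n <= s aB 0 -> exists f, [/\ iteri n step s = setarr s a f,
    forall i, i < n -> f i = F (inp, s) i & forall i, n <= i -> f i = s a i].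
  by have [f [e1 e2 _]] := main _ (leqnn _); exists f.
elim: n => [|n ih] hn; first by exists (s a); rewrite setarr_id.
have [f [e h1 h2]] := ih (ltnW hn).
exists (fun j => if n == j then F (inp, setarr s a f) n else f j); split.
- by rewrite /= e /step (ht (inp, _)) setarr_upd.
- move=> i; rewrite ltnS leq_eqVlt => /orP [/eqP ->|lt]; last by rewrite gtn_eqF // h1.
  by rewrite eqxx; apply: loc => //; apply: h2.
- by move=> i ni; rewrite ltn_eqF // h2 // ltnW.
Qed.

Lemma set_run inp (F : mach -> nat) a t s :
  (forall z r, teval z.1 z.2 r t = F z) ->
  srun inp (SSet a t) s = setarr s a (fun j => if 0 == j then F (inp, s) else s a j).
Proof. by move=> ht /=; rewrite (ht (inp, s)) -{1}(setarr_id s a) setarr_upd. Qed.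

Definition setcell (f : nat -> nat) (v : nat) : nat -> nat := fun j => if 0 == j then v else f j.

(* Fix the terms once and for all; only their values matter. *)
Record terms : Type := Terms {
  tPOW : term; tDIST : term; tBIT : term; tX : term; tVAL : term; tTR : term;
  tFND : term; tOUT : term; tTOP : term; tW : term;
  tPOWE : forall z r, teval z.1 z.2 r tPOW = nextPOW z (head 0 r);
  tDISTE : forall z r, teval z.1 z.2 r tDIST = nextDIST z (head 0 r);
  tBITE : forall z r, teval z.1 z.2 r tBIT = nextBIT z (head 0 r);
  tXE : forall z r, teval z.1 z.2 r tX = znextX z (head 0 r);
  tVALE : forall z r, teval z.1 z.2 r tVAL = znextVAL z (head 0 r);
  tTRE : forall z r, teval z.1 z.2 r tTR = znextTR z (head 0 r);
  tFNDE : forall z r, teval z.1 z.2 r tFND = znextFND z;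
  tOUTE : forall z r, teval z.1 z.2 r tOUT = znextOUT z (head 0 r);
  tTOPE : forall z r, teval z.1 z.2 r tTOP = zpow z (zL z);
  tWE : forall z r, teval z.1 z.2 r tW = (z.2 aW 0).+1
}.

Lemma terms_exist : inhabited terms.
Proof.
have [t1 h1] := comp_nextPOW; have [t2 h2] := comp_nextDIST; have [t3 h3] := comp_nextBIT.
have [t4 h4] := comp_nextX; have [t5 h5] := comp_nextVAL; have [t6 h6] := comp_nextTR.
have [t7 h7] := comp_nextFND; have [t8 h8] := comp_nextOUT; have [t9 h9] := comp_top.
have [t10 h10] := comp_succ (comp_arr aW (comp_cst 0)).
exact: inhabits (Terms h1 h2 h3 h4 h5 h6 h7 h8 h9 h10).
Qed.

Section Body.

Variables (P : terms) (inp : nat -> nat).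

Definition body : stmt :=
  SSeq (STab aBIT (tBIT P)) (SSeq (STab aX (tX P)) (SSeq (STab aVAL (tVAL P))
  (SSeq (STab aTR (tTR P)) (SSeq (STab aOUT (tOUT P)) (SSeq (SSet aFND (tFND P))
  (SSet aW (tW P))))))).

Lemma nextX_agree b nr nb k t cv near far step X X' l : l <= b ->
  (forall j, j < l -> X j = X' j) ->
  nextX b nr nb k t cv near far step X l = nextX b nr nb k t cv near far step X' l.
Proof. by move=> lb h; apply: nextX_local. Qed.

Lemma nextTR_agree b nr cn par Val TR TR' i : (forall j, j < i -> TR j = TR' j) ->
  nextTR b nr cn par Val TR i = nextTR b nr cn par Val TR' i.
Proof. by move=> h; rewrite /nextTR; case: eqP => // _; case: ifP => // /h ->. Qed.

Lemma nextVal_agree b nr nb cn cv pow p ell e m mb nu par cls rho seed lab KK X Val Val' i v :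
  nr <= b -> v < nr ->
  (forall c u, i < c < KK -> u < nr -> Val c u = Val' c u) ->
  nextVal b nr nb cn cv pow p ell e m mb nu par cls rho seed lab KK X Val i v =
  nextVal b nr nb cn cv pow p ell e m mb nu par cls rho seed lab KK X Val' i v.
Proof.
move=> nrb vn h; rewrite /nextVal; congr addn.
have lt c (cK : c < minn KK b) : c < KK by move: cK; rewrite ltn_min => /andP [].
apply: eq_bigr => c _; case: ifP => // /andP [ic _].
have hc u : u < nr -> Val c u = Val' c u by apply: h; rewrite ic lt.
have bE : best b nr cn Val c v = best b nr cn Val' c v.
  rewrite /best /Fd; apply: eq_in_find => u; rewrite mem_iota add0n /= => un.
  have un' : u < nr by move: un; rewrite ltn_min => /andP [].
  congr andb; rewrite /Al; apply: eq_in_all => u'; rewrite mem_iota add0n /= => hu'.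
  have un'' : u' < nr by move: hu'; rewrite ltn_min => /andP [].
  by rewrite !hc.
rewrite -bE hc //.
have [u0 [h1 h2 h3]] := @max_exists nr (fun u => (u == v) || cn v u) (Val c)
  (ex_intro2 _ _ v vn (introT orP (or_introl (eqxx v)))).
have [|? ? ?] := @FdP b nr (fun u => ((u == v) || cn v u) &&
    Al b nr (fun u' => ((u' == v) || cn v u') ==> (Val c u' <= Val c u))) nrb => //.
exists u0 => //; rewrite h2 AlE //; apply/allI => u' hu'.
by apply/implyP; apply: h3.
Qed.

Lemma body_run s : let b := s aB 0 in
  exists fb fx fv ft fo,
  let s1 := setarr s aBIT fb in let s2 := setarr s1 aX fx in
  let s3 := setarr s2 aVAL fv in let s4 := setarr s3 aTR ft in
  [/\ srun inp body s = setarr (setarr (setarr s4 aOUT fo)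
        aFND (setcell (s aFND) (znextFND (inp, s4)))) aW (setcell (s aW) (s aW 0).+1),
    forall x, x < b -> fo x = if s aFND 0 != 0 then s aOUT x
      else Hs b (zKK (inp, s)) (fun i => ft i == x) &
    [/\ forall x, x < b -> fb x = nextBIT (inp, s1) x,
      forall l, l < b -> fx l = znextX (inp, s2) l,
      0 < zNR (inp, s) -> zNR (inp, s) <= b -> zKK (inp, s) <= b ->
        forall x, x < b -> fv x = znextVAL (inp, s3) x &
      forall i, i < b -> ft i = znextTR (inp, s4) i]].
Proof.
move=> b.
have [fb [e1 h1]] := tab_run inp aBIT s (tBITE P); set s1 := setarr s aBIT fb in e1 h1.
have [fx [e2 h2]] := tab_run inp aX s1 (tXE P); set s2 := setarr s1 aX fx in e2 h2.
have [fv [e3 h3]] := tab_run inp aVAL s2 (tVALE P); set s3 := setarr s2 aVAL fv in e3 h3.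
have [ft [e4 h4]] := tab_run inp aTR s3 (tTRE P); set s4 := setarr s3 aTR ft in e4 h4.
have [|fo [e5 h5]] := @tab_run_own inp _ aOUT _ s4 (tOUTE P).
  by move=> i f _ fi; rewrite /znextOUT -[(inp, setarr s4 aOUT f).2 aOUT i]/(f i) fi.
exists fb, fx, fv, ft, fo; split.
- rewrite /body [srun _ _ _]/= -/(srun inp (STab aBIT (tBIT P)) s) e1.
  rewrite -/(srun inp (STab aX (tX P)) s1) e2 -/(srun inp (STab aVAL (tVAL P)) s2) e3.
  rewrite -/(srun inp (STab aTR (tTR P)) s3) e4 -/(srun inp (STab aOUT (tOUT P)) s4) e5.
  rewrite -/(srun inp (SSet aFND (tFND P)) _) (set_run _ _ _ (tFNDE P)).
  by rewrite -/(srun inp (SSet aW (tW P)) _) (set_run _ _ _ (tWE P)).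
- exact: h5.
split.
- apply: h1 => i f1 f2 ib e; rewrite /nextBIT; congr (nat_of_bool (_ <= _ - _)).
  apply: eq_bigr => y _; rewrite -[(inp, setarr s aBIT f1).2 aBIT y]/(f1 y) e //.
  by apply: leq_trans (ltn_ord y) (geq_minl _ _).
- by apply: h2 => i f1 f2 ib e; apply: nextX_agree => //; apply: ltnW.
- move=> nr0 nrb Kb; apply: h3 => i f1 f2 ib e.
  rewrite /znextVAL; apply: nextVal_agree => //.
    by rewrite -/b MdE ?ltn_pmod // (leq_trans (leq_div _ _)) // ltnW.
  move=> c u /andP [ic cK] un; rewrite /zval /=; apply: e.
  rewrite /bound /= -/b.
  have cK' : c < zKK (inp, s) := cK.
  have iE : Dv b i (zNR (inp, s)) = i %/ zNR (inp, s).
    by rewrite /Dv (minn_idPl _) // (leq_trans (leq_div _ _)) // ltnW.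
  move: ic; rewrite -[bound _]/b -[zNR (inp, setarr _ _ _)]/(zNR (inp, s)) iE.
  rewrite -[zKK (inp, setarr _ _ _)]/(zKK (inp, s)) => ic.
  rewrite /Ml (minn_idPl _); last by rewrite (leq_trans (leq_subr _ _)).
  have un' : u < zNR (inp, s) := un.
  apply: (@leq_trans ((zKK (inp, s) - c) * zNR (inp, s))).
    by rewrite -(subnSK cK') mulSn addnC ltn_add2r.
  apply: leq_trans (leq_trunc_div i (zNR (inp, s))); rewrite leq_mul2r; apply/orP; right.
  by move: ic cK'; clear; lia.
- by apply: h4 => i f1 f2 ib e; apply: nextTR_agree.
Qed.

End Body.

(** * Reading the advice *)

Definition nbit (w i : nat) : nat := (w %/ 2 ^ i) %% 2.

Lemma nbit_le1 w i : nbit w i <= 1.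
Proof. by rewrite /nbit -ltnS ltn_pmod. Qed.

Lemma divn_pow2_step w n : w %/ 2 ^ n = (w %/ 2 ^ n.+1) * 2 + nbit w n.
Proof. by rewrite /nbit expnSr divnMA -divn_eq. Qed.

Lemma sum_nbits w n : w < 2 ^ n -> \sum_(j < n) nbit w j * 2 ^ j = w.
Proof.
suff main : forall x, \sum_(j < n) nbit x j * 2 ^ j + (x %/ 2 ^ n) * 2 ^ n = x.
  by move=> h; have := main w; rewrite divn_small // mul0n addn0.
elim: n => [|n ih] x; first by rewrite big_ord0 expn0 divn1 muln1.
rewrite big_ord_recr /= -[RHS]ih -addnA; congr addn.
by rewrite (divn_pow2_step x n) mulnDl expnS; clear; lia.
Qed.

Lemma lt_sum_bits (beta : nat -> bool) n : \sum_(j < n) beta j * 2 ^ j < 2 ^ n.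
Proof.
elim: n => [|n ih]; first by rewrite big_ord0.
rewrite big_ord_recr /= expnS mul2n -addnn -addSn leq_add //.
by case: (beta n); rewrite ?mul1n ?mul0n.
Qed.

Lemma nbit_sum (beta : nat -> bool) n i : i < n ->
  nbit (\sum_(j < n) beta j * 2 ^ j) i = beta i.
Proof.
move=> hi; rewrite -(subnKC hi) big_split_ord /= big_ord_recr /= /nbit.
set lo := \sum_(j < i) _; set hiS := \sum_(j < _) _.
have hlo : lo < 2 ^ i.
  exact: lt_sum_bits.
have -> : hiS = 2 * 2 ^ i * \sum_(j < n - i.+1) beta (i.+1 + j) * 2 ^ j.
  rewrite /hiS big_distrr /=; apply: eq_bigr => j _.
  by rewrite expnD expnS mulnCA mulnA.
set z := \sum_(j < _) _.
have -> : lo + beta i * 2 ^ i + 2 * 2 ^ i * z = (z * 2 + beta i) * 2 ^ i + lo.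
  by rewrite mulnDl [2 * _ * z]mulnC mulnA addnC [lo + _]addnC addnA.
rewrite divnMDl ?expn_gt0 // divn_small // addn0 modnMDl modn_small //.
by case: (beta i).
Qed.

(* Long division of [w] by decreasing powers of two. *)
Lemma long_division L w (f : nat -> nat) : w < 2 ^ L ->
  (forall x, x < L -> f x =
     (2 ^ (L - x.+1) <= w - \sum_(y < x) (if f y != 0 then 2 ^ (L - y.+1) else 0))) ->
  forall i, i < L -> f (L - i.+1) = nbit w i.
Proof.
move=> wL hf.
have step x : x <= L ->
    \sum_(y < x) (if f y != 0 then 2 ^ (L - y.+1) else 0) = (w %/ 2 ^ (L - x)) * 2 ^ (L - x).
  elim: x => [|x ih] xL; first by rewrite big_ord0 subn0 divn_small.
  rewrite big_ord_recr /= ih ?(ltnW xL) // hf // ih ?(ltnW xL) //.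
  rewrite -(subnSK xL); set n := L - x.+1.
  have h : w - w %/ 2 ^ n.+1 * 2 ^ n.+1 = w %% 2 ^ n.+1.
    by rewrite {1}(divn_eq w (2 ^ n.+1)) addKn.
  rewrite h (divn_pow2_step w n).
  have e : w %% 2 ^ n.+1 = nbit w n * 2 ^ n + w %% 2 ^ n.
    apply/eqP; rewrite -(eqn_add2l (w %/ 2 ^ n.+1 * 2 ^ n.+1)) -divn_eq.
    by rewrite {1}(divn_eq w (2 ^ n)) (divn_pow2_step w n) expnS; apply/eqP; clear; lia.
  have lt : w %% 2 ^ n < 2 ^ n by rewrite ltn_mod expn_gt0.
  rewrite e; have := nbit_le1 w n; case: (nbit w n) => [|[|//]] _.
    by rewrite mul0n add0n leqNgt lt /= addn0 expnS; clear; lia.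
  by rewrite mul1n leq_addr /= expnS; clear; lia.
move=> i iL; have xL : L - i.+1 < L by clear - iL; lia.
rewrite hf // step ?(ltnW xL) //.
have -> : L - (L - i.+1).+1 = i by clear - iL; lia.
have -> : L - (L - i.+1) = i.+1 by clear - iL; lia.
have h : w - w %/ 2 ^ i.+1 * 2 ^ i.+1 = w %% 2 ^ i.+1.
  by rewrite {1}(divn_eq w (2 ^ i.+1)) addKn.
have e : w %% 2 ^ i.+1 = nbit w i * 2 ^ i + w %% 2 ^ i.
  apply/eqP; rewrite -(eqn_add2l (w %/ 2 ^ i.+1 * 2 ^ i.+1)) -divn_eq.
  by rewrite {1}(divn_eq w (2 ^ i)) (divn_pow2_step w i) expnS; apply/eqP; clear; lia.
have lt : w %% 2 ^ i < 2 ^ i by rewrite ltn_mod expn_gt0.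
rewrite h e; have := nbit_le1 w i; case: (nbit w i) => [|[|//]] _.
  by rewrite mul0n add0n leqNgt lt.
by rewrite mul1n leq_addr.
Qed.

(** * The iteration that reads a good advice *)

Section Static.

Variables (b nr nb k t d q : nat) (cn cv : nat -> nat -> bool) (inp : nat -> nat).

Definition w_n : nat := bl (nr + (nb + 2)).
Definition w_nu : nat := 6 * bl k + (2 * bl d + (bl w_n + 16)).
Definition w_om : nat := bl d + (d * (3 * bl k + 3) + w_nu).
Definition w_8 : nat := (2 * q + 2) * w_n + ((2 * k + 8) * w_om +
  (w_nu * (w_nu * w_nu) + 512 * (k * (k * (k * d))))).

Record static (s : state) : Prop := Static {
  st_b : s aB 0 = b;
  st_nr : s aNR 0 = nr;
  st_q : s aQ 0 = q;
  st_d : s aD 0 = d;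
  st_nb : rdinp (inp, s) 1 = nb;
  st_k : rdinp (inp, s) 2 = k;
  st_t : rdinp (inp, s) 3 = t;
  st_cn : forall u v, zcn (inp, s) u v = cn u v;
  st_cv : forall u x, zcv (inp, s) u x = cv u x;
  st_pow : forall j, j < b -> s aPOW j = 2 ^ j;
  st_dist : forall u v, u < nr -> v < nr ->
    zdist (inp, s) (zdl (inp, s)) u v = walk nr cn (k %/ q) u v
}.

Hypothesis hb : 10 * (nr + nb + k + d + q + 600) <= b.
Hypothesis hL : 8 * w_8 < b.

Lemma MlE x y : x <= b -> Ml b x y = x * y.
Proof. by move=> h; rewrite /Ml (minn_idPl h). Qed.

Variable s : state.
Hypothesis hs : static s.
Let z : mach := (inp, s).

Lemma bndE : bound z = b. Proof. exact: st_b hs. Qed.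
Lemma zNRE : zNR z = nr. Proof. exact: st_nr hs. Qed.
Lemma zNBE : zNB z = nb. Proof. exact: st_nb hs. Qed.
Lemma zKE : zK z = k. Proof. exact: st_k hs. Qed.
Lemma zTE : zT z = t. Proof. exact: st_t hs. Qed.
Lemma zQE : zQ z = q. Proof. exact: st_q hs. Qed.
Lemma zDE : zD z = d. Proof. exact: st_d hs. Qed.

Lemma zpowE j : zpow z j = powb b j.
Proof. by rewrite /zpow /powb bndE; case: ifP => // h; exact: (st_pow hs). Qed.

Lemma zpow_small j : j < b -> zpow z j = 2 ^ j.
Proof. by move=> h; rewrite zpowE /powb h. Qed.

Lemma zbl_short x : bl x < b -> zbl z x = bl x.
Proof.
move=> h.
have ex : exists2 i, i < b & x < zpow z i by exists (bl x); rewrite // zpow_small // lt_bl.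
have [h1 h2 h3] := FdP (leqnn b) ex.
rewrite /zbl bndE; apply/eqP; rewrite eqn_leq; apply/andP; split.
  by rewrite leqNgt; apply/negP => lt; have := h3 _ lt; rewrite zpow_small // lt_bl.
by apply: up_log_min => //; move: h2; rewrite zpow_small.
Qed.

Lemma zblE x : x < b -> zbl z x = bl x.
Proof. by move=> xb; apply: zbl_short; apply: leq_ltn_trans (bl_le x) xb. Qed.

Lemma w_n_le : w_n <= nr + nb + 2.
Proof. by rewrite /w_n addnA bl_le. Qed.

Lemma w_nu_le : w_nu <= 6 * k + 2 * d + nr + nb + 18.
Proof.
rewrite /w_nu; have := bl_le k; have := bl_le d; have := bl_le w_n; have := w_n_le.
by clear; lia.
Qed.

Lemma zwnE : zwn z = w_n.
Proof. by rewrite /zwn zNRE zNBE zblE //; apply: leq_trans hb; clear; lia. Qed.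

Lemma znuE : znu z = w_nu.
Proof.
have h := w_n_le; rewrite /znu bndE zKE zDE zwnE !zblE ?MlE //; by move: hb h; clear; lia.
Qed.

Lemma zomE : zom z = w_om.
Proof.
rewrite /zom bndE zKE zDE znuE !zblE ?MlE //; by move: hb; clear; lia.
Qed.

Lemma zS3E : zS3 z = k * (k * (k * d)).
Proof. by rewrite /zS3 bndE zKE zDE !MlE //; move: hb; clear; lia. Qed.

Lemma zdlE : zdl z = k %/ q.
Proof.
rewrite /zdl /Dv bndE zKE zQE (minn_idPl _) //.
by apply: leq_trans (leq_div _ _) _; move: hb; clear; lia.
Qed.

Lemma zKKE : zKK z = k + k %/ q.
Proof. by rewrite /zKK zKE zdlE. Qed.

Lemma zLE : zL z = 8 * w_8.
Proof.
rewrite /zL bndE zQE zKE zwnE zomE znuE zS3E.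
by have h := w_nu_le; rewrite !MlE //; move: hb h; clear; lia.
Qed.

Definition adv_val (A : advice) (r i : nat) : nat :=
  match r with
  | 0 => if i is f.+1 then a_far A f else a_ell A
  | 1 => nth 0 [:: a_p A; a_g A; a_e A; a_m A; a_mb A] i
  | 2 => a_step A i
  | 3 => a_par A i
  | 4 => a_cls A i
  | 5 => a_rho A i
  | 6 => a_seed A i
  | _ => a_lab A i
  end.
Definition adv_width (A : advice) (r : nat) : nat :=
  nth 0 [:: w_n; w_om; w_om; w_om; w_om; w_om; w_nu; bl (a_g A)] r.
Definition adv_bit (A : advice) (p : nat) : bool :=
  nbit (adv_val A (p %% 8) ((p %/ 8) %/ adv_width A (p %% 8)))
    ((p %/ 8) %% adv_width A (p %% 8)) != 0.
Definition adv_code (A : advice) : nat := \sum_(p < 8 * w_8) adv_bit A p * 2 ^ p.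

Section Decode.

Variable A : advice.
Hypothesis bitsE : forall p, p < 8 * w_8 -> zbit z p = adv_bit A p.

Lemma w_8_lt : w_8 < b.
Proof. by apply: leq_ltn_trans hL; apply: leq_pmull. Qed.

Lemma read_field r i : r < 8 -> i.+1 * adv_width A r <= w_8 ->
  adv_val A r i < 2 ^ adv_width A r -> zfld z r i (adv_width A r) = adv_val A r i.
Proof.
move=> r8; move: (erefl (adv_width A r)); set wd := {2 3 4 5}(adv_width A r) => wdE hi hv.
have h8 := w_8_lt.
rewrite -[RHS](sum_nbits hv) /zfld bndE.
have [->|wd0] := posnP wd; first by rewrite /Sm min0n !big_ord0.
have iw : i < w_8 by apply: leq_trans hi; rewrite leq_pmulr.
have wb : wd <= w_8 by apply: leq_trans hi; rewrite leq_pmull.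
rewrite SmE; last by apply: leq_trans wb (ltnW h8).
apply: eq_bigr => j _; have jw := ltn_ord j.
have e : i * wd + j < w_8 by apply: leq_trans hi; rewrite mulSn addnC ltn_add2r.
rewrite (MlE (x := i)) ?(MlE (x := 8)); [|by move: hb; clear; lia|by apply: ltnW (ltn_trans iw h8)].
rewrite bitsE; last by move: e r8; clear; lia.
have e1 : (8 * (i * wd + j) + r) %% 8 = r by rewrite mulnC modnMDl modn_small.
have e2 : (8 * (i * wd + j) + r) %/ 8 = i * wd + j.
  by rewrite mulnC divnMDl // divn_small // addn0.
rewrite zpow_small; last exact: ltn_trans (leq_trans jw wb) h8.
rewrite MlE; last by apply: leq_trans (leq_b1 _) _; move: hb; clear; lia.
congr (_ * _); rewrite /adv_bit e1 e2 wdE divnMDl // (divn_small jw) addn0.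
rewrite modnMDl modn_small //.
by have := nbit_le1 (adv_val A r i) j; case: (nbit _ _) => [|[|]].
Qed.

Hypothesis hA : bounded k d q w_n w_om w_nu A.

Lemma S3E : k ^ 3 * d = k * (k * (k * d)).
Proof. by rewrite !expnS expn0 muln1 -!mulnA. Qed.

Lemma region_fits r i x wd : wd = adv_width A r -> r < 8 -> x = adv_val A r i ->
  i.+1 * wd <= w_8 -> x < 2 ^ wd -> zfld z r i wd = x.
Proof. by move=> -> r8 ->; apply: read_field. Qed.

Lemma fits0 i : i <= 2 * q -> i.+1 * w_n <= w_8.
Proof. by move=> h; rewrite /w_8 (leq_trans _ (leq_addr _ _)) // leq_mul2r; move: h; clear; lia. Qed.

Lemma fits1 i : i < 2 * k + 8 -> i.+1 * w_om <= w_8.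
Proof.
move=> h; rewrite /w_8 (leq_trans _ (leq_addl _ _)) // (leq_trans _ (leq_addr _ _)) //.
by rewrite leq_mul2r h orbT.
Qed.

Lemma read1 i x : i < 5 -> x = nth 0 [:: a_p A; a_g A; a_e A; a_m A; a_mb A] i ->
  x < 2 ^ w_om -> zfld z 1 i (zom z) = x.
Proof.
by move=> h xE; rewrite zomE; apply: region_fits => //; apply: fits1; move: h; clear; lia.
Qed.

Lemma zellE : zell z = d + a_ell A.
Proof.
rewrite /zell zDE zwnE; congr addn; apply: region_fits => //; first exact: fits0.
exact: bd_ell hA.
Qed.
Lemma zpE : zp z = a_p A. Proof. by apply: read1 => //; case: (bd_p hA). Qed.
Lemma zgE : zg z = a_g A. Proof. by apply: read1 => //; exact: bd_g hA. Qed.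
Lemma zeE : ze z = a_e A. Proof. by apply: read1 => //; case: (bd_e hA). Qed.
Lemma zmE : zm z = a_m A. Proof. by apply: read1 => //; exact: bd_m hA. Qed.
Lemma zmbE : zmb z = a_mb A. Proof. by apply: read1 => //; exact: bd_mb hA. Qed.

Lemma zfarE : zfar z = a_far A.
Proof.
apply: boolp.funext => f; have [h1 h2] := bd_far hA f.
rewrite /zfar bndE zQE MlE ?zwnE; last by move: hb; clear; lia.
by case: ltnP => h; [apply: region_fits => //; apply: fits0 | rewrite h2].
Qed.

Lemma zstepE : zstep z = a_step A.
Proof.
apply: boolp.funext => l; have [h1 h2] := bd_step hA l.
rewrite /zstep zKE zomE; case: leqP => h; last by rewrite h2.
by apply: region_fits => //; apply: fits1; move: h; clear; lia.
Qed.

Lemma KK_fits i : i < k + k %/ q -> i.+1 * w_om <= w_8.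
Proof. by move=> h; apply: fits1; move: h (leq_div k q); clear; lia. Qed.

Lemma zparE : zpar z = a_par A.
Proof.
apply: boolp.funext => i; have [h1 h2] := bd_par hA i.
rewrite /zpar zKKE zomE; case: ltnP => h; last by rewrite h2.
by apply: region_fits => //; apply: KK_fits.
Qed.

Lemma zclsE : zcls z = a_cls A.
Proof.
apply: boolp.funext => i; have [h1 h2] := bd_cls hA i.
rewrite /zcls zKKE zomE; case: ltnP => h; last by rewrite h2.
by apply: region_fits => //; apply: KK_fits.
Qed.

Lemma zrhoE : zrho z = a_rho A.
Proof.
apply: boolp.funext => i; have [h1 h2] := bd_rho hA i.
rewrite /zrho zKKE zomE; case: ltnP => h; last by rewrite h2.
by apply: region_fits => //; apply: KK_fits.
Qed.

Lemma zseedE : zseed z = a_seed A.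
Proof.
apply: boolp.funext => j; have [h1 h2] := bd_seed hA j; have [_ h3] := bd_e hA.
have hn := w_nu_le.
rewrite /zseed bndE zeE znuE MlE; last by move: hb hn h3; clear; lia.
case: ltnP => h; last by rewrite h2.
apply: region_fits => //.
rewrite /w_8 (leq_trans _ (leq_addl _ _)) // (leq_trans _ (leq_addl _ _)) //.
rewrite (leq_trans _ (leq_addr _ _)) // mulnA leq_mul2r; apply/orP; right.
by apply: leq_trans h _; rewrite leq_mul2r h3 orbT.
Qed.

Lemma zlabE : zlab z = a_lab A.
Proof.
apply: boolp.funext => c; have [h1 h2] := bd_lab hA c; have [_ h3] := bd_e hA.
have hc := bd_cells hA; have hn := w_nu_le.
have h8 : 2 ^ (a_e A).+1 * bl (a_g A) <= w_8.
  apply: leq_trans hc _; rewrite S3E /w_8 (addnA (_ * w_om)) addnA; exact: leq_addl.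
have glt : bl (a_g A) < b.
  apply: leq_ltn_trans (_ : w_8 < b); last exact: w_8_lt.
  by apply: leq_trans h8; rewrite leq_pmull // expn_gt0.
rewrite /zlab zgE zeE zbl_short // zpow_small; last by move: hb hn h3; clear; lia.
case: ltnP => h; last by rewrite h2.
apply: region_fits => //; last by apply: leq_ltn_trans h1 (lt_bl _).
by apply: leq_trans h8; rewrite leq_mul2r h orbT.
Qed.

End Decode.

End Static.

(** * Widths of the fields *)

Section Widths.

Variables (nr nb k d q : nat).
Hypotheses (k0 : 0 < k) (d0 : 0 < d).

Let wn := w_n nr nb.
Let nu := w_nu nr nb k d.
Let om := w_om nr nb k d.
Let N := d * (6 * k ^ 3) ^ d.

Lemma mul_le_exp x y i j : x <= 2 ^ i -> y <= 2 ^ j -> x * y <= 2 ^ (i + j).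
Proof. by move=> hx hy; rewrite expnD leq_mul. Qed.

Lemma exp_le_exp x i j : x <= 2 ^ i -> x ^ j <= 2 ^ (i * j).
Proof. by move=> h; case: j => [|j]; rewrite ?muln0 // expnM leq_exp2r. Qed.

Lemma le_bl x : x <= 2 ^ bl x. Proof. exact: ltnW (lt_bl x). Qed.

Lemma cube_le : k ^ 3 <= 2 ^ (bl k * 3). Proof. exact: exp_le_exp (le_bl k). Qed.

Lemma S3_lt : k ^ 3 * d < 2 ^ (bl k * 3 + bl d).
Proof.
apply: leq_trans (_ : k ^ 3 * 2 ^ bl d <= _); last by rewrite mul_le_exp ?cube_le.
by rewrite ltn_pmul2l ?lt_bl // expn_gt0 k0.
Qed.

Lemma red_width : nr < 2 ^ wn.
Proof. by apply: leq_ltn_trans (lt_bl _); rewrite leq_addr. Qed.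

Lemma blue_width : nb < 2 ^ wn.
Proof. by apply: leq_ltn_trans (lt_bl _); clear; lia. Qed.

Lemma hash_width : 64 * (k ^ 3 * d) < 2 ^ nu.
Proof.
apply: (@leq_trans (2 ^ (6 + (bl k * 3 + bl d)))).
  by rewrite expnD -[2 ^ 6]/64 ltn_pmul2l // S3_lt.
by rewrite leq_exp2l // /nu /w_nu; clear; lia.
Qed.

Lemma modulus_width : 2 * ((8 * (k ^ 3 * d)) * (8 * (k ^ 3 * d)) * wn).+1 <= 2 ^ nu.
Proof.
apply: (@leq_trans (2 ^ (1 + ((3 + (bl k * 3 + bl d)) + (3 + (bl k * 3 + bl d)) + bl wn)))).
  rewrite expnD leq_mul2l /=; set y := 8 * _.
  have hy : y <= 2 ^ (3 + (bl k * 3 + bl d)) by rewrite mul_le_exp // ltnW // S3_lt.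
  apply: (@leq_trans ((2 ^ (3 + (bl k * 3 + bl d)) * 2 ^ (3 + (bl k * 3 + bl d))) * wn).+1).
    by rewrite ltnS leq_mul2r leq_mul ?orbT.
  by rewrite -!expnD [X in _ <= X]expnD ltn_pmul2l ?expn_gt0 // lt_bl.
by rewrite leq_exp2l // /nu /w_nu -/wn; clear; lia.
Qed.

Lemma count_lt : N < 2 ^ (bl d + (3 + bl k * 3) * d).
Proof.
have h : (6 * k ^ 3) ^ d <= 2 ^ ((3 + bl k * 3) * d).
  by apply: exp_le_exp; apply: mul_le_exp; rewrite ?cube_le.
apply: (@leq_trans (2 ^ bl d * (6 * k ^ 3) ^ d)); last by rewrite expnD leq_mul2l h orbT.
by rewrite ltn_pmul2r ?lt_bl // expn_gt0 muln_gt0 expn_gt0 k0.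
Qed.

Lemma om_ge : om = bl d + (3 + bl k * 3) * d + nu.
Proof. by rewrite /om /w_om -/nu addnA mulnC [bl k * 3]mulnC [3 + _]addnC. Qed.

Lemma step_width : N.+1 < 2 ^ om.
Proof.
apply: leq_ltn_trans count_lt _; rewrite ltn_exp2l // om_ge /nu /w_nu; clear; lia.
Qed.

Lemma residue_width (KK := k + k %/ q) : 2 * (KK * (KK * N) * wn).+1 < 2 ^ om.
Proof.
have hK : KK <= 2 ^ (1 + bl k).
  by rewrite expnD (leq_trans _ (leq_mul (leqnn 2) (le_bl k))) // /KK; have := leq_div k q; clear; lia.
have hN : N <= 2 ^ (bl d + (3 + bl k * 3) * d) by rewrite ltnW // count_lt.
apply: (@leq_ltn_trans (2 ^ (1 + (((1 + bl k) + ((1 + bl k) + (bl d + (3 + bl k * 3) * d))) + bl wn)))).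
  rewrite expnD leq_mul2l /=.
  have h := mul_le_exp hK (mul_le_exp hK hN).
  apply: (@leq_trans (2 ^ (1 + bl k + (1 + bl k + (bl d + (3 + bl k * 3) * d))) * wn).+1).
    by rewrite ltnS leq_mul2r h orbT.
  by rewrite [X in _ <= X]expnD ltn_pmul2l ?expn_gt0 // lt_bl.
rewrite ltn_exp2l // om_ge /nu /w_nu -/wn; move: (_ * d) => y; clear; lia.
Qed.

Lemma seed_width : nu < om.
Proof. by rewrite om_ge -[nu in X in X < _]add0n ltn_add2r addn_gt0 muln_gt0 d0 orbT. Qed.

End Widths.

Section Iteration.

Variables (b nr nb k t d q : nat) (cn cv : nat -> nat -> bool) (inp : nat -> nat).

Let nu := w_nu nr nb k d.
Let KK := k + k %/ q.
Let static := static b nr nb k t d q cn cv inp.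

Hypothesis hb : 10 * (nr + nb + k + d + q + 600) <= b.
Hypothesis hL : 8 * w_8 nr nb k d q < b.
Hypothesis hV : 2 * k * nr < b.
Hypothesis nr0 : 0 < nr.

Variables (A : advice) (s : state).
Hypothesis hs : static s.
Hypothesis hA : bounded k d q (w_n nr nb) (w_om nr nb k d) nu A.
Hypothesis acc : accepted b nr nb k t d q nu cn cv
  (fun u v => zdist (inp, s) (zdl (inp, s)) u v) A.
Hypothesis sW : s aW 0 = adv_code nr nb k d q A.

Lemma code_lt : adv_code nr nb k d q A < 2 ^ (8 * w_8 nr nb k d q).
Proof. exact: lt_sum_bits. Qed.

Variables fb fx fv ft : nat -> nat.
Let s1 := setarr s aBIT fb.
Let s2 := setarr s1 aX fx.
Let s3 := setarr s2 aVAL fv.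
Let s4 := setarr s3 aTR ft.
Hypothesis hfb : forall x, x < b -> fb x = nextBIT (inp, s1) x.
Hypothesis hfx : forall l, l < b -> fx l = znextX (inp, s2) l.
Hypothesis hfv : forall x, x < b -> fv x = znextVAL (inp, s3) x.
Hypothesis hft : forall i, i < b -> ft i = znextTR (inp, s4) i.

Let hs1 : static s1. Proof. by case: hs. Qed.
Let hs2 : static s2. Proof. by case: hs. Qed.
Let hs3 : static s3. Proof. by case: hs. Qed.
Let hs4 : static s4. Proof. by case: hs. Qed.

Lemma bits_read p : p < 8 * w_8 nr nb k d q -> fb (8 * w_8 nr nb k d q - p.+1) = adv_bit nr nb k d A p.
Proof.
move=> hp; rewrite (long_division code_lt _ hp) /adv_code; first exact: nbit_sum.
move=> x xL; rewrite hfb; last exact: ltn_trans xL hL.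
rewrite /nextBIT (zLE hb hs1) (zpow_small hs1); last by apply: leq_ltn_trans hL; exact: leq_subr.
rewrite (bndE hs1) SmE; last by apply: ltnW (ltn_trans xL hL).
rewrite -[(inp, s1).2 aW 0]/(s aW 0) sW; congr (nat_of_bool (_ <= _ - _)).
apply: eq_bigr => y _; rewrite (zpow_small hs1) //.
by apply: leq_ltn_trans hL; exact: leq_subr.
Qed.

Lemma valid_iteration : zvalid (inp, s4).
Proof.
have b2 p : p < 8 * w_8 nr nb k d q -> zbit (inp, s2) p = adv_bit nr nb k d A p.
  by move=> h; rewrite /zbit (zLE hb hs2) -bits_read.
have b3 p : p < 8 * w_8 nr nb k d q -> zbit (inp, s3) p = adv_bit nr nb k d A p.
  by move=> h; rewrite /zbit (zLE hb hs3) -bits_read.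
have b4 p : p < 8 * w_8 nr nb k d q -> zbit (inp, s4) p = adv_bit nr nb k d A p.
  by move=> h; rewrite /zbit (zLE hb hs4) -bits_read.
have fcv s' : static s' -> zcv (inp, s') = cv.
  by move=> h; apply: boolp.funext => u; apply: boolp.funext => x; rewrite (st_cv h).
have fcn s' : static s' -> zcn (inp, s') = cn.
  by move=> h; apply: boolp.funext => u; apply: boolp.funext => x; rewrite (st_cn h).
have fpow s' : static s' -> zpow (inp, s') = powb b.
  by move=> h; apply: boolp.funext => j; rewrite (zpowE h).
have kb : k.+1 < b by move: hb; clear; lia.
have nrb : nr <= b by move: hb; clear; lia.
have Kk : KK <= 2 * k by rewrite /KK; have := leq_div k q; clear; lia.
have Kb : KK <= b by apply: leq_trans Kk _; move: hb; clear; lia.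
rewrite /zvalid (bndE hs4) (zNRE hs4) (zNBE hs4) (zTE hs4) (fcn _ hs4) (fcv _ hs4).
rewrite (zparE hb hL hs4 b4 hA) (zKKE hb hs4).
apply: (acc (X := fx) (Val := zval (inp, s3))).
- move=> l lp; rewrite hfx; last by apply: ltn_trans lp (leq_ltn_trans _ kb); case: (bd_p hA).
  rewrite /znextX (bndE hs2) (zNRE hs2) (zNBE hs2) (zKE hs2) (zTE hs2) (fcv _ hs2).
  by rewrite (zfarE hb hL hs2 b2 hA) (zstepE hb hL hs2 b2 hA).
- move=> i v iK vn.
  have iE : (KK - i.+1) * nr + v < b.
    apply: leq_ltn_trans hV; apply: (@leq_trans (KK * nr)); last by rewrite leq_mul2r Kk orbT.
    apply: (@leq_trans ((KK - i.+1).+1 * nr)); first by rewrite mulSn addnC leq_add2r ltnW.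
    by rewrite leq_mul2r; apply/orP; right; move: iK; rewrite -/KK; clear; lia.
  have e1 : ((KK - i.+1) * nr + v) %/ nr = KK - i.+1.
    by rewrite divnMDl // divn_small // addn0.
  rewrite {1}/zval (bndE hs3) (zKKE hb hs3) (zNRE hs3) -/KK MlE; last first.
    by rewrite (leq_trans (leq_subr _ _)).
  rewrite -[(inp, s3).2 aVAL _]/(fv ((KK - i.+1) * nr + v)) hfv //.
  rewrite /znextVAL (bndE hs3) (zNRE hs3) (zNBE hs3) (zKKE hb hs3) (fcv _ hs3) (fcn _ hs3).
  rewrite (fpow _ hs3) (zpE hb hL hs3 b3 hA) (zellE hb hL hs3 b3 hA) (zeE hb hL hs3 b3 hA).
  rewrite (zmE hb hL hs3 b3 hA) (zmbE hb hL hs3 b3 hA) (znuE hb hs3) (zparE hb hL hs3 b3 hA).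
  rewrite (zclsE hb hL hs3 b3 hA) (zrhoE hb hL hs3 b3 hA) (zseedE hb hL hs3 b3 hA).
  rewrite (zlabE hb hL hs3 b3 hA) -/KK MdE; last by rewrite e1 (leq_trans (leq_subr _ _)).
  rewrite modnMDl (modn_small vn) /Dv e1 (minn_idPl _); last first.
    by rewrite (leq_trans (leq_subr _ _)).
  by have -> : KK - (KK - i.+1).+1 = i by move: iK; rewrite -/KK; clear; lia.
- move=> i iK; rewrite -[LHS]/(ft i) hft; last exact: leq_trans iK Kb.
  rewrite /znextTR (bndE hs4) (zNRE hs4) (fcn _ hs4).
  by rewrite (zparE hb hL hs4 b4 hA).
Qed.

End Iteration.

(** * Instances *)

Lemma nth_allpairs T1 T2 (T : Type) (f : T1 -> T2 -> T) x0 x1 x2 s t i j :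
  i < size s -> j < size t ->
  nth x0 [seq f x y | x <- s, y <- t] (i * size t + j) = f (nth x1 s i) (nth x2 t j).
Proof.
elim: s i => [|x s ih] // [|i] /= hi hj.
  by rewrite mul0n add0n nth_cat size_map hj (nth_map x2).
by rewrite nth_cat size_map mulSn -addnA ltnNge leq_addr /= addKn ih.
Qed.

Lemma idx_lt i j m n : i < m -> j < n -> i * n + j < m * n.
Proof.
move=> hi hj; apply: (@leq_trans (i.+1 * n)); last by rewrite leq_mul2r hi orbT.
by rewrite mulSn addnC ltn_add2r.
Qed.

Section Instances.

Variable I : instance.
Let nr := nred I.
Let nb := nblue I.

Definition cnI (u v : nat) : bool :=
  if insub u is Some i then if insub v is Some j then @conn I i j else false else false.
Definition cvI (u x : nat) : bool :=
  if insub u is Some i then if insub x is Some y then @cov I i y else false else false.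

Lemma cnI_val (i j : 'I_nr) : cnI i j = conn i j.
Proof. by rewrite /cnI !valK. Qed.

Lemma cvI_val (i : 'I_nr) (y : 'I_nb) : cvI i y = cov i y.
Proof. by rewrite /cvI !valK. Qed.

Lemma cnI_out u v : ~~ ((u < nr) && (v < nr)) -> cnI u v = false.
Proof.
rewrite /cnI; case: insubP => [i hu _|//]; case: insubP => [j hv _|//].
by rewrite hu hv.
Qed.

Lemma cvI_out u x : ~~ ((u < nr) && (x < nb)) -> cvI u x = false.
Proof.
rewrite /cvI; case: insubP => [i hu _|//]; case: insubP => [j hv _|//].
by rewrite hu hv.
Qed.

Lemma cnI_sym u v : cnI u v = cnI v u.
Proof.
rewrite /cnI; case: insubP => [i _ _|_]; case: insubP => [j _ _|_] //.
exact: conn_sym.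
Qed.

Variable d : nat.

Lemma input_conn u v : u < nr -> v < nr -> input I d (5 + (u * nr + v)) = cnI u v.
Proof.
move=> hu hv; rewrite /input /input_cells nth_cat /= nth_cat size_allpairs.
rewrite !size_enum_ord -/nr.
have lt : u * nr + v < nr * nr by apply: idx_lt.
rewrite (addKn 5) lt -[X in u * X + v](size_enum_ord nr).
rewrite (nth_allpairs _ _ (Ordinal hu) (Ordinal hv)) ?size_enum_ord //.
by rewrite -cnI_val !nth_enum_ord.
Qed.

Lemma input_cov u x : u < nr -> x < nb ->
  input I d (5 + (nr * nr + (u * nb + x))) = cvI u x.
Proof.
move=> hu hx; rewrite /input /input_cells nth_cat /= nth_cat size_allpairs.
rewrite !size_enum_ord -/nr -/nb (addKn 5) ltnNge leq_addr /= addKn.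
rewrite -[X in u * X + x](size_enum_ord nb).
rewrite (nth_allpairs _ _ (Ordinal hu) (Ordinal hx)) ?size_enum_ord //.
by rewrite -cvI_val !nth_enum_ord.
Qed.

Lemma input_out a : 5 + nr * (nr + nb) <= a -> input I d a = 0.
Proof.
move=> h; rewrite /input nth_default // /input_cells !size_cat !size_allpairs.
by rewrite !size_enum_ord -mulnDr.
Qed.

Lemma valid_sound b t par KK (TR : nat -> nat) (S := [set i : 'I_nr | has (fun j => TR j == val i) (iota 0 KK)]) :
  nr <= b -> nb <= b -> KK <= b ->
  valid b nr nb t cnI cvI par KK TR ->

  [/\ #|S| <= KK, induced_connected (@conn I) S & t <= #|covered S|].
Proof.
move=> hr hb hK; rewrite /valid AlE // SmE // => /andP [/allI hv ht].
have hn i : i < KK -> TR i < nr by move=> iK; case/andP: (hv _ iK).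
split.
- apply: leq_trans (_ : size (iota 0 KK) <= _); last by rewrite size_iota.
  rewrite -(size_map TR) cardE.
  rewrite -(size_map val); apply: uniq_leq_size.
    by rewrite (map_inj_uniq val_inj) enum_uniq.
  move=> v /mapP [i]; rewrite mem_enum inE => /hasP [j hj /eqP <-] ->.
  exact: map_f.
- pose e := [rel u v | [&& u \in S, v \in S & @conn I u v]].
  have esym : connect_sym e.
    by apply: sym_connect_sym => u v; rewrite /= conn_sym andbCA.
  have inS i (iK : i < KK) : Ordinal (hn i iK) \in S.
    by rewrite inE; apply/hasP; exists i; rewrite ?mem_iota.
  have root i (iK : i < KK) (K0 : 0 < KK) : connect e (Ordinal (hn 0 K0)) (Ordinal (hn i iK)).
    elim/ltn_ind: i iK => i ih iK; have := hv i iK; case/andP => _ /orP [/eqP i0|/andP [lt h]].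
      have -> : Ordinal (hn i iK) = Ordinal (hn 0 K0) by apply: val_inj; rewrite /= i0.
      exact: connect0.
    have pK := ltn_trans lt iK; apply: connect_trans (ih _ lt pK) _.
    case/orP: h => [/eqP h|h].
      have -> : Ordinal (hn i iK) = Ordinal (hn _ pK) by apply: val_inj; rewrite /= h.
      exact: connect0.
    by apply: connect1; rewrite /= !inS -cnI_val.
  move=> x y; rewrite !inE => /hasP [i]; rewrite mem_iota /= => iK /eqP hx.
  case/hasP => j; rewrite mem_iota /= => jK /eqP hy.
  have K0 : 0 < KK := leq_ltn_trans (leq0n _) iK.
  have -> : x = Ordinal (hn i iK) by apply: val_inj; rewrite /= hx.
  have -> : y = Ordinal (hn j jK) by apply: val_inj; rewrite /= hy.
  by apply: connect_trans (root j jK K0); rewrite esym; apply: root.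
- apply: leq_trans ht _; rewrite sum_card subset_leq_card //; apply/subsetP => x.
  rewrite !inE HsE // => /hasI [i iK h]; apply/existsP; exists (Ordinal (hn i iK)).
  rewrite -cvI_val h andbT inE; apply/hasP; exists i; by rewrite ?mem_iota.
Qed.

Section Solution.

Variable S : {set 'I_nr}.
Let sq := [seq val i | i <- enum S].

Lemma seq_mem (i : 'I_nr) : (val i \in sq) = (i \in S).
Proof. by rewrite (mem_map val_inj) mem_enum. Qed.

Lemma seq_uniq : uniq sq.
Proof. by rewrite (map_inj_uniq val_inj) enum_uniq. Qed.

Lemma seq_bounded : all (fun v => v < nr) sq.
Proof. by apply/allP => v /mapP [i _ ->]; exact: ltn_ord. Qed.

Lemma seq_size : size sq = #|S|.
Proof. by rewrite size_map -cardE. Qed.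

Lemma seq_cov : cov_by nb cvI sq = covered S.
Proof.
apply/setP => x; rewrite !inE; apply/hasP/existsP => [[v /mapP [i]]|[i /andP [iS h]]].
  by rewrite mem_enum => iS -> h; exists i; rewrite iS -cvI_val.
by exists (val i); [rewrite seq_mem | rewrite cvI_val].
Qed.

Lemma seq_grows : induced_connected (@conn I) S -> grows cnI sq.
Proof.
move=> cS A /hasP [x /mapP [i]]; rewrite mem_enum => iS -> Ai.
case/hasP => y /mapP [j]; rewrite mem_enum => jS -> nAj.
case: (boolP [exists u : 'I_nr, exists v : 'I_nr,
    [&& u \in S, A u, v \in S, ~~ A v & conn u v]]) => [|no].
  case/existsP => u /existsP [v /and5P [uS Au vS nAv uv]].
  by exists (val u), (val v); rewrite !seq_mem cnI_val.
have cl : closed [rel u v | [&& u \in S, v \in S & @conn I u v]] (fun u : 'I_nr => A u).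
  have one u v : [&& u \in S, v \in S & @conn I u v] -> A u -> A v.
    move=> /and3P [uS vS uv] Au; apply/negPn/negP => nAv; move/negP: no; apply.
    by apply/existsP; exists u; apply/existsP; exists v; rewrite uS Au vS nAv.
  move=> u v /= /and3P [uS vS uv]; apply/idP/idP; first by apply: one; rewrite uS vS.
  by apply: one; rewrite uS vS /= conn_sym.
have := closed_connect cl (cS i j iS jS); rewrite -!topredE /= Ai => h.
by move: nAj; rewrite /= -h.
Qed.

End Solution.

Lemma few_red (W : {set 'I_nb}) l A : biclique_free I d -> d <= l ->
  #|W| <= A * (l - d).+1 ->
  count (fun u => l <= #|nbh nb cvI u :&: W|) (iota 0 nr) <= d * A ^ d.
Proof.
move=> free dl hW.
have := @few_large_traces _ _ (fun i : 'I_nr => nbh nb cvI i) d W l A _ dl hW.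
have -> : count (fun u => l <= #|nbh nb cvI u :&: W|) (iota 0 nr) =
    #|[set i : 'I_nr | l <= #|nbh nb cvI i :&: W|]|.
  rewrite -sum_card -sum1_count big_mkcond /=.
  rewrite -(big_mkord predT (fun u => nat_of_bool (l <= #|nbh nb cvI u :&: W|))).
  by rewrite /index_iota subn0; apply: eq_bigr => u _; case: ifP.
apply=> X Y cX cY h; case: free; exists X, Y; split=> // r y rX yY.
by have := subsetP (h r rX) _ yY; rewrite inE cvI_val.
Qed.

End Instances.

(** * The search over all advices *)

Section Search.

Variables (I : instance) (d D b q : nat) (P : terms) (inp : nat -> nat).

Let nr := nred I.
Let nb := nblue I.
Let k := budget I.
Let t := demand I.
Let static := static b nr nb k t D q (@cnI I) (@cvI I) inp.
Let near (u v : nat) : bool := [&& u < nr, v < nr & walk nr (@cnI I) (k %/ q) u v].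

Hypothesis free : biclique_free I d.
Hypothesis d0 : 0 < d.
Hypothesis DE : 0 < k -> D = d.
Hypothesis q0 : 0 < q.
Hypothesis hb : 10 * (nr + nb + k + D + q + 600) <= b.
Hypothesis hL : 8 * w_8 nr nb k D q < b.
Hypothesis hV : 2 * k * nr < b.
Hypothesis hS : w_nu nr nb k D * (64 * (k ^ 3 * D)) <= b.

Definition solution (kk : nat) (S : {set 'I_nr}) : Prop :=
  [/\ #|S| <= kk, induced_connected (@conn I) S & t <= #|covered S|].

Definition good_code (w : nat) : Prop := exists A,
  [/\ bounded k D q (w_n nr nb) (w_om nr nb k D) (w_nu nr nb k D) A,
     accepted b nr nb k t D q (w_nu nr nb k D) (@cnI I) (@cvI I) near A &
     adv_code nr nb k D q A = w].

Lemma good_code_exists S : 0 < t -> solution k S ->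
  0 < nr /\ exists2 w, w < 2 ^ (8 * w_8 nr nb k D q) & good_code w.
Proof.
move=> t0 [Sk cS tS].
have S0 : 0 < #|S|.
  rewrite lt0n; apply/eqP => /cards0_eq e; move: tS; rewrite leqNgt => /negP; apply.
  rewrite (_ : covered S = set0) ?cards0 //; apply/setP => x; rewrite !inE.
  by apply/existsP => -[i]; rewrite e inE.
have k0 : 0 < k := leq_trans S0 Sk.
have Dd := DE k0; have D0 : 0 < D by rewrite Dd.
split.
  by rewrite -(card_ord nr); apply: leq_trans S0 _; exact: max_card.
have hb' := hb; have hn := w_nu_le nr nb k D.
have nearE u v : u < nr -> v < nr -> near u v = walk nr (@cnI I) (k %/ q) u v.
  by rewrite /near => -> ->.
have few (W : {set 'I_nb}) l : D <= l -> #|W| <= 6 * k ^ 3 * (l - D).+1 ->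
    count (fun u => l <= #|nbh nb (@cvI I) u :&: W|) (iota 0 nr) <= D * (6 * k ^ 3) ^ D.
  by rewrite Dd; apply: few_red.
have [A hA acc] := @completeness b nr nb k t D q (w_n nr nb) (w_om nr nb k D)
  (w_nu nr nb k D) (@cnI I) (@cvI I) [seq val i | i <- enum S]
  ltac:(move: hb'; clear; lia) ltac:(move: hb'; clear; lia) ltac:(move: hb'; clear; lia)
  ltac:(move: hb' hn; clear; lia) hS k0 q0 D0 (red_width _ _) (blue_width _ _)
  ltac:(exact: modulus_width) ltac:(exact: hash_width) ltac:(exact: step_width)
  ltac:(exact: residue_width) ltac:(exact: seed_width) (@cnI_sym I)
  (seq_uniq S) (seq_bounded S) ltac:(by rewrite seq_size) ltac:(by rewrite seq_size)
  (seq_grows cS) ltac:(by rewrite seq_cov) few near nearE.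
by exists (adv_code nr nb k D q A); [exact: code_lt | exists A].
Qed.

Lemma static_near s : static s -> (fun u v => zdist (inp, s) (zdl (inp, s)) u v) = near.
Proof.
move=> hs; apply: boolp.funext => u; apply: boolp.funext => v; rewrite /near.
case: (ltnP u nr) => hu /=; last by rewrite /zdist (zNRE hs) ltnNge hu.
case: (ltnP v nr) => hv /=; last by rewrite /zdist (zNRE hs) (ltnNge v) hv andbF.
exact: (st_dist hs).
Qed.

Definition out_set (s : state) : {set 'I_nr} := [set i : 'I_nr | s aOUT i != 0].

Record searching (n : nat) (s : state) : Prop := Searching {
  se_static : static s;
  se_W : s aW 0 = n;
  se_TOP : s aTOP 0 = 2 ^ (8 * w_8 nr nb k D q);
  se_out : s aFND 0 != 0 -> solution (k + k %/ q) (out_set s);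
  se_none : s aFND 0 = 0 -> 0 < t /\ (0 < nr -> forall w, good_code w -> n <= w)
}.

Lemma search_step n s : searching n s -> searching n.+1 (srun inp (body P) s).
Proof.
case=> hs hW hT hout hnone.
have [fb [fx [fv [ft [fo [-> hfo [hb1 hb2 hb3 hb4]]]]]]] := body_run P inp s.
rewrite (st_b hs) in hfo hb1 hb2 hb3 hb4.
set s4 := setarr (setarr (setarr _ _ _) _ _) aTR _ in hb4 *.
have hs4 : static s4 by case: hs.
have nrb : nr <= b by move: hb; clear; lia.
have nbb : nb <= b by move: hb; clear; lia.
have Kb : k + k %/ q <= b by have := leq_div k q; move: hb; clear; lia.
rewrite (zNRE hs) (zKKE hb hs) in hb3.
have fcv : zcv (inp, s4) = @cvI I.
  by apply: boolp.funext => u; apply: boolp.funext => x; rewrite (st_cv hs4).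
have fcn : zcn (inp, s4) = @cnI I.
  by apply: boolp.funext => u; apply: boolp.funext => x; rewrite (st_cn hs4).
have vE : zvalid (inp, s4) = valid b nr nb t (@cnI I) (@cvI I) (zpar (inp, s4)) (k + k %/ q) ft.
  by rewrite /zvalid (bndE hs4) (zNRE hs4) (zNBE hs4) (zTE hs4) fcn fcv (zKKE hb hs4).
have FE : znextFND (inp, s4) = if s aFND 0 != 0 then s aFND 0
    else if zvalid (inp, s4) then n.+1 else 0.
  by rewrite -hW.
have oE i : i < b -> (fo i != 0) = if s aFND 0 != 0 then s aOUT i != 0
    else has (fun j => ft j == i) (iota 0 (k + k %/ q)).
  by move=> ib; rewrite hfo //; case: ifP => // _; rewrite (zKKE hb hs) HsE //; case: has.
split.
- by case: hs.
- by rewrite -hW.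
- exact: hT.
- rewrite -[setarr _ _ _ aFND 0]/(znextFND (inp, s4)) FE => F.
  change (solution (k + k %/ q) [set i : 'I_nr | fo i != 0]).
  case: (eqVneq (s aFND 0) 0) F => [F0|F0] /=.
    case: ifP => // hv _; rewrite vE in hv.
    have [h1 h2 h3] := valid_sound nrb nbb Kb hv.
    suff -> : [set i : 'I_nr | fo i != 0] =
      [set i : 'I_nr | has (fun j => ft j == val i) (iota 0 (k + k %/ q))] by split.
    by apply/setP => i; rewrite !inE oE ?(leq_trans (ltn_ord i)) // F0.
  move=> _; suff -> : [set i : 'I_nr | fo i != 0] = out_set s by apply: hout.
  by apply/setP => i; rewrite !inE oE ?(leq_trans (ltn_ord i)) // F0.
- rewrite -[setarr _ _ _ aFND 0]/(znextFND (inp, s4)) FE.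
  case: (eqVneq (s aFND 0) 0) => [F0|F0] /=; last by move=> e; rewrite e in F0.
  case: ifP => // hv _; have [t0 none] := hnone F0; split=> // nr0 w gw.
  have := none nr0 w gw; rewrite leq_eqVlt => /orP [/eqP e|//]; exfalso.
  case: gw => A [hA acc code]; move/negP: hv; apply.
  have acc' : accepted b nr nb k t D q (w_nu nr nb k D) (@cnI I) (@cvI I)
      (fun u v => zdist (inp, s) (zdl (inp, s)) u v) A by rewrite (static_near hs).
  apply: (valid_iteration hb hL hV nr0 hs hA acc' _ hb1 hb2 (hb3 nr0 nrb Kb) hb4).
  by rewrite hW code e.
Qed.

Lemma search_end s : searching (2 ^ (8 * w_8 nr nb k D q)) s ->
  if s aFND 0 != 0 then solution (k + k %/ q) (out_set s)
  else ~ exists S, solution k S.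
Proof.
move=> hs; case: ifP => F; first by apply: (se_out hs); rewrite F.
move/negbFE/eqP: F => F [S hS'].
have [t0 none] := se_none hs F; have [nr0 [w wL gw]] := good_code_exists t0 hS'.
by have := none nr0 w gw; rewrite leqNgt wL.
Qed.

Lemma search_all n s : searching 0 s -> searching n (iter n (srun inp (body P)) s).
Proof. by elim: n => // n ih hs; apply: search_step; apply: ih. Qed.

End Search.

(** * Locating the end of the input *)

(* The length of the input is a product, whose computation takes two scratch
   cells.  Cell 5 holds the diagonal entry (0,0) of the adjacency matrix, which is
   zero, and cell 6 the entry (0,1), which is restored from (1,0). *)
Definition prologue : program :=
  If (Sub (Mem (Cst 0)) (Cst 1))
    (Seq (Store (Cst 6) (Cst 5))
    (Seq (Store (Cst 5) (Mem (Cst 0)))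
    (Seq (While (Mem (Cst 5))
           (Seq (Store (Cst 6) (Add (Mem (Cst 6)) (Add (Mem (Cst 0)) (Mem (Cst 1)))))
                (Store (Cst 5) (Sub (Mem (Cst 5)) (Cst 1)))))
    (Seq (Store (Add (Mem (Cst 6)) (Cst 3)) (Mem (Cst 0)))
    (Seq (Store (Cst 0) (Mem (Cst 6)))
         (Store (Cst 6) (Mem (Add (Cst 5) (Mem (Add (Mem (Cst 0)) (Cst 3)))))))))))
    (Seq (Store (Add (Mem (Cst 1)) (Cst 9)) (Mem (Cst 0)))
         (Store (Cst 0) (Add (Mem (Cst 1)) (Cst 6)))).

Lemma multiply_loop (m : memory) n :  m 5 = n ->
  exists tau m', [/\ exec (While (Mem (Cst 5))
           (Seq (Store (Cst 6) (Add (Mem (Cst 6)) (Add (Mem (Cst 0)) (Mem (Cst 1)))))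
                (Store (Cst 5) (Sub (Mem (Cst 5)) (Cst 1))))) m tau m',
    tau <= 50 * n + 50, m' 5 = 0, m' 6 = m 6 + n * (m 0 + m 1) &
    forall a : nat, a != 5 -> a != 6 -> m' a = m a].
Proof.
elim: n m => [|n ih] m m5.
  by exists 3, m; split; rewrite ?mul0n ?addn0 //; apply: ExecWhileFalse.
set m1 : memory := [eta m with 6 |-> m 6 + (m 0 + m 1)].
set m2 : memory := [eta m1 with 5 |-> n].
have [|tau [m' [e1 c1 h5 h6 h]]] := ih m2; first by [].
eexists; exists m'; split.
- eapply ExecWhileTrue; [by rewrite /= m5 | | exact: e1].
  eapply ExecSeq; first exact: exec_store (erefl _) (erefl _).
  by apply: exec_store => //=; rewrite m5 subn1.
- by move: c1; clear; simpl; lia.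
- exact: h5.
- by rewrite h6 /= mulSn addnA.
- by move=> a a5 a6; rewrite h //= /m2 /m1 /= (negbTE a5) (negbTE a6).
Qed.

Section Prologue.

Variables (I : instance) (d : nat).
Let nr := nred I.
Let nb := nblue I.

Definition in_end : nat := if 1 < nr then 5 + nr * (nr + nb) else nb + 6.
Definition inp : nat -> nat := fun a => if a == 0 then in_end else input I d a.
Definition start : state := fun a i => if (acode a == 1) && (i == 0) then nr else 0.

Lemma in_end_ge : 5 + nr * (nr + nb) <= in_end.
Proof.
rewrite /in_end; case: (ltnP 1 nr) => //; case: nr => [|[|]] //= _.
all: by rewrite ?mul0n ?mul1n; clear; lia.
Qed.

Lemma in_end_gt : 5 < in_end.
Proof.
rewrite /in_end; case: (ltnP 1 nr) => h; last exact: leq_addl.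
by rewrite -[5]addn0 ltn_add2l muln_gt0 addn_gt0 (ltnW h).
Qed.

Lemma inp_gt0 : 0 < inp 0.
Proof. by rewrite /inp /=; apply: leq_trans in_end_gt. Qed.

Lemma input5 : input I d 5 = 0.
Proof.
case: (posnP nr) => h; first by rewrite input_out // -/nr h mul0n.
have := @input_conn I d 0 0 h h; rewrite mul0n => ->.
by rewrite (cnI_val (Ordinal h) (Ordinal h)) conn_irr.
Qed.

Lemma input6 : 1 < nr -> input I d 6 = input I d (5 + nr).
Proof.
move=> h; have h0 : 0 < nr := ltnW h.
have := @input_conn I d 0 1 h0 h; rewrite mul0n => ->.
by have := @input_conn I d 1 0 h h0; rewrite mul1n addn0 => ->; rewrite cnI_sym.
Qed.

Lemma start_rep (m : memory) : m 0 = in_end -> m (in_end + 3) = nr ->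
  (forall a : nat, a != 0 -> a != in_end + 3 -> m a = input I d a) ->
  rep inp start [::] m.
Proof.
move=> h0 h3 h; have gt := in_end_gt; have ge := in_end_ge; split=> //.
- move=> a; rewrite /inp /=; case: eqP => [->|/eqP a0] // lt.
  by rewrite h // neq_ltn (leq_trans lt) // leq_addr.
- move=> a i; rewrite /start /cell /inp /=.
  case: andP => [[/eqP -> /eqP ->]|ne]; first by rewrite muln0.
  rewrite h ?input_out //.
  + by apply: leq_trans ge _; rewrite leq_addr.
  + by move: gt; clear; lia.
  + rewrite eqn_add2l; apply/eqP => e; apply: ne; split; apply/eqP; move: e (acode_lt16 a); clear; lia.
Qed.

Lemma prologue_ok : exists tau m, [/\ exec prologue (input I d) tau m,
  tau <= 50 * nr + 200 & rep inp start [::] m].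
Proof.
have i0 : input I d 0 = nr by [].
have i1 : input I d 1 = nb by [].
have gt := in_end_gt.
case: (ltnP 1 nr) => h.
- pose m1 : memory := [eta input I d with 6 |-> 5].
  pose m2 : memory := [eta m1 with 5 |-> nr].
  have [|tau [m3 [e1 c1 h5 h6 h3]]] := @multiply_loop m2 nr; first by [].
  have e6 : m3 6 = in_end.
    by rewrite h6 /m2 /m1 /= i0 i1 /in_end h.
  have e0 : m3 0 = nr by rewrite h3.
  pose m4 : memory := [eta m3 with in_end + 3 |-> nr].
  pose m5 : memory := [eta m4 with 0 |-> in_end].
  pose m6 : memory := [eta m5 with 6 |-> m5 (5 + nr)].
  eexists; exists m6; split.
  + eapply ExecIfTrue; first by rewrite /= i0 subn_eq0 -ltnNge.
    eapply (@ExecSeq _ _ _ _ m1); first exact: exec_store.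
    eapply (@ExecSeq _ _ _ _ m2); first exact: exec_store.
    eapply ExecSeq; first exact: e1.
    eapply (@ExecSeq _ _ _ _ m4).
      by apply: exec_store; rewrite //= e6.
    eapply (@ExecSeq _ _ _ _ m5).
      by apply: exec_store; rewrite //= /m4 /= e6 ltn_eqF //; move: gt; clear; lia.
    have h50 : m5 0 = in_end by [].
    have h53 : m5 (in_end + 3) = nr by rewrite /m5 /m4 /= eqxx addn_eq0 andbF.
    by apply: exec_store; rewrite // !eval_Mem !eval_Add !eval_Mem !eval_Add /= h50 h53.
  + by move: c1; clear; simpl; lia.
  + apply: start_rep.
    * by [].
    * by rewrite /m6 /m5 /m4 /= eqxx addn_eq0 andbF gtn_eqF //; move: gt; clear; lia.
    * move=> a a0 aE; rewrite /m6 /=; case: eqP => [->|/eqP a6].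
        have n5 : (5 + nr == 5) = false by rewrite gtn_eqF // -[5 in X in X < _]addn0 ltn_add2l ltnW.
        have n6 : (5 + nr == 6) = false by rewrite gtn_eqF // -[6]/(5 + 1) ltn_add2l.
        have nE : (5 + nr == in_end + 3) = false.
          rewrite ltn_eqF //; apply: (@leq_ltn_trans in_end); last by rewrite -[X in X < _]addn0 ltn_add2l.
          by apply: leq_trans in_end_ge; rewrite leq_add2l leq_pmulr // addn_gt0 (ltnW h).
        by rewrite /m5 /m4 /= nE h3 ?n5 ?n6 // /m2 /m1 /= n5 n6 input6.
      rewrite /m5 /m4 /= (negbTE a0) (negbTE aE).
      case: (eqVneq a 5) => [->|a5]; first by rewrite h5 input5.
      by rewrite h3 // /m2 /m1 /= (negbTE a5) (negbTE a6).
- pose m1 : memory := [eta input I d with nb + 9 |-> nr].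
  pose m2 : memory := [eta m1 with 0 |-> in_end].
  have eE : in_end = nb + 6 by rewrite /in_end ltnNge h.
  eexists; exists m2; split.
  + eapply ExecIfFalse; first by rewrite /= i0; apply/eqP; rewrite subn_eq0.
    eapply (@ExecSeq _ _ _ _ m1); first by apply: exec_store; rewrite /= ?i0 ?i1.
    by apply: exec_store; rewrite //= /m1 /= i1 eE; case: eqP => // e; move: e; clear; lia.
  + by clear; simpl; lia.
  + apply: start_rep.
    * by [].
    * by rewrite /m2 /m1 /= eE addn_eq0 andbF -addnA eqxx.
    * by move=> a a0 aE; rewrite /m2 /m1 /= (negbTE a0); move: aE; rewrite eE -addnA => /negbTE ->.
Qed.

End Prologue.

Section Sizes.

Variables (nr nb k D q M : nat).
Hypothesis ME : M = nr + nb + k + D + q + 600.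

Let step i : 600 * M ^ i <= M ^ i.+1.
Proof. by rewrite expnS leq_mul2r ME leq_addl orbT. Qed.

Let le i j : i <= j -> M ^ i <= M ^ j.
Proof. by move=> h; rewrite leq_pexp2l // ME addnS. Qed.

Lemma range_sum : 10 * (nr + nb + k + D + q + 600) <= M ^ 8.
Proof.
rewrite -ME; apply: leq_trans (le (isT : 2 <= 8)); apply: leq_trans (step 1).
by rewrite expn1 leq_mul2r orbT.
Qed.

Lemma range_product : 2 * k * nr < M ^ 8.
Proof.
apply: leq_trans (le (isT : 3 <= 8)); apply: leq_trans (step 2).
apply: (@leq_ltn_trans (2 * M ^ 2)); last by rewrite ltn_pmul2r // expn_gt0 ME addnS.
by rewrite -mulnA leq_mul2l /= expnS expn1 leq_mul // ME; clear; lia.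
Qed.

Lemma range_dist : (k %/ q).+1 * nr * nr <= M ^ 8.
Proof.
apply: leq_trans (le (isT : 3 <= 8)); rewrite !expnS expn0 muln1 mulnA !leq_mul //.
- by rewrite ME; have := leq_div k q; clear; lia.
- by rewrite ME; clear; lia.
- by rewrite ME; clear; lia.
Qed.

Lemma nu_le_range : w_nu nr nb k D <= 6 * M.
Proof. by apply: leq_trans (w_nu_le _ _ _ _) _; rewrite ME; clear; lia. Qed.

Lemma cube_le_range : k ^ 3 * D <= M ^ 4.
Proof. by rewrite [M ^ 4]expnSr leq_mul ?leq_exp2r // ME; clear; lia. Qed.

Lemma range_hash : w_nu nr nb k D * (64 * (k ^ 3 * D)) <= M ^ 8.
Proof.
apply: leq_trans (le (isT : 6 <= 8)); apply: leq_trans (step 5).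
apply: (@leq_trans ((6 * M) * (64 * M ^ 4))).
  by apply: leq_mul nu_le_range _; rewrite leq_mul2l cube_le_range orbT.
rewrite [M ^ 5]expnS mulnACA -[6 * 64]/384.
by rewrite leq_mul2r orbT.
Qed.

Lemma om_le_range : w_om nr nb k D <= 4 * M ^ 2.
Proof.
have h2 : D * (3 * bl k + 3) <= M * (3 * M).
  by rewrite leq_mul //; have := bl_le k; rewrite ME; clear; lia.
have h := nu_le_range; have hD : bl D <= M by have := bl_le D; rewrite ME; clear; lia.
have h1 := step 1; rewrite expn1 in h1; move: h2; rewrite mulnCA mulnn => h2.
by rewrite /w_om; move: h h1 h2 hD; clear; lia.
Qed.

Lemma range_bits : 8 * w_8 nr nb k D q < M ^ 8.
Proof.
apply: leq_trans (le (isT : 6 <= 8)).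
have hn : w_n nr nb <= M by apply: leq_trans (w_n_le _ _) _; rewrite ME; clear; lia.
have h1 : (2 * q + 2) * w_n nr nb <= (2 * M) * M.
  by apply: leq_mul => //; rewrite ME; clear; lia.
have h2 : (2 * k + 8) * w_om nr nb k D <= (2 * M) * (4 * M ^ 2).
  by apply: leq_mul om_le_range; rewrite ME; clear; lia.
have h3 : w_nu nr nb k D * (w_nu nr nb k D * w_nu nr nb k D) <= (6 * M) * ((6 * M) * (6 * M)).
  by have h := nu_le_range; apply: leq_mul h (leq_mul h h).
have h4 := cube_le_range; rewrite S3E in h4.
have e1 : (2 * M) * M = 2 * M ^ 2 by rewrite -mulnA mulnn.
have e2 : (2 * M) * (4 * M ^ 2) = 8 * M ^ 3 by rewrite mulnACA -expnS.
have e3 : (6 * M) * ((6 * M) * (6 * M)) = 216 * M ^ 3.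
  by rewrite -[216]/(6 ^ 3) -expnMn !expnS expn0 muln1.
have M0 : 0 < M ^ 4 by rewrite expn_gt0 ME addnS.
have s2 := step 2; have s3 := step 3; have s4 := step 4; have s5 := step 5.
rewrite /w_8; move: h1 h2 h3 h4; rewrite e1 e2 e3.
move: (M ^ 2) (M ^ 3) (M ^ 4) (M ^ 5) (M ^ 6) s2 s3 s4 s5 M0 (_ * w_n _ _) (_ * w_om _ _ _ _) (w_nu _ _ _ _ * _) (k * _).
by clear; lia.
Qed.

End Sizes.

(** * Initialisation *)

Lemma zcn_inp I d (s : state) u v : s aNR 0 = nred I -> nred I <= s aB 0 ->
  zcn (inp I d, s) u v = cnI I u v.
Proof.
move=> sn sb; rewrite /zcn /zNR /bound /= sn.
case: (ltnP u (nred I)) => hu /=; last by rewrite cnI_out // ltnNge hu.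
case: (ltnP v (nred I)) => hv /=; last by rewrite cnI_out // (ltnNge v) hv andbF.
have h : 5 + (u * nred I + v) < in_end I.
  apply: leq_trans (in_end_ge I); rewrite ltn_add2l mulnDr ltn_addr //; exact: idx_lt.
rewrite /rdinp /= MlE ?(leq_trans (ltnW hu)) // -[inp I d 0]/(in_end I) h.
by rewrite -[inp I d _]/(input I d (5 + (u * nred I + v))) input_conn //; case: cnI.
Qed.

Lemma rdinp_inp I d s a : 0 < a < 5 -> rdinp (inp I d, s) a = input I d a.
Proof.
case/andP => a0 a5; rewrite /rdinp -[(inp I d, s).1 0]/(in_end I).
by rewrite (ltn_trans a5 (in_end_gt I)) /= /inp gtn_eqF.
Qed.

Lemma zcv_inp I d (s : state) u x : s aNR 0 = nred I -> nred I + nblue I <= s aB 0 ->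
  zcv (inp I d, s) u x = cvI I u x.
Proof.
move=> sn sb; rewrite /zcv /zNR /bound /= sn.
have -> : zNB (inp I d, s) = nblue I by rewrite /zNB rdinp_inp.
case: (ltnP u (nred I)) => hu /=; last by rewrite cvI_out // ltnNge hu.
case: (ltnP x (nblue I)) => hx /=; last by rewrite cvI_out // (ltnNge x) hx andbF.
have h : 5 + (nred I * nred I + (u * nblue I + x)) < in_end I.
  by apply: leq_trans (in_end_ge I); rewrite ltn_add2l mulnDr ltn_add2l; apply: idx_lt.
have nb' : nred I <= s aB 0 by apply: leq_trans sb; exact: leq_addr.
rewrite /rdinp /= !MlE ?(leq_trans (ltnW hu)) // -[inp I d 0]/(in_end I) h.
rewrite -[inp I d _]/(input I d (5 + (nred I * nred I + (u * nblue I + x)))) input_cov //.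
by case: cvI.
Qed.

Record iterms : Type := ITerms {
  iD : term; iS : term; iSq : term; iF : term;
  iDE : forall z r, teval z.1 z.2 r iD = if rdinp z 2 != 0 then rdinp z 4 else 0;
  iSE : forall z r, teval z.1 z.2 r iS = zNR z + zNB z + zK z + zD z + zQ z + 600;
  iSqE : forall z r, teval z.1 z.2 r iSq = Ml (bound z) (bound z) (bound z);
  iFE : forall z r, teval z.1 z.2 r iF = (zT z == 0)
}.

Lemma iterms_exist : inhabited iterms.
Proof.
have [t1 h1] : Comp (fun z _ => if rdinp z 2 != 0 then rdinp z 4 else 0) by termify.
have [t2 h2] : Comp (fun z _ => zNR z + zNB z + zK z + zD z + zQ z + 600) by termify.
have [t3 h3] : Comp (fun z _ => Ml (bound z) (bound z) (bound z)) by termify.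
have [t4 h4] : Comp (fun z _ => (zT z == 0)) by termify.
exact: inhabits (ITerms h1 h2 h3 h4).
Qed.

Section Init.

Variables (P : terms) (Q : iterms) (I : instance) (d q : nat).

Let nr := nred I.
Let nb := nblue I.
Let k := budget I.
Let t := demand I.
Definition eff_d : nat := if k == 0 then 0 else d.
Definition magnitude : nat := nr + nb + k + eff_d + q + 600.
Definition range : nat := magnitude ^ 8.
Let inp := inp I d.

Definition sets : seq (arr * term) :=
  [:: (aQ, TCst q); (aD, iD Q); (aB, iS Q); (aB, iSq Q); (aB, iSq Q); (aB, iSq Q)].
Definition tables : stmt :=
  SSeq (SSet aFND (iF Q)) (SSeq (STab aPOW (tPOW P)) (SSeq (STab aDIST (tDIST P))
    (SSet aTOP (tTOP P)))).

Definition set_all (l : seq (arr * term)) : program :=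
  foldr (fun at_ p => Seq (scomp (SSet at_.1 at_.2)) p) Skip l.
Definition run_all (l : seq (arr * term)) (s : state) : state :=
  foldl (fun s at_ => srun inp (SSet at_.1 at_.2) s) s l.

Lemma set_all_ok l s m c : rep inp s [::] m ->
  (forall i, i < size l -> scost (run_all (take i l) s aB 0)
     (SSet (nth (aB, TCst 0) l i).1 (nth (aB, TCst 0) l i).2) <= c) ->
  exists tau m', [/\ exec (set_all l) m tau m', tau <= size l * c + 1 &
    rep inp (run_all l s) [::] m'].
Proof.
elim: l s m => [|[a u] l ih] s m H hc.
  by exists 1, m; split=> //; exact: ExecSkip.
have [t1 [m1 [e1 c1 r1]]] := sset_ok (inp_gt0 I d) a u H.
have [|t2 [m2 [e2 c2 r2]]] := ih _ _ r1; first by move=> i il; apply: (hc i.+1).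
exists (t1 + t2), m2; split=> //; first exact: ExecSeq e1 e2.
by rewrite mulSn -addnA leq_add // (leq_trans c1) // (hc 0).
Qed.

Definition sized (v : nat) : state :=
  upd (upd (upd (start I) aQ 0 q) aD 0 eff_d) aB 0 v.

Lemma updK s a i v w : upd (upd s a i v) a i w = upd s a i w.
Proof.
apply: boolp.funext => a'; apply: boolp.funext => j; rewrite /upd.
by case: (_ && _).
Qed.

Lemma run_set a u s v : teval inp s [::] u = v -> srun inp (SSet a u) s = upd s a 0 v.
Proof. by move=> <-. Qed.

Lemma run_square v : srun inp (SSet aB (iSq Q)) (sized v) = sized (v * v).
Proof.
rewrite (@run_set _ _ _ (v * v)) ?updK //.
by rewrite (iSqE Q (inp, sized v)) /Ml /bound /= minnn.
Qed.

Lemma run_sets : run_all sets (start I) = sized range /\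
  forall i, i < 6 -> run_all (take i sets) (start I) aB 0 <= range.
Proof.
have e2 : srun inp (SSet aD (iD Q)) (upd (start I) aQ 0 q) = upd (upd (start I) aQ 0 q) aD 0 eff_d.
  by apply: run_set; rewrite (iDE Q (inp, _)) !rdinp_inp // /eff_d /k if_neg.
have e3 : srun inp (SSet aB (iS Q)) (upd (upd (start I) aQ 0 q) aD 0 eff_d) = sized magnitude.
  by apply: run_set; rewrite (iSE Q (inp, _)) /zNB /zK !rdinp_inp.
have e1 : srun inp (SSet aQ (TCst q)) (start I) = upd (start I) aQ 0 q by apply: run_set.
have q1 : srun inp (SSet aB (iSq Q)) (sized magnitude) = sized (magnitude ^ 2).
  by rewrite run_square mulnn.
have q2 : srun inp (SSet aB (iSq Q)) (sized (magnitude ^ 2)) = sized (magnitude ^ 4).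
  by rewrite run_square -expnD.
have q3 : srun inp (SSet aB (iSq Q)) (sized (magnitude ^ 4)) = sized range.
  by rewrite run_square -expnD.
have cons a u l s : run_all ((a, u) :: l) s = run_all l (srun inp (SSet a u) s) by [].
have nil s : run_all [::] s = s by [].
have M0 : 0 < magnitude by rewrite /magnitude addnS.
have le i : 0 < i <= 8 -> magnitude ^ i <= range by case/andP => ? ?; rewrite /range leq_pexp2l.
split; first by rewrite /sets !cons e1 e2 e3 q1 q2 q3 nil.
case=> [|[|[|[|[|[|//]]]]]] _; rewrite /sets [take _ _]/= ?cons ?e1 ?e2 ?e3 ?q1 ?q2 nil //.
- exact: (le 1).
- exact: (le 2).
- exact: (le 4).
Qed.

End Init.

Section Tables.

Variables (P : terms) (Q : iterms) (I : instance) (d q : nat).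

Let nr := nred I.
Let nb := nblue I.
Let k := budget I.
Let t := demand I.
Let D := eff_d I d.
Let b := range I d q.
Let inp := inp I d.

Let hb : 10 * (nr + nb + k + D + q + 600) <= b. Proof. exact: range_sum. Qed.

Lemma pow_table s f : s aB 0 = b ->
  (forall i, i < s aB 0 -> f i = nextPOW (inp, setarr s aPOW f) i) ->
  forall i, i < b -> f i = 2 ^ i.
Proof.
move=> sb hf; elim=> [|i ih] ib; rewrite hf ?sb // /nextPOW //=.
by rewrite -[setarr _ _ _ _ _]/(f i) ih ?(ltnW ib) // expnS mul2n addnn.
Qed.

Lemma dist_index r u v : u < nr -> v < nr ->
  let x := (r * nr + u) * nr + v in
  [/\ x %/ nr = r * nr + u, x %% nr = v, (r * nr + u) %/ nr = r & (r * nr + u) %% nr = u].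
Proof.
move=> hu hv x; have nr0 : 0 < nr := leq_ltn_trans (leq0n _) hu.
by rewrite /x !divnMDl // !divn_small // !addn0 !modnMDl !modn_small.
Qed.

Lemma nextDISTE s r u v : s aB 0 = b -> s aNR 0 = nr -> u < nr -> v < nr ->
  (r * nr + u) * nr + v < b ->
  nextDIST (inp, s) ((r * nr + u) * nr + v) = if r == 0 then u == v : nat
  else has (fun w => zdist (inp, s) r.-1 u w && ((w == v) || cnI I w v)) (iota 0 nr) : nat.
Proof.
move=> sb sn hu hv xb; have [e1 e2 e3 e4] := dist_index r hu hv.
have nrb : nr <= b by move: hb; clear; lia.
have l1 : r * nr + u <= b by rewrite -e1 (leq_trans (leq_div _ _)) // ltnW.
have l2 : r <= b by rewrite -e3 (leq_trans (leq_div _ _)).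
rewrite /nextDIST -[bound _]/(s aB 0) -[zNR _]/(s aNR 0) sb sn.
have d1 : Dv b ((r * nr + u) * nr + v) nr = r * nr + u by rewrite /Dv e1 (minn_idPl l1).
have d2 : Dv b (r * nr + u) nr = r by rewrite /Dv e3 (minn_idPl l2).
rewrite d1 d2 !MdE ?e1 ?e3 // e2 e4; case: eqP => // _; rewrite HsE //.
congr nat_of_bool; apply: eq_has => w; congr (_ && (_ || _)).
by apply: zcn_inp; rewrite ?sb.
Qed.

Lemma zdistE s r u v : s aB 0 = b -> s aNR 0 = nr -> u < nr -> v < nr ->
  (r * nr + u) * nr + v < b ->
  zdist (inp, s) r u v = (s aDIST ((r * nr + u) * nr + v) != 0).
Proof.
move=> sb sn hu hv xb; have [e1 e2 e3 e4] := dist_index r hu hv.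
have l1 : r * nr + u <= b by rewrite -e1 (leq_trans (leq_div _ _)) // ltnW.
have l2 : r <= b by rewrite -e3 (leq_trans (leq_div _ _)).
by rewrite /zdist -[bound _]/(s aB 0) -[zNR _]/(s aNR 0) sb sn hu hv !MlE.
Qed.

Lemma prev_index r u v w : u < nr -> v < nr -> w < nr ->
  (r * nr + u) * nr + w < (r.+1 * nr + u) * nr + v.
Proof.
move=> hu hv hw; apply: (@leq_trans ((r * nr + u).+1 * nr)).
  by rewrite mulSn addnC ltn_add2r.
apply: leq_trans (leq_addr _ _); rewrite leq_mul2r; apply/orP; right.
by rewrite mulSn -addnA -[X in X < _]add0n ltn_add2r (leq_ltn_trans (leq0n u) hu).
Qed.

Lemma dist_table s f : s aB 0 = b -> s aNR 0 = nr ->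
  (forall i, i < s aB 0 -> f i = nextDIST (inp, setarr s aDIST f) i) ->
  forall r u v, u < nr -> v < nr -> (r * nr + u) * nr + v < b ->
  (f ((r * nr + u) * nr + v) != 0) = walk nr (@cnI I) r u v.
Proof.
move=> sb sn hf; elim=> [|r ih] u v hu hv xb; rewrite hf ?sb // nextDISTE //=.
  by case: (u == v).
rewrite (eq_in_has (a2 := fun w => walk nr (@cnI I) r u w && ((w == v) || cnI I w v))).
  by case: has.
move=> w; rewrite mem_iota /= => hw; have lt := ltn_trans (prev_index r hu hv hw) xb.
by rewrite zdistE // -[setarr _ _ _ _ _]/(f _) ih.
Qed.

Lemma dist_local s i f1 f2 : s aB 0 = b -> s aNR 0 = nr -> i < s aB 0 ->
  (forall j, j < i -> f1 j = f2 j) ->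
  nextDIST (inp, setarr s aDIST f1) i = nextDIST (inp, setarr s aDIST f2) i.
Proof.
move=> sb sn; rewrite sb => ib h; case: (posnP nr) => nr0.
  by rewrite /nextDIST -[zNR _]/(s aNR 0) -[zNR (inp, setarr s aDIST f2)]/(s aNR 0) sn nr0 /Md /Dv !divn0 !min0n.
have iE : i = (i %/ nr %/ nr * nr + (i %/ nr) %% nr) * nr + i %% nr by rewrite -!divn_eq.
have hu : (i %/ nr) %% nr < nr by rewrite ltn_mod.
have hv : i %% nr < nr by rewrite ltn_mod.
rewrite iE in ib h *; move: (i %/ nr %/ nr) ((i %/ nr) %% nr) (i %% nr) hu hv ib h.
move=> r u v hu hv ib h; rewrite !nextDISTE //; case: r ib h => // r ib h /=.
congr nat_of_bool; apply: eq_in_has => w; rewrite mem_iota /= => hw.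
have lt := prev_index r hu hv hw.
by rewrite !zdistE ?(ltn_trans lt) // -[setarr _ _ _ _ _]/(f1 _) h.
Qed.

Lemma tables_searching : searching I D b q inp 0 (srun inp (tables P Q) (sized I d q b)).
Proof.
set s0 := sized I d q b; rewrite /tables [srun _ _ _]/=.
rewrite -/(srun inp (SSet aFND (iF Q)) s0) (set_run _ _ _ (iFE Q)).
set s1 := setarr s0 _ _.
have [fp [e2 h2]] := tab_run inp aPOW s1 (tPOWE P).
rewrite -/(srun inp (STab aPOW (tPOW P)) s1) e2; set s2 := setarr s1 _ _.
have [fd [e3 h3]] := tab_run inp aDIST s2 (tDISTE P).
rewrite -/(srun inp (STab aDIST (tDIST P)) s2) e3; set s3 := setarr s2 _ _.
rewrite -/(srun inp (SSet aTOP (tTOP P)) s3) (set_run _ _ _ (tTOPE P)).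
have sb : s2 aB 0 = b by [].
have sn : s2 aNR 0 = nr by [].
have hp i : i < b -> fp i = 2 ^ i.
  apply: (@pow_table s1) => //; apply: h2 => i' f1 f2 _ h; rewrite /nextPOW.
  by case: i' h => // i' h; rewrite /= -[setarr _ _ _ _ _]/(f1 i') h.
have hd := dist_table sb sn (h3 (fun i f1 f2 => @dist_local s2 i f1 f2 sb sn)).
set s4 := setarr s3 _ _.
have nrb : nr <= b by move: hb; clear; lia.
have nbb : nr + nb <= b by move: hb; clear; lia.
have tE : zT (inp, s0) = t by rewrite /zT rdinp_inp.
have dlE : zdl (inp, s4) = k %/ q.
  rewrite /zdl /zK rdinp_inp // -[bound _]/b -[zQ _]/q -[input I d 2]/k /Dv (minn_idPl _) //.
  by apply: leq_trans (leq_div _ _) _; move: hb; clear; lia.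
have hs : static b nr nb k t D q (@cnI I) (@cvI I) inp s4.
  split=> //; try by rewrite rdinp_inp.
  - by move=> u v; apply: (zcn_inp _ _ (s := s4)).
  - by move=> u v; apply: (zcv_inp _ _ (s := s4)).
  - move=> u v hu hv; rewrite dlE.
    have xb : (k %/ q * nr + u) * nr + v < b.
      apply: leq_trans (@range_dist nr nb k D q _ (erefl _)).
      by apply: idx_lt hv; rewrite mulSn addnC ltn_add2r.
    by rewrite zdistE // -hd.
split=> //.
- have hs' : static b nr nb k t D q (@cnI I) (@cvI I) inp s3 by case: hs.
  rewrite -[LHS]/(zpow (inp, s3) (zL (inp, s3))) (zLE hb hs') (zpow_small hs') //.
  exact: range_bits.
- rewrite -[s4 aFND 0]/(zT (inp, s0) == 0 : nat) tE eqb0 negbK => /eqP t0.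
  have -> : out_set I s4 = set0 by apply/setP => i; rewrite !inE.
  by split; rewrite ?cards0 //; [move=> x y; rewrite !inE | rewrite -/t t0].
- rewrite -[s4 aFND 0]/(zT (inp, s0) == 0 : nat) tE => /eqP.
  by rewrite eqb0 -lt0n => t0; split.
Qed.

End Tables.

(** * Output *)

Definition epilogue : program :=
  Seq (Store (ccell 0 0) (Cst 0))
  (Seq (While (Sub (rd (acode aNR).+2 0) (rd 0 0))
         (Seq (Store (Add (rd 0 0) (Cst 1)) (Mem (acell (acode aOUT).+2 (rd 0 0))))
              (Store (ccell 0 0) (Add (rd 0 0) (Cst 1)))))
       (If (rd (acode aFND).+2 0) (Store (Cst 0) (Cst 1)) (Store (Cst 0) (Cst 0)))).

Section Epilogue.

Variables (inp : nat -> nat) (s : state).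
Hypothesis small : s aNR 0 < inp 0.

Record emitting (j : nat) (m : memory) : Prop := Emitting {
  em_base : m 0 = inp 0;
  em_arr : forall a i, m (cell inp (acode a).+2 i) = s a i;
  em_reg : m (cell inp 0 0) = j;
  em_out : forall i, i < j -> m i.+1 = s aOUT i
}.

Lemma emit_eval j m c i : emitting j m -> eval m (rd c i) = m (cell inp c i).
Proof. by move=> h; rewrite /= (em_base h). Qed.

Lemma emit_acell j m c e : emitting j m -> eval m (acell c e) = cell inp c (eval m e).
Proof. by move=> h; rewrite /= (em_base h) /cell; lia. Qed.

Lemma emit_loop n j m : j + n = s aNR 0 -> emitting j m ->
  exists tau m', [/\ exec (While (Sub (rd (acode aNR).+2 0) (rd 0 0))
         (Seq (Store (Add (rd 0 0) (Cst 1)) (Mem (acell (acode aOUT).+2 (rd 0 0))))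
              (Store (ccell 0 0) (Add (rd 0 0) (Cst 1))))) m tau m',
    tau <= 300 * n + 100 & emitting (s aNR 0) m'].
Proof.
elim: n j m => [|n ih] j m jn h.
  exists (ecost (Sub (rd (acode aNR).+2 0) (rd 0 0))).+1, m; split=> //.
    by apply: ExecWhileFalse; rewrite eval_Sub !(emit_eval _ _ h) (em_arr h aNR) (em_reg h) -jn addn0 subnn.
  by rewrite -jn addn0.
have lt : j.+1 < inp 0 by apply: leq_ltn_trans small; rewrite -jn addnS ltnS leq_addr.
set m1 : memory := [eta m with j.+1 |-> s aOUT j].
have g c i : (cell inp c i == j.+1) = false by rewrite gtn_eqF // (leq_trans lt) // leq_addr.
have h1 : emitting j m1.
  split=> [|a i||i ij]; rewrite /m1 /= ?g.
  - by rewrite (em_base h).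
  - exact: em_arr h _ _.
  - exact: em_reg h.
  - by rewrite eqSS ltn_eqF // (em_out h).
set m2 : memory := [eta m1 with cell inp 0 0 |-> j.+1].
have h2 : emitting j.+1 m2.
  have i0 : 0 < inp 0 by apply: leq_ltn_trans lt.
  split=> [|a i||i ij].
  - by rewrite /m2 /= ltn_eqF ?(em_base h1) // /cell addn_gt0 i0.
  - by rewrite /m2 /= cell_inj ?acode_lt16 //= (em_arr h1).
  - by rewrite /m2 /= eqxx.
  - have lt' : i.+1 < cell inp 0 0 by apply: leq_trans (leq_addr _ _); apply: leq_ltn_trans ij lt.
    rewrite /m2 /= ltn_eqF // /m1 /= eqSS; case: eqP => [->|/eqP ne] //.
    by rewrite (em_out h) // ltn_neqAle ne.
have [|tau [m' [e c h']]] := ih j.+1 m2 _ h2; first by rewrite addSnnS.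
eexists; exists m'; split.
- eapply ExecWhileTrue; last exact: e.
    by rewrite eval_Sub !(emit_eval _ _ h) (em_arr h aNR) (em_reg h) -jn addKn.
  eapply (@ExecSeq _ _ _ _ m1).
    apply: exec_store; first by rewrite eval_Add (emit_eval _ _ h) (em_reg h) /= addn1.
    by rewrite eval_Mem (emit_acell _ _ h) (emit_eval _ _ h) (em_reg h) (em_arr h aOUT).
  apply: exec_store; first by rewrite /= (em_base h1).
  by rewrite eval_Add (emit_eval _ _ h1) (em_reg h1) /= addn1.
- by move: c; clear; simpl; lia.
- exact: h'.
Qed.

Lemma epilogue_ok m : rep inp s [::] m -> exists tau m', [/\ exec epilogue m tau m',
  tau <= 300 * s aNR 0 + 300, m' 0 = (s aFND 0 != 0) &
  forall i, i < s aNR 0 -> m' i.+1 = s aOUT i].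
Proof.
move=> H; have i0 : 0 < inp 0 by apply: leq_ltn_trans small.
have h0 : emitting 0 [eta m with cell inp 0 0 |-> 0].
  have H' := rep_reg i0 0 0 H; split=> //.
  - exact: rep0 H'.
  - by move=> a i; exact: rep_arr H' a i.
  - by rewrite /= eqxx.
have [tau [m' [e c h']]] := emit_loop (add0n _) h0.
exists ((ecost (ccell 0 0) + ecost (Cst 0)).+1 + (tau + (ecost (rd (acode aFND).+2 0) + 3).+1)).
exists [eta m' with 0 |-> (s aFND 0 != 0 : nat)]; split.
- apply: ExecSeq (ExecSeq e _).
    by apply: exec_store; rewrite // (eval_ccell i0 _ _ H).
  case: (eqVneq (s aFND 0) 0) => F.
    apply: ExecIfFalse; first by rewrite (emit_eval _ _ h') (em_arr h' aFND).
    exact: (@ExecStore (Cst 0) (Cst 0)).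
  apply: ExecIfTrue; first by rewrite (emit_eval _ _ h') (em_arr h' aFND).
  exact: (@ExecStore (Cst 0) (Cst 1)).
- by move: c; clear; simpl; lia.
- by [].
- by move=> i ij; rewrite /= (em_out h').
Qed.

End Epilogue.

Lemma tcost_mono t b b' : b <= b' -> tcost b t <= tcost b' t.
Proof.
move=> h; elim: t => [c|x|a t ih|t ih|t iht u ihu|t iht u ihu|t iht u ihu v ihv|t ih] //=.
- by rewrite leq_add2r.
- by rewrite leq_add2r.
- by rewrite leq_add2r leq_add.
- by rewrite leq_add2r leq_add.
- by rewrite leq_add2r !leq_add.
- by rewrite leq_add2r leq_mul // leq_add2r.
Qed.

Lemma scost_mono c b b' : b <= b' -> scost b c <= scost b' c.
Proof.
move=> h; elim: c => [a t|a t|c ihc d ihd] /=.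
- by rewrite leq_add2r tcost_mono.
- by rewrite leq_add2r leq_mul // leq_add2r tcost_mono.
- exact: leq_add.
Qed.

Section Main.

Variables (P : terms) (Q : iterms).

Definition algorithm (q : nat) : program :=
  Seq prologue (Seq (set_all (sets Q q)) (Seq (scomp (tables P Q))
    (Seq (wloop (body P)) epilogue))).

(* A statement whose cost bounds that of every part of the program. *)
Definition yardstick : stmt :=
  SSeq (SSet aD (iD Q)) (SSeq (SSet aB (iS Q)) (SSeq (SSet aB (iSq Q))
    (SSeq (tables P Q) (SSeq (body P) (SSet aB (TSum (TCst 0))))))).

Lemma body_counts inp s : srun inp (body P) s aW 0 = (s aW 0).+1.
Proof. by have [? [? [? [? [? [-> _ _]]]]]] := body_run P inp s. Qed.

Lemma algorithm_ok (I : instance) d q : 0 < d -> biclique_free I d -> 0 < q ->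
  exists tau m, [/\ exec (algorithm q) (input I d) tau m,
    tau <= 20 * scost (range I d q) yardstick *
      2 ^ (8 * w_8 (nred I) (nblue I) (budget I) (eff_d I d) q) &
    (output_answer m = 1 /\ solution (budget I + budget I %/ q) (output_set I m)) \/
    (output_answer m = 0 /\ ~ exists S : {set 'I_(nred I)}, solution (budget I) S)].
Proof.
move=> d0 free q0; set b := range I d q; set L := 8 * _.
have DE : 0 < budget I -> eff_d I d = d by rewrite /eff_d; case: eqP => // ->.
have [t1 [m1 [e1 c1 r1]]] := prologue_ok I d.
have [sE sb] := run_sets Q I d q.
have parts : [/\ 120 + 120 * b <= scost b yardstick, scost b (SSet aD (iD Q)) <= scost b yardstick,
    scost b (SSet aB (iS Q)) <= scost b yardstick &
    [/\ scost b (SSet aB (iSq Q)) <= scost b yardstick, scost b (tables P Q) <= scost b yardstick &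
      scost b (body P) + 120 * b + 120 <= scost b yardstick]].
  rewrite /yardstick; move: (tables P Q) (body P) => x y; rewrite /=.
  by split; [| | |split]; clear; lia.
have [p1 p2 p3 [p4 p5 p6]] := parts.
have [|t2 [m2 [e2 c2 r2]]] := @set_all_ok I d (sets Q q) (start I) m1 (scost b yardstick) r1.
  move=> i hi; have h6 := sb i hi.
  have mono c : scost b c <= scost b yardstick ->
      scost (run_all I d (take i (sets Q q)) (start I) aB 0) c <= scost b yardstick.
    by apply: leq_trans; apply: scost_mono.
  case: i hi h6 mono => [|[|[|[|[|[|//]]]]]] _ _ mono; apply: mono => //.
  by apply: leq_trans p1; rewrite /=; clear; lia.
rewrite sE in r2.
have [t3 [m3 [e3 c3 r3]]] := scomp_ok (inp_gt0 I d) (isT : keeps aB (tables P Q)) r2.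
have s3 := tables_searching P Q I d q; rewrite -/b in c3 r3 s3.
set st := srun _ _ _ in r3 s3.
have [t4 [m4 [e4 c4 r4]]] := wloop_ok (inp_gt0 I d) (isT : keeps aB (body P))
  (isT : keeps aTOP (body P)) (body_counts _) r3.
rewrite (se_TOP s3) (se_W s3) subn0 (st_b (se_static s3)) -/L in c4 r4.
have hb : 10 * (nred I + nblue I + budget I + eff_d I d + q + 600) <= b by exact: range_sum.
have hL : L < b by exact: range_bits.
have hV : 2 * budget I * nred I < b by exact: range_product.
have hS : w_nu (nred I) (nblue I) (budget I) (eff_d I d) * (64 * (budget I ^ 3 * eff_d I d)) <= b.
  exact: range_hash.
have s4 := search_all P hb hL hV (2 ^ L) s3.
have se := search_end free d0 DE q0 hb hS s4.
set sf := iter _ _ _ in r4 s4 se.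
have nrE : sf aNR 0 = nred I := st_nr (se_static s4).
have nrb : nred I <= b by move: hb; clear; lia.
have [|t5 [m5 [e5 c5 ans out]]] := @epilogue_ok (inp I d) sf _ m4 r4.
  rewrite nrE; apply: leq_trans (in_end_ge I); rewrite -addn1 addnC leq_add //.
  rewrite mulnDr; apply: leq_trans (leq_addr _ _).
  by case: (nred I) => // n; apply: leq_pmulr.
exists (t1 + (t2 + (t3 + (t4 + t5)))), m5; split.
- by apply: ExecSeq e1 (ExecSeq e2 (ExecSeq e3 (ExecSeq e4 e5))).
- have L0 : 0 < 2 ^ L by rewrite expn_gt0.
  rewrite nrE in c5; rewrite -[sized I d q b aB 0]/b in c3; rewrite [size _]/= in c2.
  have h4 : 2 ^ L * (scost b (body P) + 20) <= 2 ^ L * scost b yardstick.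
    by rewrite leq_mul2l; apply/orP; right; move: p6; clear; lia.
  have h0 : scost b yardstick <= 2 ^ L * scost b yardstick by rewrite leq_pmull.
  rewrite -mulnA [_ * 2 ^ L]mulnC.
  set x := 2 ^ L * scost b yardstick in h4 h0 *; set y := 2 ^ L * _ in c4 h4.
  by clearbody x y; move: c1 c2 c3 c4 c5 h4 h0 p1 p5 nrb; clear; lia.
have outE : output_set I m5 = out_set I sf by apply/setP => i; rewrite !inE out ?nrE.
move: se; rewrite /output_answer ans outE; case: eqP => /= _ h; [right | left]; by split.
Qed.

Lemma algorithm_time : exists K e, forall b, 20 * scost b yardstick <= K * b.+1 ^ e.
Proof.
have [K [e h]] := scost_poly yardstick; exists (20 * K), e => b.
by rewrite -mulnA leq_mul2l h orbT.
Qed.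

End Main.

(** * Running time *)

Lemma cube_le_exp j : j ^ 3 <= 4 * 2 ^ j.
Proof.
elim: j => // j ih; case: (ltnP j 4) => h; first by case: j h ih => [|[|[|[|]]]].
rewrite [2 ^ _]expnS mulnCA; apply: leq_trans (leq_mul (leqnn 2) ih).
rewrite !expnS !expn0 !muln1 -addn1.
have h1 : 4 * (j * j) <= j * (j * j) by rewrite leq_mul2r h orbT.
have h2 : 4 * j <= j * j by rewrite leq_mul2r h orbT.
have -> : (j + 1) * ((j + 1) * (j + 1)) = j * (j * j) + 3 * (j * j) + 3 * j + 1.
  by rewrite !mulnDl !mulnDr !mul1n !muln1; clear; lia.
by move: h1 h2 h; move: (j * (j * j)) (j * j); clear; lia.
Qed.

Lemma exp_bl_le x : 0 < x -> 2 ^ bl x <= 2 * x.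
Proof.
move=> x0; have h := @up_log_gtn 2 x.+1 isT x0.
have p : 0 < bl x by rewrite /bl up_log_gt0.
by rewrite -(prednK p) expnS leq_mul2l -ltnS.
Qed.

Lemma bl_cube x : bl x ^ 3 <= 8 * x.
Proof.
case: (posnP x) => [->|x0]; first by rewrite /bl up_log1.
apply: leq_trans (cube_le_exp _) _; rewrite -[8]/(4 * 2) -mulnA leq_mul2l /=.
exact: exp_bl_le.
Qed.

Lemma cube_add x y : (x + y) ^ 3 <= 8 * (x ^ 3 + y ^ 3).
Proof.
wlog h : x y / x <= y => [wl|].
  by case: (leqP x y) => h; [exact: wl | rewrite addnC [x ^ 3 + _]addnC; apply: wl; apply: ltnW].
apply: (@leq_trans ((2 * y) ^ 3)); first by rewrite leq_exp2r // mul2n -addnn leq_add2r.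
by rewrite expnMn mulnDr leq_addl.
Qed.

Lemma bl_mono x y : x <= y -> bl x <= bl y.
Proof. by move=> h; apply: leq_up_log. Qed.

Section TimeBound.

Variables (nr nb k D q n : nat).
Hypotheses (q0 : 0 < q) (hn : nr + nb + 2 <= n).
Hypotheses (D0 : k = 0 -> D = 0) (D1 : 0 < k -> 0 < D).

Let E := k * (D * (k * k + bl D)).
Let X := E + q * bl n.

Lemma bl_n_gt0 : 0 < bl n.
Proof. by rewrite /bl; apply: leq_trans (leq_up_log 2 (_ : 3 <= _)); rewrite // ltnS (leq_trans _ hn) // addnC. Qed.

Let q_le : q <= X.
Proof. by rewrite /X (leq_trans _ (leq_addl _ _)) // leq_pmulr // bl_n_gt0. Qed.

Let lam_le : bl n <= X.
Proof. by rewrite /X (leq_trans _ (leq_addl _ _)) // leq_pmull. Qed.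

Lemma E_bounds : [/\ k <= E, D <= E, k * D <= E, k * (D * k) <= E & [/\ k * bl D <= E,
  k * (k * (k * D)) <= E & k * k <= E]].
Proof.
case: (posnP k) => [k0|k0]; first by rewrite k0 (D0 k0).
have d0 := D1 k0; have kk0 : 0 < k * k by rewrite muln_gt0 k0.
have -> : E = k * (D * (k * k)) + k * (D * bl D) by rewrite /E !mulnDr.
have e0 : k * (k * (k * D)) <= k * (D * (k * k)) by rewrite (mulnA k k D) [k * k * D]mulnC.
have w x y z : x <= y -> x <= y + z by move=> h; apply: leq_trans h (leq_addr _ _).
split; [apply: w|apply: w|apply: w|apply: w|split; [|exact: w|apply: w]].
- by rewrite leq_pmulr // muln_gt0 d0.
- by rewrite mulnCA leq_pmulr // muln_gt0 k0.
- by rewrite leq_mul2l leq_pmulr ?orbT.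
- by rewrite leq_mul2l leq_mul2l leq_pmull ?orbT.
- by apply: leq_trans (leq_addl _ _); rewrite leq_mul2l leq_pmull ?orbT.
- by rewrite leq_mul2l (leq_trans (leq_pmull k k0)) ?orbT // leq_pmull.
Qed.

Let E_le : E <= X. Proof. exact: leq_addr. Qed.

Let w_n_le_bl : w_n nr nb <= bl n.
Proof. by apply: bl_mono; rewrite addnA. Qed.

Definition cube_factor : nat := 64 * (216 * 8 + 8 * 8 + 8 + 16 * (16 * 16)).

Lemma nu_cube : w_nu nr nb k D * (w_nu nr nb k D * w_nu nr nb k D) <=
  cube_factor * X.
Proof.
rewrite /cube_factor.
have -> : w_nu nr nb k D * (w_nu nr nb k D * w_nu nr nb k D) = w_nu nr nb k D ^ 3.
  by rewrite !expnS expn0 muln1.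
have [hk hD _ _ _] := E_bounds.
rewrite /w_nu addnA; apply: leq_trans (cube_add _ _) _.
have c1 := cube_add (6 * bl k) (2 * bl D); rewrite !expnMn in c1.
have c2 := cube_add (bl (w_n nr nb)) 16.
have k3 := bl_cube k; have D3 := bl_cube D.
have n3 : bl (w_n nr nb) ^ 3 <= 8 * bl n.
  by apply: leq_trans (bl_cube _) _; rewrite leq_mul2l w_n_le_bl.
have X1 : 16 ^ 3 <= 16 * (16 * 16) * X.
  by rewrite leq_pmulr // (leq_trans q0) // q_le.
rewrite -[6 ^ 3]/216 -[2 ^ 3]/8 in c1.
move: c1 c2 k3 D3 n3 X1 hk hD E_le lam_le.
move: (_ ^ 3) (_ ^ 3) (_ ^ 3) (_ ^ 3) (_ ^ 3) (_ ^ 3).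
clear; lia.
Qed.

Lemma nu_linear : w_nu nr nb k D <= cube_factor * X.
Proof.
apply: leq_trans nu_cube; rewrite -[X in X <= _]muln1 leq_mul2l muln_gt0.
by case: (w_nu nr nb k D).
Qed.

Lemma om_bound : (2 * k + 8) * w_om nr nb k D <= (400 + 8 * cube_factor) * X.
Proof.
case: (posnP k) => [k0|k0].
  have -> : w_om nr nb k D = w_nu nr nb k D.
    by rewrite /w_om (D0 k0) mul0n /bl up_log1.
  rewrite [in 2 * k]k0 muln0 add0n mulnDl -mulnA; apply: leq_trans (leq_addl _ _).
  by rewrite leq_mul2l nu_linear.
have [h1 h2 h3 h4 [h5 h6 h7]] := E_bounds.
have bk : bl k <= k := bl_le k.
have h8 : k * (D * bl k) <= E by apply: leq_trans h4; rewrite leq_mul2l leq_mul2l bk !orbT.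
have h9 : k * bl k <= E by apply: leq_trans h7; rewrite leq_mul2l bk orbT.
have h10 : k * bl (w_n nr nb) <= k * k + 8 * bl n.
  case: (leqP (bl (w_n nr nb)) k) => h.
    by rewrite (leq_trans _ (leq_addr _ _)) // leq_mul2l h orbT.
  apply: leq_trans (leq_addl _ _).
  apply: (@leq_trans (bl (w_n nr nb) ^ 3)); last first.
    by apply: leq_trans (bl_cube _) _; rewrite leq_mul2l w_n_le_bl.
  rewrite !expnS expn0 muln1 mulnC leq_mul2l (leq_trans (ltnW h)) ?orbT //.
  by rewrite leq_pmulr // (leq_ltn_trans _ h).
apply: (@leq_trans (400 * X)); last by rewrite leq_mul2r leq_addr orbT.
apply: (@leq_trans ((10 * k) * w_om nr nb k D)).
  by rewrite leq_mul2r; apply/orP; right; move: k0; clear; lia.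
rewrite -mulnA -[400]/(10 * 40) -mulnA leq_mul2l /=.
rewrite /w_om /w_nu; move: (bl (w_n nr nb)) h10 => w h10.
have -> : k * (bl D + (D * (3 * bl k + 3) + (6 * bl k + (2 * bl D + (w + 16))))) =
    3 * (k * bl D) + 3 * (k * (D * bl k)) + 3 * (k * D) + 6 * (k * bl k) + k * w + 16 * k.
  by move: (bl D) (bl k) => x y; clear; lia.
have hl := lam_le; move: h1 h3 h5 h8 h9 h10 h7 E_le hl.
move: (k * bl D) (k * (D * bl k)) (k * D) (k * bl k) (k * w) (k * k) => a1 a2 a3 a4 a5 a6.
by clear; lia.
Qed.

Lemma bits_bound : 8 * w_8 nr nb k D q <= 8 * (4 + (400 + 9 * cube_factor + 512)) * X.
Proof.
have h1 : (2 * q + 2) * w_n nr nb <= 4 * X.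
  apply: (@leq_trans ((4 * q) * bl n)).
    by rewrite leq_mul ?w_n_le_bl //; move: q0; clear; lia.
  by rewrite -mulnA leq_mul2l /X leq_addl.
have [_ _ _ _ [_ h2 _]] := E_bounds; have h3 := om_bound; have h4 := nu_cube.
rewrite -mulnA leq_mul2l /= /w_8.
move: h1 h2 h3 h4 E_le; move: cube_factor (_ * w_n _ _) (_ * w_om _ _ _ _) (w_nu _ _ _ _ * _) (k * _).
clear => c x y z v; rewrite !mulnDl; lia.
Qed.

Lemma size_bound : nr + nb + k + D + q + 600 <= 2 ^ (13 * X).
Proof.
have [h1 h2 _ _ _] := E_bounds; have X0 : 0 < X := leq_trans q0 q_le.
have le x y : x <= y -> y <= X -> x <= 2 ^ X.
  by move=> xy yX; rewrite (leq_trans xy) // (leq_trans (ltnW (ltn_expl y (isT : 1 < 2)))) // leq_exp2l.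
have a1 : nr + nb <= 2 ^ X.
  apply: (@leq_trans (2 ^ bl n)); last by rewrite leq_exp2l.
  by apply: leq_trans (le_bl n); apply: leq_trans hn; exact: leq_addr.
have a2 := le _ _ (leqnn k) (leq_trans h1 E_le).
have a3 := le _ _ (leqnn D) (leq_trans h2 E_le).
have a4 := le _ _ (leqnn q) q_le.
have a5 : 600 <= 2 ^ (10 * X).
  by apply: (@leq_trans (2 ^ 10)) => //; rewrite leq_exp2l // leq_pmulr.
have a6 : 2 ^ X <= 2 ^ (10 * X) by rewrite leq_exp2l // leq_pmull.
rewrite -[13]/(3 + 10) mulnDl expnD.
apply: (@leq_trans (8 * 2 ^ (10 * X))).
  by move: a1 a2 a3 a4 a5 a6; move: (2 ^ X) (2 ^ (10 * X)); clear; lia.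
by rewrite leq_mul2r; apply/orP; right; rewrite -[8]/(2 ^ 3) leq_exp2l // leq_pmulr.
Qed.

Lemma total_bound K e : K * ((nr + nb + k + D + q + 600) ^ 8).+1 ^ e * 2 ^ (8 * w_8 nr nb k D q) <=
  2 ^ ((K + 117 * e + 8 * (4 + (400 + 9 * cube_factor + 512))) * X).
Proof.
have X0 : 0 < X := leq_trans q0 q_le.
have M1 : 1 < nr + nb + k + D + q + 600 by apply: leq_trans (leq_addl _ _).
move: size_bound M1; move: (nr + nb + k + D + q + 600) => M hM M1.
have h1 : K <= 2 ^ (K * X).
  by apply: (@leq_trans (2 ^ K)); [exact: ltnW (ltn_expl _ _) | rewrite leq_exp2l // leq_pmulr].
have h2 : (M ^ 8).+1 <= 2 ^ (13 * X * 9).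
  apply: (@leq_trans (M ^ 9)); last by rewrite expnM leq_exp2r.
  rewrite (expnS M 8); apply: (@leq_trans (2 * M ^ 8)); last by rewrite leq_mul2r M1 orbT.
  by rewrite mul2n -addnn -addn1 leq_add2l expn_gt0 (ltnW M1).
have h3 : (M ^ 8).+1 ^ e <= 2 ^ (117 * e * X).
  have -> : 117 * e * X = (13 * X * 9) * e by clear; lia.
  exact: exp_le_exp.
move: bits_bound; move: (8 * (4 + _)) (8 * w_8 nr nb k D q) => c w hw.
rewrite (mulnDl (K + _)) (mulnDl K) !expnD; apply: leq_mul; first exact: leq_mul.
by rewrite leq_exp2l.
Qed.

End TimeBound.

Import Order.TTheory GRing.Theory Num.Theory.
Local Open Scope ring_scope.

Section Reals.

Variable R : realType.

Lemma ln2_gt0 : 0 < ln 2 :> R.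
Proof. by rewrite ln_gt0 // ltr1n. Qed.

Lemma bl_le_log (d : nat) : (0 < d)%N -> (bl d)%:R <= 1 + ln d%:R / ln 2 :> R.
Proof.
move=> d0; have l2 := ln2_gt0.
rewrite -(ler_pM2r l2) mulrDl mul1r divfK ?gt_eqF //.
have -> : (bl d)%:R * ln 2 = ln ((2 ^ bl d)%:R : R) by rewrite natrX lnXn // mulr_natl.
rewrite -lnM ?posrE ?ltr0n // -natrM ler_ln ?posrE ?ltr0n ?expn_gt0 ?muln_gt0 ?d0 // ler_nat.
exact: exp_bl_le.
Qed.

Lemma exponent_le (k d D : nat) : (0 < d)%N -> ((0 < k)%N -> D = d) ->
  (k * (D * (k * k + bl D)))%:R <=
  2 * (k%:R * d%:R * (k%:R ^+ 2 + ln d%:R / ln 2)) :> R.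
Proof.
move=> d0 hD; case: (posnP k) => [->|k0]; first by rewrite !mul0r mulr0.
rewrite hD // !natrM natrD natrM -!mulrA [2 * _]mulrCA ler_wpM2l ?ler0n //.
rewrite [2 * _]mulrCA ler_wpM2l ?ler0n //.
have h := bl_le_log d0; have k1 : 1 <= k%:R :> R by rewrite ler1n.
have l0 : 0 <= ln d%:R / ln 2 :> R.
  by rewrite divr_ge0 ?(ltW ln2_gt0) // ln_ge0 // ler1n.
have kk : 1 <= k%:R ^+ 2 :> R by rewrite expr_ge1.
move: h kk l0; rewrite -expr2; move: (_ / _) (_ ^+ 2) (bl d)%:R => x y z; lra.
Qed.

Lemma time_real (C k d D q n time : nat) (eps : R) : 0 < eps -> (0 < d)%N ->
  ((0 < k)%N -> D = d) -> (1 < n)%N -> q%:R <= 1 + eps^-1 ->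
  (time <= 2 ^ (C * (k * (D * (k * k + bl D)) + q * bl n)))%N ->
  time%:R <= 2 `^ ((2 * C)%:R * (k%:R * d%:R * (k%:R ^+ 2 + ln d%:R / ln 2)))
             * n%:R `^ ((2 * C)%:R * (1 + eps^-1)) :> R.
Proof.
move=> e0 d0 hD n1 hq ht.
have n0 : (0 < n)%N := ltnW n1.
have h : (time <= 2 ^ (C * (k * (D * (k * k + bl D)))) * n ^ (2 * (C * q)))%N.
  apply: leq_trans ht _; rewrite mulnDr expnD leq_mul2l; apply/orP; right.
  rewrite mulnA (mulnC _ (bl n)) (expnM 2) (expnM n); case: (C * q)%N => // m; rewrite leq_exp2r //.
  by apply: leq_trans (exp_bl_le n0) _; rewrite leq_mul2r n1 orbT.
apply: (@le_trans _ _ (2 ^ (C * (k * (D * (k * k + bl D)))) * n ^ (2 * (C * q)))%N%:R).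
  by rewrite ler_nat.
have pw (x y : nat) : (x ^ y)%N%:R = x%:R `^ y%:R :> R by rewrite natrX powR_mulrn ?ler0n.
rewrite natrM !pw ler_pM ?powR_ge0 //.
- rewrite ler_powR ?ler1n // (natrM _ C) (mulnC 2 C) (natrM _ C 2) -[C%:R * 2 * _]mulrA.
  by apply: ler_wpM2l; [rewrite ler0n | apply: exponent_le].
- by rewrite ler_powR ?ler1n // mulnA natrM ler_wpM2l.
Qed.

End Reals.

Theorem theorem1p2 (R : realType) :
  exists C : nat, forall eps : R, 0 < eps ->
  exists P : program, forall (I : instance) (d : nat),
    (1 <= d)%N -> biclique_free I d ->
    let k : R := (budget I)%:R in
    let log2d : R := ln d%:R / ln 2 in
    exists (time : nat) (m : memory),
      [/\ exec P (input I d) time m,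
          time%:R <= 2 `^ (C%:R * (k * d%:R * (k ^+ 2 + log2d)))
                     * (instance_size I)%:R `^ (C%:R * (1 + eps^-1)) :> R
        & let S := output_set I m in
          (output_answer m = 1%N /\
             [/\ #|S|%:R <= (1 + eps) * k,
                 induced_connected (@conn I) S
               & (demand I <= #|covered S|)%N])
          \/
          (output_answer m = 0%N /\
             ~ exists S' : {set 'I_(nred I)},
                 [/\ (#|S'| <= budget I)%N,
                     induced_connected (@conn I) S'
                   & (demand I <= #|covered S'|)%N])].
Proof.
have [P] := terms_exist; have [Q] := iterms_exist.
have [K [e hK]] := algorithm_time P Q.
set C := (K + 117 * e + 8 * (4 + (400 + 9 * cube_factor + 512)))%N.
exists (2 * C)%N => eps e0; set q := (Num.truncn eps^-1).+1.
have i0 : 0 <= eps^-1 by rewrite invr_ge0 ltW.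
have q_le : q%:R <= 1 + eps^-1.
  by rewrite -natr1 addrC lerD2l; have /andP [] := truncn_itv i0.
have q_ge : eps^-1 <= q%:R by apply: ltW; have /andP [] := truncn_itv i0.
exists (algorithm P Q q) => I d d0 free k log2d.
have [tau [m [e1 ht ans]]] := @algorithm_ok P Q I d q d0 free isT.
exists tau, m; split=> //.
- have n_ge : (nred I + nblue I + 2 <= instance_size I)%N.
    by rewrite /instance_size /bit_length; lia.
  apply: (@time_real R C _ _ (eff_d I d) q) => //.
  + by rewrite /eff_d; case: eqP => // ->.
  + by apply: leq_trans n_ge; rewrite leq_addl.
  + apply: leq_trans ht _.
    have D0 : budget I = 0%N -> eff_d I d = 0%N by rewrite /eff_d => ->.
    have D1 : (0 < budget I)%N -> (0 < eff_d I d)%N by rewrite /eff_d; case: eqP => // ->.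
    apply: leq_trans (total_bound (isT : (0 < q)%N) n_ge D0 D1 K e).
    by rewrite leq_mul2r; apply/orP; right; exact: hK.
- case: ans => [[a1 [h1 h2 h3]]|[a0 no]]; [left | right]; split=> //.
  split=> //; apply: (@le_trans _ _ (budget I + budget I %/ q)%N%:R); first by rewrite ler_nat.
  rewrite natrD mulrDl mul1r lerD2l.
  have q0 : 0 < q%:R :> R by rewrite ltr0n.
  apply: (@le_trans _ _ (k / q%:R)).
    by rewrite ler_pdivlMr // -natrM ler_nat leq_trunc_div.
  by rewrite ler_pdivrMr // mulrAC ler_peMl ?ler0n // -ler_pdivrMl // mulr1.
Qed.
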